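(* Let $A$ be a totally definite quaternion algebra over a totally real number field $K$ of degree $n=[K:\mathbb{Q}]$, and let $\Lambda$ be an $\mathcal{O}_K$-order of $A$ with reduced norm one group $\Lambda^1$. 1. If $[K:\mathbb{Q}]=1$, then $\Lambda^1$ contains a $\mathbb{Q}$-basis for $A$ if and only if $\Lambda^1$ is isomorphic to the binary tetrahedral group or to the binary dihedral group of order $4m$ for some $m$ with $\varphi(2m)=2$. 2. If $[K:\mathbb{Q}]=2$, then $\Lambda^1$ contains a $\mathbb{Q}$-basis for $A$ if and only if either $\Lambda^1$ is isomorphic to the binary octahedral group or to the binary icosahedral group, or, for some $m$, $\Lambda^1$ is isomorphic to the binary dihedral group of order $4m$ and $K=\mathbb{Q}(\zeta_{2m}+\zeta_{2m}^{-1})$. 3. If $[K:\mathbb{Q}]>2$, then $\Lambda^1$ contains a $\mathbb{Q}$-basis for $A$ if and only if, for some $m$, $\Lambda^1$ is isomorphic to the binary dihedral group of order $4m$ and $K=\mathbb{Q}(\zeta_{2m}+\zeta_{2m}^{-1})$.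
   Context: A quaternion algebra over a number field $K$ is $A=\left(\frac{a,b}{K}\right)=K\oplus Ki\oplus Kj\oplus Kij$ with $i^2=a$, $j^2=b$, $ij=-ji$, $a,b\in K^\times$. It is totally definite if $A\otimes_{\mathbb{Q}}\mathbb{R}\cong\mathbb{H}^n$, where $n=[K:\mathbb{Q}]$ and $\mathbb{H}$ denotes the Hamilton quaternions (then $K$ is totally real). For $x=x_0+x_1i+x_2j+x_3ij$, the conjugate is $\overline{x}=x_0-x_1i-x_2j-x_3ij$ and the reduced norm is $n_{A/K}(x)=x\overline{x}\in K$. $\mathcal{O}_K$ is the ring of integers of $K$. An $\mathcal{O}_K$-order $\Lambda$ of $A$ is a subring of $A$ containing $1$ that is a finitely generated $\mathcal{O}_K$-module containing a $K$-basis of $A$. Its reduced norm one group is $\Lambda^1=\{x\in\Lambda : n_{A/K}(x)=1\}$. Groups: the binary dihedral group of order $4m$ ($m$ a positive integer) is $\langle x,y\mid y^{2m}=1,\ x^2=y^m,\ xyx^{-1}=y^{-1}\rangle$; the binary tetrahedral group (order 24), binary octahedral group (order 48), binary icosahedral group (order 120) are $\langle x,y,z\mid x^2=y^3=z^c=xyz\rangle$ with $c=3,4,5$ respectively. $\varphi$ is Euler's totient function and $\zeta_{2m}$ is a primitive $2m$-th root of unity. Equality of the abstract number field $K$ with a subfield of $\mathbb{C}$ is understood as isomorphism of fields. *)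

(* Defs.v *)
From HB Require Import structures.
From mathcomp Require Import all_boot all_order all_algebra all_fingroup.
From mathcomp Require Import all_solvable all_field.
From mathcomp Require Import reals complex ring.

Set Implicit Arguments.
Unset Strict Implicit.
Unset Printing Implicit Defensive.

Import GRing.Theory.
Local Open Scope ring_scope.

(* [Quat a b x0 x1 x2 x3] is x0 + x1 i + x2 j + x3 ij in (a, b / K). *)
Record quat (K : fieldType) (a b : K) :=
  Quat { qre : K; qi : K; qj : K; qij : K }.

Section QuaternionAlgebra.

Variables (K : fieldType) (a b : K).
Local Notation A := (quat a b).
Implicit Types x y z : A.

Definition quat_to_prod x := (qre x, qi x, qj x, qij x).
Definition quat_of_prod (p : K * K * K * K) : A :=
  let: (x0, x1, x2, x3) := p in Quat a b x0 x1 x2 x3.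

Lemma quat_to_prodK : cancel quat_to_prod quat_of_prod.
Proof. by case. Qed.

HB.instance Definition _ := Choice.copy A (can_type quat_to_prodK).

Definition qadd x y : A :=
  Quat a b (qre x + qre y) (qi x + qi y) (qj x + qj y) (qij x + qij y).
Definition qopp x : A := Quat a b (- qre x) (- qi x) (- qj x) (- qij x).
Definition qzero : A := Quat a b 0 0 0 0.

Fact qaddA : associative qadd.
Proof. by move=> x y z; rewrite /qadd /= !addrA. Qed.
Fact qaddC : commutative qadd.
Proof. by move=> x y; congr Quat; rewrite addrC. Qed.
Fact qadd0 : left_id qzero qadd.
Proof. by case=> *; rewrite /qadd /= !add0r. Qed.
Fact qaddN : left_inverse qzero qopp qadd.
Proof. by case=> *; rewrite /qadd /= !addNr. Qed.

HB.instance Definition _ := GRing.isZmodule.Build A qaddA qaddC qadd0 qaddN.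

(* The K-bilinear product determined by i^2 = a, j^2 = b, ij = -ji. *)
Definition qmul x y : A :=
  let: Quat x0 x1 x2 x3 := x in
  let: Quat y0 y1 y2 y3 := y in
  Quat a b
    (x0 * y0 + a * (x1 * y1) + b * (x2 * y2) - a * b * (x3 * y3))
    (x0 * y1 + x1 * y0 - b * (x2 * y3) + b * (x3 * y2))
    (x0 * y2 + x2 * y0 + a * (x1 * y3) - a * (x3 * y1))
    (x0 * y3 + x3 * y0 + x1 * y2 - x2 * y1).
Definition qone : A := Quat a b 1 0 0 0.

Fact qmulA : associative qmul.
Proof. by do 3![case=> ????]; rewrite /qmul; congr Quat; ring. Qed.
Fact qmul1l : left_id qone qmul.
Proof. by case=> *; rewrite /qmul; congr Quat; ring. Qed.
Fact qmul1r : right_id qone qmul.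
Proof. by case=> *; rewrite /qmul; congr Quat; ring. Qed.
Fact qmulDl : left_distributive qmul qadd.
Proof. by do 3![case=> ????]; rewrite /qmul /qadd /=; congr Quat; ring. Qed.
Fact qmulDr : right_distributive qmul qadd.
Proof. by do 3![case=> ????]; rewrite /qmul /qadd /=; congr Quat; ring. Qed.
Fact qone_neq0 : qone != 0.
Proof. by apply/eqP=> -[/eqP]; rewrite oner_eq0. Qed.

HB.instance Definition _ := GRing.Zmodule_isNzRing.Build A
  qmulA qmul1l qmul1r qmulDl qmulDr qone_neq0.

Definition qscale (c : K) x : A :=
  Quat a b (c * qre x) (c * qi x) (c * qj x) (c * qij x).

Fact qscaleA c d x : qscale c (qscale d x) = qscale (c * d) x.
Proof. by rewrite /qscale /= !mulrA. Qed.
Fact qscale1 : left_id 1 qscale.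
Proof. by case=> *; rewrite /qscale /= !mul1r. Qed.
Fact qscaleDr : right_distributive qscale +%R.
Proof. by move=> c x y; congr Quat; rewrite /= mulrDr. Qed.
Fact qscaleDl x : {morph qscale^~ x : c d / c + d}.
Proof. by move=> c d; congr Quat; rewrite /= mulrDl. Qed.

HB.instance Definition _ := GRing.Zmodule_isLmodule.Build K A
  qscaleA qscale1 qscaleDr qscaleDl.

Fact qscaleAl (c : K) x y : c *: (x * y) = c *: x * y.
Proof. by case: x y => ????[????]; congr Quat; rewrite /=; ring. Qed.
Fact qscaleAr (c : K) x y : c *: (x * y) = x * (c *: y).
Proof. by case: x y => ????[????]; congr Quat; rewrite /=; ring. Qed.

HB.instance Definition _ := GRing.Lmodule_isLalgebra.Build K A qscaleAl.
HB.instance Definition _ := GRing.Lalgebra_isAlgebra.Build K A qscaleAr.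

Definition qconj x : A := Quat a b (qre x) (- qi x) (- qj x) (- qij x).

(* x * qconj x lies in the copy K 1 of K, so its first coordinate is the
   reduced norm. *)
Definition qnorm x : K := qre (x * qconj x).

Lemma qscalarE (c : K) : c%:A = Quat a b c 0 0 0 :> A.
Proof.
transitivity (Quat a b (c * 1) (c * 0) (c * 0) (c * 0)); first by [].
by rewrite mulr1 mulr0.
Qed.

Lemma qnormE x : x * qconj x = (qnorm x)%:A.
Proof.
rewrite qscalarE; case: x => x0 x1 x2 x3.
by rewrite /qnorm /qconj -[_ * _]/(qmul _ _) /=; congr Quat; ring.
Qed.

Lemma quat_ii : Quat a b 0 1 0 0 * Quat a b 0 1 0 0 = a%:A.
Proof. by rewrite qscalarE -[_ * _]/(qmul _ _) /=; congr Quat; ring. Qed.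
Lemma quat_jj : Quat a b 0 0 1 0 * Quat a b 0 0 1 0 = b%:A.
Proof. by rewrite qscalarE -[_ * _]/(qmul _ _) /=; congr Quat; ring. Qed.
Lemma quat_ij : Quat a b 0 1 0 0 * Quat a b 0 0 1 0 = Quat a b 0 0 0 1.
Proof. by rewrite -[_ * _]/(qmul _ _) /=; congr Quat; ring. Qed.
Lemma quat_ji : Quat a b 0 0 1 0 * Quat a b 0 1 0 0 = - Quat a b 0 0 0 1.
Proof.
by rewrite -[_ * _]/(qmul _ _) -[- _]/(qopp _) /qopp /=; congr Quat; ring.
Qed.

End QuaternionAlgebra.

(* X is a basis of V over S, acting on V through f : S -> K.  Passing f
   explicitly lets a K-space be viewed as a Q-space without a second (and
   conflicting) canonical module structure on V. *)
Definition is_basis_via (S K : nzRingType) (V : lmodType K) (f : S -> K)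
    (X : seq V) : Prop :=
  forall v : V, exists! c : {ffun 'I_(size X) -> S},
    v = \sum_(i < size X) f (c i) *: X`_i.

Section NumberField.

Variable K : fieldExtType rat.

Definition is_algint (x : K) : Prop := integralOver (intr : int -> K) x.

Definition totally_real (R : realType) : Prop :=
  forall (f : {rmorphism K -> R[i]}) (x : K), f x \is Num.real.

Variables a b : K.
Local Notation A := (quat a b).

Definition balanced (R : realType) (M : zmodType) (t : A -> R -> M) : Prop :=
  [/\ forall x y r, t (x + y) r = t x r + t y r,
      forall x r s, t x (r + s) = t x r + t x s
    & forall (q : rat) x r, t (q%:A *: x) r = t x (ratr q * r)].

(* Universal property of the tensor product of A and R over Q. *)
Definition is_tensor_product (R : realType) (T : zmodType)
    (t : A -> R -> T) : Prop :=
  balanced t /\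
  forall (M : zmodType) (g : A -> R -> M), balanced g ->
    exists2 h : {additive T -> M}, (forall x r, h (t x r) = g x r)
      & forall h' : {additive T -> M},
          (forall x r, h' (t x r) = g x r) -> h' =1 h.

(* The R-algebra H^n, n = [K : Q], is (isomorphic to) the tensor product over
   Q of A and R: t x r is the image of the pure tensor of x and r. *)
Definition totally_definite (R : realType) : Prop :=
  exists t : A -> R -> {ffun 'I_(\dim {:K}) -> quat (-1 : R) (-1 : R)},
    [/\ is_tensor_product t,
        t 1 1 = 1,
        forall x y r s, t (x * y) (r * s) = t x r * t y s
      & forall x r s, t x (r * s) = r *: t x s].

Definition is_fg_intmod (L : {pred A}) : Prop :=
  exists s : seq A, forall x : A,
    x \in L <-> exists c : 'I_(size s) -> K,
      (forall i, is_algint (c i)) /\ x = \sum_(i < size s) c i *: s`_i.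

Definition is_order (L : {pred A}) : Prop :=
  [/\ GRing.subring_closed L,
      is_fg_intmod L
    & exists2 X : seq A, {subset X <= L} & is_basis_via (@id K) X].

Definition norm_one (L : {pred A}) : {pred A} :=
  [pred x | (x \in L) && (qnorm x == 1)].

Definition contains_Qbasis (S : {pred A}) : Prop :=
  exists2 X : seq A, {subset X <= S} & is_basis_via (in_alg K) X.

(* The multiplicative structure S inherits from A is a group isomorphic to the
   finite group G. *)
Definition mul_isog (S : {pred A}) (gT : finGroupType) (G : {group gT}) :
    Prop :=
  exists f : gT -> A,
    [/\ {in G &, injective f},
        {in G &, forall g h, f (g * h)%g = f g * f h}
      & forall x, x \in S <-> exists2 g, g \in G & f g = x].

End NumberField.

(* [\isog Grp] determines a finite group up to isomorphism as the largest
   finite quotient of the presented group; the groups presented below are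
   finite, so this is the presented group itself. *)
Definition binary_dihedral (m : nat) (gT : finGroupType) (G : {group gT}) :
    Prop :=
  (G \isog Grp (x : y :
     (y ^+ (2 * m), x ^+ 2 = y ^+ m, x * y * x^-1 = y^-1)))%g.

Definition binary_polyhedral (c : nat) (gT : finGroupType) (G : {group gT}) :
    Prop :=
  (G \isog Grp (x : y : z :
     (x ^+ 2 = x * y * z, y ^+ 3 = x * y * z, z ^+ c = x * y * z)))%g.

Definition binary_tetrahedral := binary_polyhedral 3.
Definition binary_octahedral := binary_polyhedral 4.
Definition binary_icosahedral := binary_polyhedral 5.

Definition mul_isog_to (K : fieldExtType rat) (a b : K)
    (S : {pred quat a b})
    (P : forall gT : finGroupType, {group gT} -> Prop) : Prop :=
  exists (gT : finGroupType) (G : {group gT}), P gT G /\ mul_isog S G.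

(* Membership in Q(z), the smallest subfield of C containing z. *)
Definition in_adjoin (C : fieldType) (z x : C) : Prop :=
  forall S : {pred C}, GRing.divring_closed S -> z \in S -> x \in S.

(* K is isomorphic to the subfield Q(zeta + zeta^-1) of C, zeta a primitive
   2m-th root of unity. *)
Definition is_real_cyclotomic (R : realType) (K : fieldExtType rat) (m : nat) :
    Prop :=
  exists2 zeta : R[i], (2 * m).-primitive_root zeta
    & exists f : {rmorphism K -> R[i]}, forall y : R[i],
        in_adjoin (zeta + zeta^-1) y <-> exists x : K, f x = y.

(* Main.v *)
(* Each of the n real places of K embeds A in the Hamilton quaternions, and
   these embeddings bound the norm one elements of an order in every coordinate,
   so [norm_one L] is a finite group of unit quaternions.  A nonabelian one is
   binary dihedral or binary polyhedral: either conjugation makes it invert a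
   cyclic subgroup, or comparing the traces of the elements closest to 1 with
   those of their powers and commutators forces the largest nontrivial trace t
   to be 1, sqrt 2 or the golden ratio, with two generators of trace t whose
   product has trace 1.

   If the group generated by g and h spans A over Q, then the field generated
   by qtr g, qtr h and qtr (g h) is K; conversely a noncommuting pair together
   with K = Q(qtr y), y in the group, spans A over Q because qtr y = y + y^-1.
   For the polyhedral groups Q(t) has degree 1, 2, 2, and in the dihedral case
   K = Q(qtr y), where qtr y is the sum of a primitive 2m-th root of unity and
   its inverse. *)

From HB Require Import structures.
Require Import Defs.
From mathcomp Require Import all_boot all_order all_algebra all_fingroup.
From mathcomp Require Import all_solvable all_field.
From mathcomp Require Import reals.
From mathcomp Require Import complex boolp ring lra zify.

Set Implicit Arguments.
Unset Strict Implicit.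
Unset Printing Implicit Defensive.

(** * Presentations of the binary polyhedral and dihedral groups *)

(** Identifying a group with a presented one takes two bounds. Every finite group satisfying the
    relations has at most N elements, by enumerating cosets of a cyclic subgroup; the group at hand
    has at least N, because N divides its order. The bound t^2 <= t + 1 on the largest nontrivial
    trace comes from a noncommuting pair a, b of trace t chosen as close to each other as possible:
    the pair b, a b a^-1 has the same traces and cannot be closer. That two elements generate the
    whole polyhedral group is a metric fact. In each coset of the subgroup J they generate, take the
    element nearest to 1. If it is not 1 or -1, its coordinates along an orthonormal frame lying in
    J are too small for a unit vector. The places come from the universal property of the tensor
    product: the n coordinates of H^n restrict to embeddings of K, and uniqueness of the induced map
    makes them linearly independent over R. Independence is what identifies the trace of K with the
    sum of the places, and what lets an element be recovered from its traces against a rational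
    basis. *)

Section Presentations.

Import GroupScope.

Section CosetEnumeration.

Variables (gT : finGroupType) (a b : gT).

(** The elements whose right multiplication preserves [X] form a submonoid, which in a finite group
    is a subgroup; evaluate it at 1. *)
Lemma gen2_sub_stable (X : {set gT}) :
    1 \in X -> {in X, forall x, x * a \in X} -> {in X, forall x, x * b \in X} ->
  <<[set a; b]>> \subset X.
Proof.
move=> X1 Xa Xb.
pose S := [set g | [forall x in X, x * g \in X]].
have inS g : reflect {in X, forall x, x * g \in X} (g \in S).
  by rewrite inE; apply: (iffP forall_inP).
have gS : group_set S.
  apply/group_setP; split; first by apply/inS => x; rewrite mulg1.
  move=> g h /inS Sg /inS Sh; apply/inS => x Xx; rewrite mulgA.
  exact/Sh/Sg.
have sSX : <<[set a; b]>> \subset Group gS.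
  by rewrite gen_subG; apply/subsetP => g /set2P[] ->; apply/inS.
apply/subsetP => g /(subsetP sSX)/inS /(_ 1 X1).
by rewrite mul1g.
Qed.

(** [W] lists representatives of right cosets of [<[a]>], and the two hypotheses are the coset
    tables of [a] and [b]. The representatives need not be distinct, since only an upper bound is
    drawn. *)
Lemma card_coset_enum (W : seq gT) :
    1 \in W ->
    {in W, forall w, exists2 w', w' \in W & w * a \in <[a]> :* w'} ->
    {in W, forall w, exists2 w', w' \in W & w * b \in <[a]> :* w'} ->
  #|<<[set a; b]>>| <= size W * #[a].
Proof.
move=> W1 Wa Wb; pose X := \bigcup_(w <- W) (<[a]> :* w).
have inX x : reflect (exists2 w, w \in W & x \in <[a]> :* w) (x \in X).
  rewrite /X; elim: W {W1 Wa Wb X} => [|w W IH].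
    by rewrite big_nil inE; constructor=> -[].
  rewrite big_cons inE; apply: (iffP orP) => [[Hx|/IH[w' Ww' Hx]]|[w' Ww' Hx]].
  - by exists w; rewrite ?mem_head.
  - by exists w'; rewrite // inE Ww' orbT.
  move: Ww' Hx; rewrite inE => /predU1P[-> Hx|Ww' Hx]; first by left.
  by right; apply/IH; exists w'.
have step g : {in W, forall w, exists2 w', w' \in W & w * g \in <[a]> :* w'} ->
    {in X, forall x, x * g \in X}.
  move=> Wg x /inX[w /Wg[w' Ww' Hw]] /rcosetP[h Ah ->]; apply/inX.
  exists w' => //; case/rcosetP: Hw => k Ak Ek; rewrite -mulgA Ek mulgA.
  by rewrite mem_rcoset mulgK groupM.
have /subset_leq_card : <<[set a; b]>> \subset X.
  apply: gen2_sub_stable (step _ Wa) (step _ Wb).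
  by apply/inX; exists 1 => //; rewrite rcoset1 group1.
move/leq_trans; apply; rewrite /X; elim: W {W1 Wa Wb X inX step} => [|w W IH].
  by rewrite big_nil cards0.
rewrite big_cons /= mulSn; apply: leq_trans (leq_add (leqnn _) IH).
rewrite cardsU; apply: leq_trans (leq_subr _ _) _.
by rewrite card_rcoset -orderE.
Qed.

End CosetEnumeration.

Section Polyhedral.

Variables (gT : finGroupType).
Implicit Types a b x y z : gT.

(** The braid relation gives [(ab)^3 = (aba)(bab) = (aba)(aba) = a(baab)a]; cancel [a] on both
    sides. *)
Lemma braid_relation a b n :
    a * b * a = b * a * b -> (a * b) ^+ 3 = a ^+ n.+2 ->
  b * a * a * b = a ^+ n.
Proof.
move=> E; rewrite 3!expgS expg0 mulg1 !mulgA => H.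
apply: (mulgI a); apply: (mulIg a); rewrite -expgS -expgSr -H -!mulgA.
by do 3 congr (_ * _); rewrite !mulgA E.
Qed.

Lemma braid_conj a b :
  a * b * a = b * a * b -> b^-1 * a * b = a * b * a^-1.
Proof.
by move=> E; apply: (mulgI b); apply: (mulIg a); rewrite !mulgA mulgV mul1g mulgKV.
Qed.

(* [a] and [b] are conjugate, and [(a b)^3] is central. *)
Lemma braid_central a b n :
    a * b * a = b * a * b -> (a * b) ^+ 3 = a ^+ n ->
  [/\ commute (a ^+ n) b, b ^+ n = a ^+ n & (b * a) ^+ 3 = b ^+ n].
Proof.
move=> E H.
have Ca : commute (a ^+ n) a by apply/commute_sym/commuteX.
have Cab : commute (a ^+ n) (a * b) by rewrite -H; apply/commute_sym/commuteX.
have Cb : commute (a ^+ n) b.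
  rewrite -[b](mulKg a); apply: commuteM => //; exact: commuteV.
have Eb : b ^+ n = a ^+ n.
  have -> : b = a ^ (a * b)^-1.
    by rewrite conjgE invgK invMg !mulgA E !mulgK.
  by rewrite -conjXg conjgE invgK mulgA -Cab mulgK.
split=> //; rewrite Eb -H.
have -> : b * a = (a * b) ^ a by rewrite conjgE !mulgA mulVg mul1g.
by rewrite -conjXg H conjgE Ca mulKg.
Qed.


(** Conjugation by [u] both inverts and fixes [a ^+ n]. *)
Lemma order_inverted a u n :
  u * a * u^-1 = a^-1 -> commute (a ^+ n) u -> #[a] %| (2 * n).
Proof.
move=> Eu Cu; rewrite order_dvdn mul2n -addnn expgD.
have: (a ^ u^-1) ^+ n = a ^- n by rewrite conjgE invgK mulgA Eu expgVn.
rewrite -conjXg conjgE invgK mulgA -Cu mulgK => Ea.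
by rewrite {2}Ea mulgV.
Qed.

Lemma coset_step (W : seq gT) a h w u :
    h \in <[a]> -> w \in W -> u = h * w ->
  exists2 w', w' \in W & u \in <[a]> :* w'.
Proof. by move=> Ah Ww ->; exists w => //; rewrite mem_rcoset mulgK. Qed.

Lemma braid_swap a b n :
    a * b * a = b * a * b -> (a * b) ^+ 3 = a ^+ n ->
  b * a * b = a * b * a /\ (b * a) ^+ 3 = b ^+ n.
Proof. by move=> E /(braid_central E)[_ _ ->]. Qed.

Lemma mulVg_central a b n :
  commute (a ^+ n.+1) b -> b * a^-1 = a ^- n.+1 * (b * a ^+ n).
Proof.
move=> Ca; apply: (mulIg a); apply: (mulgI (a ^+ n.+1)).
by rewrite mulgKV !mulgA mulgV mul1g -mulgA -expgSr.
Qed.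

Lemma tetrahedral_square a b :
  a * b * a = b * a * b -> (a * b) ^+ 3 = a ^+ 3 -> (b * a^-1) ^+ 2 = a ^- 3.
Proof.
move=> E H; have R := braid_relation E H; have [Ca _ _] := braid_central E H.
apply: (mulgI (a ^+ 3)); rewrite mulgV (expgS (b * _)) expg1 !mulgA Ca.
rewrite !expgS expg0 mulg1 !mulgA mulgK.
by move: R; rewrite expg1 => ->; rewrite mulgV.
Qed.

(** The inverse elements [b a^-1] and [a b^-1] have squares [a^-3] and [b^-3 = a^-3], by the
    previous lemma and its mirror image; hence [a^3 = a^-3]. *)
Lemma tetrahedral_order a b :
  a * b * a = b * a * b -> (a * b) ^+ 3 = a ^+ 3 -> #[a] %| 6.
Proof.
move=> E H; have [E' H'] := braid_swap E H; have [_ Eb _] := braid_central E H.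
have S1 := tetrahedral_square E H; have S2 := tetrahedral_square E' H'.
have: (b * a^-1) ^- 2 = (a * b^-1) ^+ 2 by rewrite -expgVn invMg invgK.
rewrite S1 S2 Eb invgK => Ea.
by rewrite order_dvdn (expgD a 3 3) {1}Ea mulVg.
Qed.


Ltac coset h w :=
  refine (@coset_step _ _ h w _ _ _ _);
  [ by rewrite ?(group1, groupM, groupV, mem_cycle, cycle_id)
  | by rewrite !inE eqxx ?orbT
  | rewrite ?mulgA ?mulg1 ?mul1g //].

(** In the tetrahedral group the cosets of [<[a]>] correspond to the 4 vertices, [a] being a
    rotation about one of them; likewise 6 vertices for the octahedron and 12 for the icosahedron
    below. *)
Lemma card_tetrahedral a b :
  a * b * a = b * a * b -> (a * b) ^+ 3 = a ^+ 3 -> #|<<[set a; b]>>| <= 24.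
Proof.
move=> E H; have Oa := tetrahedral_order E H.
have R := braid_relation E H; have [Ca Eb _] := braid_central E H.
have [E' H'] := braid_swap E H; have R' := braid_relation E' H'.
rewrite !expg1 in R R'.
apply: (@leq_trans (4 * #[a])); last by rewrite (@leq_mul 4 _ 4 6) // dvdn_leq.
apply: (card_coset_enum (W := [:: 1; b; b * a; b * a * a])); first exact: mem_head.
- move=> w; rewrite !inE => /or4P[]/eqP->.
  + coset a (1 : gT).
  + coset (1 : gT) (b * a).
  + coset (1 : gT) (b * a * a).
  + coset (a ^+ 3) b.
    by rewrite Ca !expgS expg0 mulg1 !mulgA.
move=> w; rewrite !inE => /or4P[]/eqP->.
- coset (1 : gT) b.
- coset (a^-1 * a ^- 3) (b * a * a).
  have -> : b * b = a^-1 * (b * a^-1).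
    by apply: (mulgI a); apply: (mulIg a); rewrite !mulgA mulgV mul1g mulgKV.
  by rewrite (mulVg_central Ca) !expgS expg0 mulg1 !mulgA.
- coset a (b * a).
- coset a (1 : gT).
Qed.

Lemma octahedral_invert a b :
    a * b * a = b * a * b -> (a * b) ^+ 3 = a ^+ 4 ->
  (b * b) * a * (b * b)^-1 = a^-1.
Proof.
move=> E H; have [E' H'] := braid_swap E H; have R' := braid_relation E' H'.
apply: (mulgI a); apply: (mulIg (b * b)).
rewrite expgS expg1 in R'.
by rewrite mulgV mul1g -!mulgA mulVg mulg1 !mulgA R'.
Qed.

Lemma card_octahedral a b :
  a * b * a = b * a * b -> (a * b) ^+ 3 = a ^+ 4 -> #|<<[set a; b]>>| <= 48.
Proof.
move=> E H.
have R := braid_relation E H; have [Ca Eb _] := braid_central E H.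
have Inv := octahedral_invert E H.
have Oa : #[a] %| 2 * 4.
  by apply: order_inverted Inv _; rewrite -expg2; apply: commuteX.
have [E' H'] := braid_swap E H; have R' := braid_relation E' H'.
rewrite !expgS !expg0 !mulg1 in R R'.
apply: (@leq_trans (6 * #[a])); last by rewrite (@leq_mul 6 _ 6 8) // dvdn_leq.
apply: (card_coset_enum (W := [:: 1; b; b * a; b * a * a; b * a * a * a; b * b])); first exact: mem_head.
- move=> w; rewrite !inE => /or3P[/eqP->|/eqP->|/or4P[]/eqP->].
  + coset a (1 : gT).
  + coset (1 : gT) (b * a).
  + coset (1 : gT) (b * a * a).
  + coset (1 : gT) (b * a * a * a).
  + coset (a ^+ 4) b.
    by rewrite Ca !expgS expg0 mulg1 !mulgA.
  + coset a^-1 (b * b).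
    by apply: (mulgI a); rewrite !mulgA mulgV mul1g R'.
move=> w; rewrite !inE => /or3P[/eqP->|/eqP->|/or4P[]/eqP->].
- coset (1 : gT) b.
- coset (1 : gT) (b * b).
- coset a (b * a).
- coset (a * a) (1 : gT).
- coset (a ^+ 3 * a^-4) (b * a * a * a).
  have -> : b * a * a * a * b = a ^+ 3 * (b * a^-1).
    have -> : b * a * a = a * a * b^-1 by rewrite -R mulgK.
    rewrite -[LHS]mulgA -[LHS]mulgA [b^-1 * _]mulgA (braid_conj E).
    by rewrite !expgS expg0 mulg1 !mulgA.
  by rewrite (mulVg_central Ca) !expgS expg0 mulg1 !mulgA.
- coset (a ^+ 4 * a^-2) (b * a * a).
  have -> : b * b * b = a ^+ 4 * b^-1.
    by rewrite -Eb !expgS expg0 mulg1 !mulgA mulgK.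
  have -> : b^-1 = a^-2 * (b * a * a).
    by apply: (mulIg b); rewrite mulVg -mulgA R expg2 mulVg.
  by rewrite !mulgA.
Qed.

Lemma icosahedral_shift a b :
    a * b * a = b * a * b -> (a * b) ^+ 3 = a ^+ 5 ->
  a^-1 * b * b = b * b * a * b^-1.
Proof.
move=> E H; have [E' H'] := braid_swap E H; have R' := braid_relation E' H'.
rewrite !expgS expg0 mulg1 in R'; apply: (mulgI a); apply: (mulIg b).
by rewrite !mulgA mulgV mul1g mulgKV R' !mulgA.
Qed.

Lemma icosahedral_bridge a b :
    a * b * a = b * a * b -> (a * b) ^+ 3 = a ^+ 5 ->
  b * a * a * a * b^-1 = b * b * a * a.
Proof.
move=> E H; have R := braid_relation E H; apply: (mulIg b).
rewrite mulgVK; transitivity (b * (b * a * a * b)); last by rewrite !mulgA.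
by rewrite R !expgS expg0 mulg1 !mulgA.
Qed.

(** As a rotation [w] is a half-turn reversing the axis of [a]. Inversion by [w] bounds the order of
    [a], and the formula for [w * b] is the last entry of the coset table. *)
Lemma icosahedral_invert a b (w := b * b * a^-1 * b) :
    a * b * a = b * a * b -> (a * b) ^+ 3 = a ^+ 5 ->
  w * b = a ^+ 5 * a ^- 3 * (b * b * a * a) /\ w * a * w^-1 = a^-1.
Proof.
move=> E H; have S := icosahedral_shift E H; have B := icosahedral_bridge E H.
have R := braid_relation E H; have [Ca Eb _] := braid_central E H.
have Ewb : w * b = a ^+ 5 * a ^- 3 * (b * b * a * a).
  have -> : w * b = b ^+ 5 * (b^-1 * a * b^-1).
    rewrite /w -[LHS]mulgA -[LHS]mulgA [a^-1 * _]mulgA S.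
    by rewrite (expgSr b 4) !expgS expg0 mulg1 !mulgA mulgK.
  rewrite Eb -[RHS]mulgA; congr (_ * _); apply: (mulgI (a ^+ 3)).
  have T : a ^+ 3 * b^-1 = b * a * a by rewrite -R mulgK.
  by rewrite !mulgA mulgV mul1g T B.
split=> //; apply: (mulIg w); rewrite mulgVK.
have [E' H'] := braid_swap E H; have R' := braid_relation E' H'.
have V : b * b * a * a * b^-1 = a ^+ 3 * a ^- 5 * w.
  have V s r u y : y * b = s * r^-1 * u -> u * b^-1 = r * s^-1 * y.
    move=> Ey; apply: (mulIg b); rewrite mulgVK -[RHS]mulgA Ey.
    by rewrite !mulgA mulgVK mulgV mul1g.
  exact: V Ewb.
transitivity (b * b * (a^-1 * b * a)); first by rewrite /w !mulgA.
rewrite (braid_conj E'); transitivity (b ^+ 3 * a * b^-1).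
  by rewrite !expgS expg0 mulg1 !mulgA.
rewrite -R'; transitivity (a * (b * b * a * a * b^-1)); first by rewrite !mulgA.
have -> : a^-1 = a * a ^+ 3 * a ^- 5.
  by apply: (mulIg (a ^+ 5)); rewrite mulgVK (expgS a 4) mulKg -expgS.
by rewrite V; clearbody w; move: (a ^+ 3) (a ^- 5) => r s; rewrite !mulgA.
Qed.

Lemma card_icosahedral a b :
  a * b * a = b * a * b -> (a * b) ^+ 3 = a ^+ 5 -> #|<<[set a; b]>>| <= 120.
Proof.
move=> E H; have R := braid_relation E H; have [Ca Eb _] := braid_central E H.
have [Ewb Inv] := icosahedral_invert E H.
have Oa : #[a] %| 2 * 5.
  apply: order_inverted Inv _; have Cab : commute (a ^+ 5) b := Ca.
  have Ca1 : commute (a ^+ 5) a^-1 by apply/commuteV/commute_sym/commuteX.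
  by do 3!apply: commuteM => //.
have [E' H'] := braid_swap E H; have R' := braid_relation E' H'.
have B := icosahedral_bridge E H; have aV := mulVg_central Ca.
rewrite !expgS !expg0 !mulg1 in R R'.
have a5b : b * a * a * a * a * a = a ^+ 5 * b.
  by rewrite Ca !expgS expg0 mulg1 !mulgA.
have T : a * a * a * b^-1 = b * a * a by rewrite -[in LHS](mulgA a) -R mulgK.
have H3 : b * a * a * a * b = a ^+ 4 * (b * a^-1).
  transitivity (a * a * a * (b^-1 * a * b)); first by rewrite -T !mulgA.
  by rewrite (braid_conj E) !expgS expg0 mulg1 !mulgA.
have H4 : b * a * a * a * a * b = a ^+ 4 * (b * b * a^-1).
  transitivity (a * a * a * ((b^-1 * a * b) * (b^-1 * a * b))).
    by rewrite -T !mulgA mulgK.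
  by rewrite (braid_conj E) !expgS expg0 mulg1 !mulgA mulgVK.
have aV2 : b * b * a^-1 = a ^- 5 * (b * b * a ^+ 4).
  by apply: mulVg_central; apply: commuteM.
have aV3 : b * b * a^-1 * a^-1 = a ^- 5 * (b * b * a ^+ 3).
  by rewrite aV2 -mulgA -(mulgA (b * b)) (expgSr a 3) mulgK.
apply: (@leq_trans (12 * #[a])); last by rewrite (@leq_mul 12 _ 12 10) // dvdn_leq.
apply: (card_coset_enum (W := [:: 1; b; b * a; b * a * a; b * a * a * a;
  b * a * a * a * a; b * b; b * b * a; b * b * a * a; b * b * a * a * a;
  b * b * a * a * a * a; b * b * a^-1 * b])); first exact: mem_head.
- move=> w; rewrite !inE.
  case/or4P=> [/eqP->|/eqP->|/eqP->|/or4P[/eqP->|/eqP->|/eqP->|/or3P[/eqP->|/eqP->|/or4P[]/eqP->]]].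
  + coset a (1 : gT).
  + coset (1 : gT) (b * a).
  + coset (1 : gT) (b * a * a).
  + coset (1 : gT) (b * a * a * a).
  + coset (1 : gT) (b * a * a * a * a).
  + coset (a ^+ 5) b.
  + coset (1 : gT) (b * b * a).
  + coset (1 : gT) (b * b * a * a).
  + coset (1 : gT) (b * b * a * a * a).
  + coset (1 : gT) (b * b * a * a * a * a).
  + coset (a ^+ 5) (b * b).
    transitivity (b * (b * a * a * a * a * a)); first by rewrite !mulgA.
    by rewrite a5b Ca -[RHS]mulgA Ca.
  coset a^-1 (b * b * a^-1 * b).
  by move: Inv => /(congr1 (mulg^~ (b * b * a^-1 * b))) /=; rewrite mulgVK => ->; rewrite !mulgA.
move=> w; rewrite !inE.
case/or4P=> [/eqP->|/eqP->|/eqP->|/or4P[/eqP->|/eqP->|/eqP->|/or3P[/eqP->|/eqP->|/or4P[]/eqP->]]].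
- coset (1 : gT) b.
- coset (1 : gT) (b * b).
- coset a (b * a).
- coset (a ^+ 3) (1 : gT).
- coset (a ^+ 4 * a ^- 5) (b * a * a * a * a).
  by rewrite H3 aV !expgS expg0 mulg1 !mulgA.
- coset (a ^+ 4 * a ^- 5) (b * b * a * a * a * a).
  by rewrite H4 aV2 !expgS expg0 mulg1 !mulgA.
- coset a (b * b * a).
  by rewrite R' !mulgA.
- coset a (b * a * a).
  transitivity (b * (b * a * b)); first by rewrite !mulgA.
  by rewrite -E !mulgA -E.
- coset (1 : gT) (b * a * a * a).
  transitivity (b * (b * a * a * b)); first by rewrite !mulgA.
  by rewrite R !mulgA.
- coset (a ^+ 4 * a ^- 5) (b * b * a * a * a).
  transitivity (b * (b * a * a * a * b)); first by rewrite !mulgA.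
  transitivity (b * a * a * a * a * b * a^-1).
    by rewrite H3 !expgS expg0 mulg1 !mulgA.
  by rewrite H4 -[LHS]mulgA aV3 !expgS expg0 mulg1 !mulgA.
- coset (a ^+ 5) (b * b * a^-1 * b).
  have -> : b * b * a * a * a * a = a ^+ 5 * (b * b * a^-1).
    by rewrite aV2 mulVKg !expgS expg0 mulg1 !mulgA.
  by rewrite [a ^+ 5 * (_ * _)]mulgA [a ^+ 5 * (_ * _)]mulgA.
coset (a ^+ 5 * a ^- 3) (b * b * a * a).
by rewrite Ewb; move: (a ^+ 5) (a ^- 3) => r s; rewrite !mulgA.
Qed.
End Polyhedral.

(** By cardinality the first projection is injective on [<<S>>], which is therefore the graph of a
    morphism onto the second projection. *)
Lemma subdirect_homg (gT rT : finGroupType) (S : {set gT * rT}) :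
  #|<<S>>| <= #|<<fst @: S>>| -> <<snd @: S>> \homg <<fst @: S>>.
Proof.
have Eh (xT : finGroupType) (f : {morphism setT >-> xT}) :
    f @* <<S>> = <<f @: S>> :> {set _}.
  by rewrite morphim_gen ?subsetT // morphimE setTI.
have E1 := Eh _ (fst_morphism gT rT); have E2 := Eh _ (snd_morphism gT rT).
rewrite -E1 -E2 => leDG.
have injf : 'injm (restrm (subsetT <<S>>) (fst_morphism gT rT)).
  apply/injmP/imset_injP; rewrite eqn_leq leq_imset_card.
  by rewrite -morphimEdom morphim_restrm setIid.
have := sub_isog (subxx _) injf; rewrite morphim_restrm setIid => isoDG.
exact: homg_trans (morphim_homg (snd_morphism gT rT) (subsetT _)) (isog_hom isoDG).
Qed.

Lemma pair_mulgP (gT rT : finGroupType) (u v : gT * rT) :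
  fst_morphism gT rT u = v.1 -> snd_morphism gT rT u = v.2 -> u = v.
Proof. by case: u v => [? ?] [? ?] /= -> ->. Qed.

Section PolyhedralPresentation.

Variables (gT : finGroupType).
Implicit Types (G : {group gT}) (x y z : gT).

(** The generators [z] and [z^-1 y] turn the three relations into the braid relation and one
    relation in [c], which is the form suited to a coset enumeration over [<[z]>]. *)
Lemma polyhedral_braid x y z c :
    x ^+ 2 = x * y * z -> y ^+ 3 = x * y * z -> z ^+ c = x * y * z ->
  let b := z^-1 * y in
  [/\ z * b * z = b * z * b, (z * b) ^+ 3 = z ^+ c, z * b = y & z * b * z = x].
Proof.
move=> Ex Ey Ez b; have Ezb : z * b = y by rewrite mulVKg.
have Exyz : y * z = x by apply: (mulgI x); rewrite mulgA -Ex.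
split; rewrite ?Ezb ?Exyz //; last by rewrite Ey Ez.
rewrite -mulgA Ezb /b; apply: (mulgI z); rewrite !mulgA mulgV mul1g.
apply: (mulgI y); rewrite mulgA Exyz -expg2 Ex -Ey.
by rewrite !expgS expg0 mulg1.
Qed.

Lemma gen_polyhedral x y z c :
    x ^+ 2 = x * y * z -> y ^+ 3 = x * y * z -> z ^+ c = x * y * z ->
  <[x]> <*> <[y]> <*> <[z]> = <<[set z; z^-1 * y]>>.
Proof.
move=> Ex Ey Ez; have [_ _ Ezb Ezbz] := polyhedral_braid Ex Ey Ez.
have Gz : z \in <<[set z; z^-1 * y]>> by rewrite mem_gen ?set21.
have Gb : z^-1 * y \in <<[set z; z^-1 * y]>> by rewrite mem_gen ?set22.
have Gy : y \in <<[set z; z^-1 * y]>> by rewrite -[y in y \in _]Ezb groupM.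
have Gx : x \in <<[set z; z^-1 * y]>> by rewrite -Ezbz Ezb groupM.
apply/eqP; rewrite eqEsubset; apply/andP; split.
  by rewrite !join_subG !cycle_subG Gx Gy Gz.
have Jz : z \in <[x]> <*> <[y]> <*> <[z]> by rewrite mem_gen // inE cycle_id orbT.
have Jy : y \in <[x]> <*> <[y]> by rewrite mem_gen // inE cycle_id orbT.
have {}Jy : y \in <[x]> <*> <[y]> <*> <[z]> by rewrite mem_gen // inE Jy.
by rewrite gen_subG; apply/subsetP => u /set2P[]->; rewrite ?groupM ?groupV.
Qed.

Lemma homg_polyhedralP (H : {group gT}) c :
  reflect (exists x y z, [/\ H = <[x]> <*> <[y]> <*> <[z]> :> {set gT},
     x ^+ 2 = x * y * z, y ^+ 3 = x * y * z & z ^+ c = x * y * z])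
   (H \homg Grp (x : y : z :
     (x ^+ 2 = x * y * z, y ^+ 3 = x * y * z, z ^+ c = x * y * z))).
Proof.
apply: (iffP existsP) => [[[[x y] z] /= /eqP[EH Ex Ey Ez]]|].
  by exists x, y, z.
move=> [x [y [z [EH Ex Ey Ez]]]]; exists (x, y, z).
by rewrite /= !xpair_eqE; apply/and4P; split; apply/eqP.
Qed.

Lemma card_polyhedral (H : {group gT}) c N :
    (c, N) \in [:: (3, 24); (4, 48); (5, 120)]%N ->
    H \homg Grp (x : y : z :
     (x ^+ 2 = x * y * z, y ^+ 3 = x * y * z, z ^+ c = x * y * z)) ->
  #|H| <= N.
Proof.
move=> cN /homg_polyhedralP[x [y [z [EH Ex Ey Ez]]]].
rewrite EH (gen_polyhedral Ex Ey Ez).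
have [E1 E2 _ _] := polyhedral_braid Ex Ey Ez.
move: cN; rewrite !inE => /or3P[]/eqP[Ec EN]; rewrite {c}Ec in Ez E2 *; rewrite EN.
- exact: card_tetrahedral.
- exact: card_octahedral.
exact: card_icosahedral.
Qed.

End PolyhedralPresentation.

(** For any other group [H] with these relations, the pairs of generators satisfy them in [G * H],
    so they generate a subgroup of at most [N <= #|G|] elements; [subdirect_homg] then makes [H] a
    quotient of [G]. *)
Lemma polyhedral_isoGrp (gT : finGroupType) (G : {group gT}) c N :
    (c, N) \in [:: (3, 24); (4, 48); (5, 120)]%N ->
    G \homg Grp (x : y : z :
     (x ^+ 2 = x * y * z, y ^+ 3 = x * y * z, z ^+ c = x * y * z)) ->
  N <= #|G| -> binary_polyhedral c G.
Proof.
move=> cN homG leNG; apply: intro_isoGrp => // rT H homH.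
have /homg_polyhedralP[x [y [z [EG Ex Ey Ez]]]] := homG.
have /homg_polyhedralP[x' [y' [z' [EH Ex' Ey' Ez']]]] := homH.
rewrite (gen_polyhedral Ex Ey Ez) in EG; rewrite (gen_polyhedral Ex' Ey' Ez') in EH.
pose u := (x, x') : gT * rT; pose v := (y, y') : gT * rT; pose w := (z, z') : gT * rT.
have [Eu Ev Ew] : [/\ u ^+ 2 = u * v * w, v ^+ 3 = u * v * w & w ^+ c = u * v * w].
  by split; apply: pair_mulgP; rewrite ?morphX ?inE.
pose S := [set w; w^-1 * v].
have ES (xT : finType) (f : gT * rT -> xT) : f @: S = [set f w; f (w^-1 * v)].
  by rewrite /S imsetU1 imset_set1.
have E1 : fst @: S = [set z; z^-1 * y] by rewrite ES.
have E2 : snd @: S = [set z'; z'^-1 * y'] by rewrite ES.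
rewrite EH EG -E1 -E2; apply: subdirect_homg; rewrite E1 -EG.
apply: leq_trans leNG; apply: (card_polyhedral (H := <<S>>%G) cN).
apply/homg_polyhedralP; exists u, v, w; split=> //.
by rewrite (gen_polyhedral Eu Ev Ew).
Qed.

Lemma nonabelian_image (gT : finGroupType) (G : {group gT}) p
    (rT : finGroupType) (H : {group rT}) :
  G \isog Grp p -> H \homg Grp p -> ~~ abelian H -> ~~ abelian G.
Proof.
move=> isoG; rewrite -isoG => /homgP[f <-]; apply: contra.
exact: morphim_abelian.
Qed.

Definition table5 (s : seq nat) (i : 'I_5) : 'I_5 := inZp (nth 0 s i).

Lemma forall_I5 (P : pred 'I_5) :
  P (inZp 0) -> P (inZp 1) -> P (inZp 2) -> P (inZp 3) -> P (inZp 4) -> forall i, P i.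
Proof.
move=> P0 P1 P2 P3 P4 i; have -> : i = inZp i by rewrite valZpK.
by case: i => -[|[|[|[|[|]]]]].
Qed.

(** The rotation groups A4, S4 and A5 are quotients in which [xyz = 1]. The tables list the images
    of [x], [y], [z], of orders 2, 3 and [c], as permutations of five points. *)
Lemma polyhedral_nonabelian (gT : finGroupType) (G : {group gT}) c :
  c \in [:: 3; 4; 5]%N -> binary_polyhedral c G -> ~~ abelian G.
Proof.
have inj_table s : uniq s -> size s = 5 -> all (leq^~ 4) s -> injective (table5 s).
  move=> Us Ss As i j /(congr1 val) /=; have Hs k : (k < 5 -> nth 0 s k %% 5 = nth 0 s k)%N.
    by move=> k5; rewrite modn_small // ltnS; apply: (allP As); rewrite mem_nth ?Ss.
  by rewrite !Hs // => /eqP; rewrite nth_uniq ?Ss // => /eqP/val_inj.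
have model s1 s2 s3 (I1 : injective (table5 s1)) (I2 : injective (table5 s2)) (I3 : injective (table5 s3)) :
    perm I1 * perm I2 * perm I3 = 1 -> perm I1 ^+ 2 = 1 -> perm I2 ^+ 3 = 1 ->
    perm I3 ^+ c = 1 -> perm I1 * perm I2 != perm I2 * perm I1 ->
    binary_polyhedral c G -> ~~ abelian G.
  move: (perm I1) (perm I2) (perm I3) => x y z Exyz Ex Ey Ez Nxy /nonabelian_image; apply.
    by apply/homg_polyhedralP; exists x, y, z; rewrite Exyz; split.
  apply: contra Nxy => /centsP/(_ x _ y _)/eqP; apply.
    by rewrite /= mem_gen // inE mem_gen ?inE ?cycle_id.
  by rewrite /= mem_gen // inE mem_gen ?inE ?cycle_id ?orbT.
rewrite !inE => /or3P[]/eqP Ec; rewrite {c}Ec in model *.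
- apply: (model _ _ _ (inj_table [:: 1; 0; 3; 2; 4]%N isT erefl isT)
    (inj_table [:: 1; 2; 0; 3; 4]%N isT erefl isT) (inj_table [:: 3; 1; 0; 2; 4]%N isT erefl isT));
    try by apply/permP=> i; rewrite ?expgS ?expg0 ?mulg1 !(permM, permE) /=; apply/eqP; move: i; apply: forall_I5.
  by apply/eqP=> /permP/(_ 0%R); rewrite !permM !permE.
- apply: (model _ _ _ (inj_table [:: 1; 0; 2; 3; 4]%N isT erefl isT)
    (inj_table [:: 0; 2; 3; 1; 4]%N isT erefl isT) (inj_table [:: 1; 3; 0; 2; 4]%N isT erefl isT));
    try by apply/permP=> i; rewrite ?expgS ?expg0 ?mulg1 !(permM, permE) /=; apply/eqP; move: i; apply: forall_I5.
  by apply/eqP=> /permP/(_ 0%R); rewrite !permM !permE.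
apply: (model _ _ _ (inj_table [:: 1; 0; 3; 2; 4]%N isT erefl isT)
    (inj_table [:: 2; 1; 4; 3; 0]%N isT erefl isT) (inj_table [:: 4; 0; 1; 2; 3]%N isT erefl isT));
    try by apply/permP=> i; rewrite ?expgS ?expg0 ?mulg1 !(permM, permE) /=; apply/eqP; move: i; apply: forall_I5.
by apply/eqP=> /permP/(_ 0%R); rewrite !permM !permE.
Qed.

(** * Binary dihedral groups *)

Section BinaryDihedral.

Variables (gT : finGroupType).
Implicit Types (G : {group gT}) (x y : gT).

Lemma homg_dihedralP (H : {group gT}) m :
  reflect (exists x y, [/\ H = <<[set y; x]>> :> {set gT},
     y ^+ (2 * m) = 1, x ^+ 2 = y ^+ m & x * y * x^-1 = y^-1])
   (H \homg Grp (x : y : (y ^+ (2 * m), x ^+ 2 = y ^+ m, x * y * x^-1 = y^-1))).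
Proof.
have Eg x y : <[x]> <*> <[y]> = <<[set y; x]>>.
  apply/eqP; rewrite eqEsubset join_subG !cycle_subG !mem_gen ?inE ?eqxx ?orbT //=.
  rewrite gen_subG; apply/subsetP => u /set2P[]->.
    by rewrite mem_gen // inE cycle_id orbT.
  by rewrite mem_gen // inE cycle_id.
apply: (iffP existsP) => [[[x y] /= /eqP[EH Ey Ex Exy]]|].
  by exists x, y; rewrite -Eg.
move=> [x [y [EH Ey Ex Exy]]]; exists (x, y).
by rewrite /= !xpair_eqE; apply/and4P; split; apply/eqP; rewrite // Eg.
Qed.

Lemma card_dihedral_order (H : {group gT}) x y m :
    H = <<[set y; x]>> :> {set gT} -> x ^+ 2 = y ^+ m -> x * y * x^-1 = y^-1 ->
  #|H| <= 2 * #[y].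
Proof.
move=> -> Ex Exy; apply: (card_coset_enum (W := [:: 1; x])); first exact: mem_head.
  move=> w; rewrite !inE => /orP[]/eqP->.
    by apply: (@coset_step _ _ _ y 1); rewrite ?cycle_id ?inE ?eqxx ?mulg1 ?mul1g.
  apply: (@coset_step _ _ _ y^-1 x); rewrite ?groupV ?cycle_id ?inE ?eqxx ?orbT //.
  by rewrite -Exy mulgVK.
move=> w; rewrite !inE => /orP[]/eqP->.
  by apply: (@coset_step _ _ _ 1 x); rewrite ?group1 ?inE ?eqxx ?orbT.
by apply: (@coset_step _ _ _ (y ^+ m) 1); rewrite ?mem_cycle ?inE ?eqxx ?orbT // mulg1 -Ex.
Qed.

End BinaryDihedral.

Lemma dihedral_isoGrp (gT : finGroupType) (G : {group gT}) m : (0 < m)%N ->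
    G \homg Grp (x : y : (y ^+ (2 * m), x ^+ 2 = y ^+ m, x * y * x^-1 = y^-1)) ->
  4 * m <= #|G| -> binary_dihedral m G.
Proof.
move=> m_gt0 homG leNG; apply: intro_isoGrp => // rT H homH.
have /homg_dihedralP[x [y [EG Ey Ex Exy]]] := homG.
have /homg_dihedralP[x' [y' [EH Ey' Ex' Exy']]] := homH.
pose u := (x, x') : gT * rT; pose v := (y, y') : gT * rT.
have [Ev Eu Euv] : [/\ v ^+ (2 * m) = 1, u ^+ 2 = v ^+ m & u * v * u^-1 = v^-1].
  split; last by congr (_, _).
    by apply: pair_mulgP; rewrite ?morphX ?inE.
  by apply: pair_mulgP; rewrite -?[(v ^+ m).1]/(fst_morphism gT rT _) -?[(v ^+ m).2]/(snd_morphism gT rT _) !morphX ?inE.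
pose S := [set v; u].
have ES (xT : finType) (f : gT * rT -> xT) : f @: S = [set f v; f u].
  by rewrite /S imsetU1 imset_set1.
have E1 : fst @: S = [set y; x] by rewrite ES.
have E2 : snd @: S = [set y'; x'] by rewrite ES.
rewrite EH EG -E1 -E2; apply: subdirect_homg; rewrite E1 -EG.
apply: leq_trans leNG; rewrite -[4]/(2 * 2)%N -mulnA.
apply: leq_trans (card_dihedral_order (H := <<S>>%G) (erefl _) Eu Euv) _.
by rewrite leq_mul // dvdn_leq ?muln_gt0 ?order_dvdn ?Ev.
Qed.

Section DihedralModel.

Variable m : nat.
Hypothesis m_gt0 : (0 < m)%N.

Local Notation T := ('Z_(2 * m) * bool)%type.

Let char2m : ((2 * m)%:R = 0 :> 'Z_(2 * m))%R.
Proof. by rewrite pchar_Zp // mul2n -addnn; case: m m_gt0 => // k _; rewrite addSn addnS. Qed.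

Let mm0 : (m%:R + m%:R = 0 :> 'Z_(2 * m))%R.
Proof. by rewrite -GRing.natrD addnn -mul2n char2m. Qed.

(** Right multiplication by [y] in the regular representation, where [(i, false)] stands for [y^i]
    and [(i, true)] for [x y^i]; [dihedral_flip] is right multiplication by [x]. *)
Definition dihedral_rot (u : T) : T := (u.1 + 1, u.2)%R.
Definition dihedral_flip (u : T) : T :=
  (if u.2 then m%:R - u.1 else - u.1, ~~ u.2)%R.

Lemma dihedral_rot_inj : injective dihedral_rot.
Proof.
move=> [i e] [j f] E; have /= Ee := congr1 snd E.
by rewrite Ee; congr (_, _); apply: (@GRing.addIr _ 1%R); apply: (congr1 fst E).
Qed.

Lemma dihedral_flip_inj : injective dihedral_flip.
Proof.
move=> [i e] [j f] E; have /negb_inj /= Ee := congr1 snd E; move: E; rewrite Ee => E.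
congr (_, _); apply: GRing.oppr_inj; move/(congr1 fst): E.
by case: f {Ee} => //= E; apply: GRing.addrI E.
Qed.

Let y := perm dihedral_rot_inj.
Let x := perm dihedral_flip_inj.

Let yX k i e : (y ^+ k) (i, e) = (i + k%:R, e)%R.
Proof.
elim: k => [|k IH]; first by rewrite perm1 GRing.addr0.
by rewrite expgSr permM IH permE /dihedral_rot /= -GRing.addrA -GRing.natr1.
Qed.

Lemma dihedral_model : exists H : {group {perm T}},
  (H \homg Grp (x : y : (y ^+ (2 * m), x ^+ 2 = y ^+ m, x * y * x^-1 = y^-1)))
  /\ 4 * m <= #|H|.
Proof.
exists <<[set y; x]>>%G; split.
  apply/homg_dihedralP; exists x, y; split=> //.
  - by apply/permP=> -[i e]; rewrite yX char2m GRing.addr0 perm1.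
  - apply/permP=> -[i e]; rewrite yX expgS expg1 permM !permE /dihedral_flip /=.
    case: e; congr (_, _) => /=; last by ring.
    by apply/eqP; rewrite -GRing.subr_eq0; apply/eqP; rewrite -[RHS]GRing.oppr0 -mm0; ring.
  apply: (mulIg x); rewrite mulgVK; apply: (mulgI y); rewrite mulVKg.
  apply/permP=> -[i e]; rewrite !permM !permE /dihedral_flip /dihedral_rot /=.
  by case: e; congr (_, _) => /=; ring.
have -> : (4 * m = #|{: T}|)%N.
  rewrite card_prod card_bool card_ord Zp_cast; last by case: m m_gt0 => // k _; rewrite mulnS.
  by rewrite mulnAC.
have Hy k : y ^+ k \in <<[set y; x]>> by rewrite groupX ?mem_gen ?set21.
have Hx : x \in <<[set y; x]>> by rewrite mem_gen ?set22.
pose f (p : {perm T}) := p (0, false)%R.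
have surj u : u \in f @: <<[set y; x]>>.
  case: u => i [|].
    apply/imsetP; exists (y ^+ (- i)%R * x); first by rewrite groupM.
    rewrite /f permM yX natr_Zp GRing.add0r permE; congr (_, _).
    by rewrite -[LHS](GRing.opprK i).
  by apply/imsetP; exists (y ^+ i); rewrite ?Hy // /f yX natr_Zp GRing.add0r.
apply: leq_trans (leq_imset_card f _).
by rewrite -cardsT subset_leq_card //; apply/subsetP => u _; apply: surj.
Qed.

End DihedralModel.

(** The relations alone give only that the order of [y] divides [2 * m]. A quotient with at least
    [4 * m] elements, together with [#|G| <= 2 * #[y]], excludes a smaller order. *)
Lemma binary_dihedral_gen (gT : finGroupType) (G : {group gT}) m :
    (0 < m)%N -> binary_dihedral m G ->
  exists x y, [/\ G = <<[set y; x]>> :> {set gT}, x ^+ 2 = y ^+ m,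
    x * y * x^-1 = y^-1 & #[y] = (2 * m)%N].
Proof.
move=> m_gt0 isoG; have [H [homH leH]] := dihedral_model m_gt0.
have /homg_dihedralP[x [y [EG Ey Ex Exy]]] := isoGrp_hom isoG.
exists x, y; split=> //; apply/eqP; rewrite eqn_leq dvdn_leq ?muln_gt0 ?order_dvdn ?Ey //=.
rewrite -(@leq_pmul2l 2) // mulnA; apply: leq_trans leH _.
rewrite -isoG in homH; apply: leq_trans (leq_homg homH) _.
exact: card_dihedral_order EG Ex Exy.
Qed.

End Presentations.

Import Order.TTheory GRing.Theory Num.Theory.
Local Open Scope ring_scope.

(** * Quaternion algebras *)

Section Quaternions.

Variables (K : fieldType) (a b : K).
Local Notation A := (quat a b).
Implicit Types x y z : A.

Lemma quat_eqP x y :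
  qre x = qre y -> qi x = qi y -> qj x = qj y -> qij x = qij y -> x = y.
Proof. by case: x y => [????] [????] /= -> -> -> ->. Qed.

Fact qreD x y : qre (x + y) = qre x + qre y. Proof. by []. Qed.
Fact qiD x y : qi (x + y) = qi x + qi y. Proof. by []. Qed.
Fact qjD x y : qj (x + y) = qj x + qj y. Proof. by []. Qed.
Fact qijD x y : qij (x + y) = qij x + qij y. Proof. by []. Qed.
Fact qreN x : qre (- x) = - qre x. Proof. by []. Qed.
Fact qiN x : qi (- x) = - qi x. Proof. by []. Qed.
Fact qjN x : qj (- x) = - qj x. Proof. by []. Qed.
Fact qijN x : qij (- x) = - qij x. Proof. by []. Qed.
Fact qreZ (c : K) x : qre (c *: x) = c * qre x. Proof. by []. Qed.
Fact qiZ (c : K) x : qi (c *: x) = c * qi x. Proof. by []. Qed.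
Fact qjZ (c : K) x : qj (c *: x) = c * qj x. Proof. by []. Qed.
Fact qijZ (c : K) x : qij (c *: x) = c * qij x. Proof. by []. Qed.
Fact qreM x y : qre (x * y) =
  qre x * qre y + a * (qi x * qi y) + b * (qj x * qj y) - a * b * (qij x * qij y).
Proof. by case: x y => [????] [????]. Qed.
Fact qiM x y : qi (x * y) =
  qre x * qi y + qi x * qre y - b * (qj x * qij y) + b * (qij x * qj y).
Proof. by case: x y => [????] [????]. Qed.
Fact qjM x y : qj (x * y) =
  qre x * qj y + qj x * qre y + a * (qi x * qij y) - a * (qij x * qi y).
Proof. by case: x y => [????] [????]. Qed.
Fact qijM x y : qij (x * y) =
  qre x * qij y + qij x * qre y + qi x * qj y - qj x * qi y.
Proof. by case: x y => [????] [????]. Qed.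

Definition quatE := (qreD, qiD, qjD, qijD, qreN, qiN, qjN, qijN,
  qreZ, qiZ, qjZ, qijZ, qreM, qiM, qjM, qijM).

Definition qtr x : K := qre x *+ 2.

Lemma qnorm_def x :
  qnorm x = qre x ^+ 2 - a * qi x ^+ 2 - b * qj x ^+ 2 + a * b * qij x ^+ 2.
Proof. by rewrite /qnorm !quatE /=; ring. Qed.

Lemma qconjM x y : qconj (x * y) = qconj y * qconj x.
Proof. by apply: quat_eqP; rewrite /= !quatE /=; ring. Qed.

Lemma qnormM x y : qnorm (x * y) = qnorm x * qnorm y.
Proof. by rewrite !qnorm_def !quatE; ring. Qed.

Lemma qnorm_conj x : qnorm (qconj x) = qnorm x.
Proof. by rewrite !qnorm_def /=; ring. Qed.

Lemma qconjK x : qconj (qconj x) = x.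
Proof. by apply: quat_eqP; rewrite /= ?opprK. Qed.

Lemma qnorm1 : qnorm (1 : A) = 1.
Proof. by rewrite qnorm_def /=; ring. Qed.

Lemma add_qconj x : x + qconj x = (qtr x)%:A.
Proof. by rewrite qscalarE; apply: quat_eqP; rewrite !quatE /= ?subrr // /qtr mulr2n. Qed.

Lemma qtrD x y : qtr (x + y) = qtr x + qtr y.
Proof. by rewrite /qtr mulrnDl. Qed.

Lemma qtrN x : qtr (- x) = - qtr x.
Proof. by rewrite /qtr mulNrn. Qed.

Lemma qtrZ c x : qtr (c *: x) = c * qtr x.
Proof. by rewrite /qtr quatE mulrnAr. Qed.

Lemma qtr1 : qtr (1 : A) = 2%:R. Proof. by []. Qed.

Lemma qtrA (c : K) : qtr (c%:A : A) = c *+ 2.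
Proof. by rewrite qscalarE. Qed.

Lemma qtrMC x y : qtr (x * y) = qtr (y * x).
Proof. by rewrite /qtr !quatE; congr (_ *+ 2); ring. Qed.

Lemma qtr_mul x y : qtr (x * y) + qtr (x * qconj y) = qtr x * qtr y.
Proof. by rewrite /qtr !quatE /=; ring. Qed.

Lemma sqr_quat x : x * x = qtr x *: x - (qnorm x)%:A.
Proof.
by rewrite qscalarE; apply: quat_eqP; rewrite !quatE /= ?qnorm_def /qtr; ring.
Qed.

Lemma mul_scalarC (c : K) x : c%:A * x = x * c%:A.
Proof. by rewrite -scalerAl mul1r -scalerAr mulr1. Qed.

Section Anisotropic.

Hypothesis aniso : forall x, qnorm x = 0 -> x = 0.

Lemma quat_mul_eq0 x y : x * y = 0 -> x = 0 \/ y = 0.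
Proof.
move=> xy0; have: qnorm x * qnorm y = 0.
  by rewrite -qnormM xy0 qnorm_def /=; ring.
by move/eqP; rewrite mulf_eq0 => /orP[]/eqP/aniso; [left|right].
Qed.

Lemma quat_mulfI x y z : x != 0 -> x * y = x * z -> y = z.
Proof.
move=> x0 E; have /quat_mul_eq0[/eqP|/eqP] : x * (y - z) = 0.
- by rewrite mulrBr E subrr.
- by rewrite (negbTE x0).
by rewrite subr_eq0 => /eqP.
Qed.

(** Both are roots of the same quadratic polynomial, which factors as [(X - y)(X - qconj y)] and may
    be evaluated at [x] because [x] commutes with [y]; there are no zero divisors. *)
Lemma comm_same_qtr x y :
    x * y = y * x -> qtr x = qtr y -> qnorm x = qnorm y ->
  x = y \/ x = qconj y.
Proof.
move=> Cxy Et En; have /quat_mul_eq0[/eqP|/eqP] : (x - y) * (x - qconj y) = 0.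
- have -> : qconj y = (qtr y)%:A - y by rewrite -add_qconj addrAC subrr add0r.
  rewrite mulrBl !mulrBr -mul_scalarC -[y * (_%:A)]mul_scalarC sqr_quat -Et En.
  rewrite Cxy sqr_quat -!scalerAl !mul1r -Et.
  by apply: quat_eqP; rewrite !quatE /=; ring.
- by rewrite subr_eq0 => /eqP; left.
by rewrite subr_eq0 => /eqP; right.
Qed.

(** The commutator of the relation with [u] is [(c2 + c3 u)(uv - vu) = 0]. Since the second factor
    is invertible, [c2 + c3 u = 0], and [u] is not a scalar. *)
Lemma quat_indep (u v : A) (c0 c1 c2 c3 : K) :
    u * v != v * u -> c0%:A + c1 *: u + c2 *: v + c3 *: (u * v) = 0 ->
  [/\ c0 = 0, c1 = 0, c2 = 0 & c3 = 0].
Proof.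
move=> Nuv E; have scal0 (c : K) x : c *: x = 0 -> x != 0 -> c = 0.
  move=> /eqP; rewrite scaler_eq0 => /orP[/eqP //|-> //].
pose w := u * v - v * u; have w0 : w != 0 by rewrite subr_eq0.
have nscal (x : A) (d0 d1 : K) : d0%:A + d1 *: x = 0 -> x * u != u * x \/ x * v != v * x ->
    d0 = 0 /\ d1 = 0.
  move=> Ed Nx; have d10 : d1 = 0.
    have com y : d1 *: (x * y - y * x) = 0.
      have: (d0%:A + d1 *: x) * y - y * (d0%:A + d1 *: x) = 0 by rewrite Ed mul0r mulr0 subrr.
      by move=> <-; apply: quat_eqP; rewrite qscalarE !quatE /=; ring.
    by case: Nx => Nx; [apply: (scal0 _ _ (com u))|apply: (scal0 _ _ (com v))]; rewrite subr_eq0.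
  split=> //; move: Ed; rewrite d10 scale0r addr0 => /scal0; apply; exact: oner_neq0.
have E2 : (c2%:A + c3 *: u) * w = 0.
  have <- : u * (c0%:A + c1 *: u + c2 *: v + c3 *: (u * v))
     - (c0%:A + c1 *: u + c2 *: v + c3 *: (u * v)) * u = (c2%:A + c3 *: u) * w.
    by rewrite /w qscalarE qscalarE; apply: quat_eqP; rewrite !quatE /=; ring.
  by rewrite E mulr0 mul0r subrr.
have [Ec|/eqP] := quat_mul_eq0 E2; last by rewrite (negbTE w0).
have [c20 c30] := nscal _ _ _ Ec (or_intror Nuv).
move: E; rewrite c20 c30 !scale0r !addr0 => /nscal[|-> ->] //; by right.
Qed.

End Anisotropic.

Lemma quat_span (u v w : A) :
    (forall c0 c1 c2 c3 : K, c0%:A + c1 *: u + c2 *: v + c3 *: (u * v) = 0 ->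
       [/\ c0 = 0, c1 = 0, c2 = 0 & c3 = 0]) ->
  exists c0 c1 c2 c3 : K, w = c0%:A + c1 *: u + c2 *: v + c3 *: (u * v).
Proof.
move=> ind.
pose co (x : A) : 'rV[K]_4 := \row_j [:: qre x; qi x; qj x; qij x]`_j.
pose B := \matrix_(i < 4) co [:: 1; u; v; u * v]`_i.
have coE (r : 'rV[K]_4) : r *m B = co ((r 0 0)%:A + r 0 1 *: u + r 0 2%:R *: v + r 0 3%:R *: (u * v)).
  apply/rowP => j; rewrite !mxE !big_ord_recl big_ord0 !mxE /=.
  have -> : lift ord0 ord0 = 1 :> 'I_4 by apply: val_inj.
  have -> : lift ord0 (lift ord0 ord0) = 2%:R :> 'I_4 by apply: val_inj.
  have -> : lift ord0 (lift ord0 (lift ord0 ord0)) = 3%:R :> 'I_4 by apply: val_inj.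
  by case: j => -[|[|[|[|j]]]] //= _; rewrite ?qscalarE ?quatE /=; ring.
have co_inj x : co x = 0 -> x = 0.
  move=> /rowP cx; have cj (j : 'I_4) : [:: qre x; qi x; qj x; qij x]`_j = 0.
    by have := cx j; rewrite !mxE.
  apply: quat_eqP; [exact: (cj 0)|exact: (cj 1)|exact: (cj 2%:R)|exact: (cj 3%:R)].
have uB : B \in unitmx.
  rewrite -row_free_unit -kermx_eq0; apply/eqP/row_matrixP => i; rewrite row0.
  have /eqP := sub_kermxP (row_sub i (kermx B)).
  move: (row i _) => r /eqP; rewrite coE => /co_inj/ind[r0 r1 r2 r3].
  apply/rowP => j; rewrite mxE; case: j => -[|[|[|[|j]]]] // Hj.
  - by rewrite -[RHS]r0; congr (r _ _); apply: val_inj.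
  - by rewrite -[RHS]r1; congr (r _ _); apply: val_inj.
  - by rewrite -[RHS]r2; congr (r _ _); apply: val_inj.
  by rewrite -[RHS]r3; congr (r _ _); apply: val_inj.
pose r := co w *m invmx B; exists (r 0 0), (r 0 1), (r 0 2%:R), (r 0 3%:R).
apply/eqP; rewrite -subr_eq0; apply/eqP/co_inj.
have coB x y : co (x - y) = co x - co y.
  apply/rowP => j; rewrite !mxE; case: j => -[|[|[|[|j]]]] //=.
by rewrite coB -coE mulmxKV // subrr.
Qed.

End Quaternions.

(** * Finite groups of unit Hamilton quaternions *)

Section HamiltonNorm.

Variable R : realFieldType.
Local Notation H := (quat (-1 : R) (-1 : R)).
Implicit Types x y : H.

Lemma hamilton_norm x :
  qnorm x = qre x ^+ 2 + qi x ^+ 2 + qj x ^+ 2 + qij x ^+ 2.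
Proof. by rewrite qnorm_def; ring. Qed.

Lemma hamilton_aniso x : qnorm x = 0 -> x = 0.
Proof.
have S (u : R) : 0 <= u ^+ 2 := sqr_ge0 u.
rewrite hamilton_norm => N0.
have Z (u : R) : u ^+ 2 <= 0 -> u = 0.
  by move=> u0; apply/eqP; rewrite -(sqrf_eq0 u) eq_le u0 S.
have [S0 S1 S2 S3] := And4 (S (qre x)) (S (qi x)) (S (qj x)) (S (qij x)).
by apply: quat_eqP; apply: Z; lra.
Qed.

Lemma hamilton_qtr2 x : qnorm x = 1 -> qtr x = 2 -> x = 1.
Proof.
rewrite hamilton_norm /qtr => N1 t2; apply/eqP; rewrite -subr_eq0; apply/eqP.
by apply: hamilton_aniso; rewrite hamilton_norm !quatE /=; nra.
Qed.

Lemma hamilton_qtr_le2 x : qnorm x = 1 -> qtr x <= 2.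
Proof.
have S (u : R) : 0 <= u ^+ 2 := sqr_ge0 u.
rewrite hamilton_norm /qtr => N1.
have [S0 S1 S2 S3] := And4 (S (qre x - 1)) (S (qi x)) (S (qj x)) (S (qij x)).
nra.
Qed.

(* The angle of a rotation is a multiple of 36, 45 or 60 degrees as soon as
   none of its first four multiples is smaller than 36 degrees. *)
Lemma trace_quantization (phi t : R) (P := fun u => [\/ u = 2, u = - 2 | - phi <= u <= phi]) :
    0 < phi -> phi ^+ 2 = phi + 1 -> 0 <= t ->
    P t -> P (t ^+ 2 - 2) -> P (t ^+ 3 - 3 * t) -> P (t ^+ 4 - 4 * t ^+ 2 + 2) ->
  [\/ t = 2, t = 0, t = phi - 1 | (t = 1 \/ t ^+ 2 = 2) \/ t = phi].
Proof.
move=> phi0 Ephi t0 [t2|t2|/andP[_ lt]]; [by constructor 1 | by lra | ].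
have phi1 : 1 < phi by nra.
have phi2 : phi < 2 by nra.
case=> [E|E|/andP[l2 _]]; [nra | | ].
  by move=> _ _; constructor 2; apply/eqP; rewrite -sqrf_eq0; apply/eqP; lra.
have gt1 : phi - 1 <= t by nra.
case=> [E|E|/andP[l3 _] P4].
- have : 0 < (t + 1) ^+ 2 * (2 - t) by rewrite mulr_gt0 ?exprn_gt0 //; lra.
  have -> : (t + 1) ^+ 2 * (2 - t) = 2 - (t ^+ 3 - 3 * t) by ring.
  by rewrite E subrr ltxx.
- have /eqP : (t - 1) ^+ 2 * (t + 2) = 0 by rewrite -[RHS](subrr (- 2)) -{1}E; ring.
  rewrite mulf_eq0 sqrf_eq0 => /orP[/eqP E1|/eqP E1] _; last by lra.
  by constructor 4; left; left; lra.
have [->|ne1] := eqVneq t (phi - 1); first by constructor 3.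
have {ne1} gt1 : phi - 1 < t by rewrite lt_neqAle eq_sym ne1.
(* [phi] and [phi - 1] are 2 cos of 36 and 72 degrees, and 2 cos of 216 degrees is [- phi]. So
   [phi - 1] is a root of [t^3 - 3 t + phi], and removing it leaves a quadratic inequality. *)
have l3' : 0 <= (t - (phi - 1)) * (t ^+ 2 + (phi - 1) * t - (phi + 1)).
  have -> : (t - (phi - 1)) * (t ^+ 2 + (phi - 1) * t - (phi + 1)) =
     t ^+ 3 - 3 * t + phi + (phi ^+ 2 - phi - 1) - t * (phi ^+ 2 - phi - 1) by ring.
  by rewrite Ephi; lra.
have {l3'} l3' : 0 <= t ^+ 2 + (phi - 1) * t - (phi + 1).
  by move: l3'; rewrite pmulr_rge0 // subr_gt0.
constructor 4; case: P4 => [E|E|/andP[l4 _]].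
- have /eqP : t ^+ 2 * (2 - t) * (2 + t) = 0.
    have -> : t ^+ 2 * (2 - t) * (2 + t) = 2 - (t ^+ 4 - 4 * t ^+ 2 + 2) by ring.
    by rewrite E subrr.
  by rewrite (mulf_eq0 _ (2 + t)) (mulf_eq0 _ (2 - t)) sqrf_eq0 => /orP[/orP[]|] /eqP; lra.
- left; right; have /eqP : (t ^+ 2 - 2) ^+ 2 = 0 
    by have -> : (t ^+ 2 - 2) ^+ 2 = (t ^+ 4 - 4 * t ^+ 2 + 2) + 2 by [ring]; rewrite E addNr.
  by rewrite sqrf_eq0 subr_eq0 => /eqP.
(* 2 cos of 144 degrees is [- phi], so [t^4 - 4 t^2 + 2 + phi] vanishes at [phi]; it is a difference
   of squares. For [t < phi] its first factor is negative, and the sign of the second contradicts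
   the bound from the third power. *)
right; have l4' : 0 <= (t ^+ 2 - 2 - (phi - 1)) * (t ^+ 2 - 2 + (phi - 1)).
  have -> : (t ^+ 2 - 2 - (phi - 1)) * (t ^+ 2 - 2 + (phi - 1)) =
    t ^+ 4 - 4 * t ^+ 2 + 2 + phi - (phi ^+ 2 - phi - 1) by ring.
  by rewrite Ephi; lra.
apply/eqP; rewrite eq_le lt leNgt; apply/negP => ltt.
have l5 : t ^+ 2 - 2 - (phi - 1) < 0 by nra.
have : t ^+ 2 - 2 + (phi - 1) <= 0 by rewrite -(nmulr_rge0 _ l5).
nra.
Qed.

End HamiltonNorm.

(** A faithful representation by unit quaternions. The element [e] lying over -1 allows every trace
    to be negated inside [G]. *)
Record unit_rep (R : rcfType) (gT : finGroupType) (G : {group gT})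
    (rho : gT -> quat (-1 : R) (-1 : R)) (e : gT) : Prop := UnitRep {
  repM : {in G &, {morph rho : g h / (g * h)%g >-> g * h}};
  rep_inj : {in G &, injective rho};
  rep_norm : {in G, forall g, qnorm (rho g) = 1};
  rep_e_in : e \in G;
  rep_e : rho e = -1 }.

Section HamiltonGroup.

Variables (R : rcfType) (gT : finGroupType) (G : {group gT}).
Local Notation H := (quat (-1 : R) (-1 : R)).
Variables (rho : gT -> H) (e : gT).
Hypothesis hrep : unit_rep G rho e.

Let rhoM := repM hrep.
Let rho_inj := rep_inj hrep.
Let rho_norm := rep_norm hrep.
Let Ge := rep_e_in hrep.
Let rho_e := rep_e hrep.

Let t g := qtr (rho g).

Lemma rho_neq0 g : g \in G -> rho g != 0.
Proof.
move=> Gg; apply/eqP => r0; have := rho_norm Gg.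
by rewrite r0 qnorm_def /= => /eqP; rewrite !expr0n /= !mulr0 !subr0 addr0 eq_sym oner_eq0.
Qed.

Lemma rho1 : rho 1%g = 1.
Proof.
apply: (quat_mulfI (@hamilton_aniso R) (rho_neq0 (group1 G))).
by rewrite -rhoM // mulg1 mulr1.
Qed.

Lemma rhoV g : g \in G -> rho g^-1%g = qconj (rho g).
Proof.
move=> Gg; apply: (quat_mulfI (@hamilton_aniso R) (rho_neq0 Gg)).
by rewrite -rhoM ?groupV // mulgV rho1 qnormE rho_norm // scale1r.
Qed.

Lemma rho_comm g h : g \in G -> h \in G ->
  (rho g * rho h = rho h * rho g) <-> commute g h.
Proof.
move=> Gg Gh; rewrite -!rhoM //; split=> [/rho_inj|-> //].
by apply; rewrite groupM.
Qed.

Lemma e_comm g : g \in G -> commute e g.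
Proof. by move=> Gg; apply/rho_comm; rewrite // rho_e mulrN1 mulN1r. Qed.

Lemma eK g : (e * (e * g) = g)%g.
Proof.
have e2 : (e * e = 1)%g by apply: rho_inj; rewrite ?groupM // rhoM // rho_e rho1 mulrNN mulr1.
by rewrite mulgA e2 mul1g.
Qed.

Lemma ee : (e * e = 1)%g. Proof. by have := eK 1; rewrite mulg1. Qed.

Lemma trM g h : g \in G -> h \in G -> t (g * h)%g + t (g * h^-1)%g = t g * t h.
Proof. by move=> Gg Gh; rewrite /t !rhoM ?groupV // rhoV // qtr_mul. Qed.

Lemma trC g h : g \in G -> h \in G -> t (g * h)%g = t (h * g)%g.
Proof. by move=> Gg Gh; rewrite /t !rhoM // qtrMC. Qed.

Lemma tr1 : t 1%g = 2. Proof. by rewrite /t rho1. Qed.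

Lemma trV g : g \in G -> t g^-1%g = t g.
Proof. by move=> Gg; rewrite /t rhoV. Qed.

Lemma trN g : g \in G -> t (e * g)%g = - t g.
Proof. by move=> Gg; rewrite /t rhoM // rho_e mulN1r qtrN. Qed.

Lemma tr_eq2 g : g \in G -> t g = 2 -> g = 1%g.
Proof.
by move=> Gg /hamilton_qtr2 E; apply: rho_inj => //; rewrite rho1 E ?rho_norm.
Qed.

Lemma tr_le2 g : g \in G -> t g <= 2.
Proof. by move=> Gg; apply: hamilton_qtr_le2; apply: rho_norm. Qed.

Lemma tr_sqr g : g \in G -> t (g * g)%g = t g ^+ 2 - 2.
Proof. by move=> Gg; rewrite expr2 -trM // mulgV tr1 addrK. Qed.

Lemma tr_conj g h : g \in G -> h \in G -> t (h * g * h^-1)%g = t g.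
Proof. by move=> Gg Gh; rewrite trC ?groupM ?groupV // mulgA mulVg mul1g. Qed.

Lemma tr_comm g h : g \in G -> h \in G -> commute g h -> t g = t h ->
  g = h \/ g = h^-1%g.
Proof.
move=> Gg Gh /(rho_comm Gg Gh) Cgh Et.
have [|E|E] := comm_same_qtr (@hamilton_aniso R) Cgh Et.
- by rewrite !rho_norm.
- by left; apply: rho_inj.
by right; apply: rho_inj; rewrite ?groupV // rhoV.
Qed.

Lemma tr0_sqr g : g \in G -> t g = 0 -> (g * g = e)%g.
Proof.
move=> Gg tg; apply: rho_inj; rewrite ?groupM // rhoM // sqr_quat rho_norm //.
by rewrite -[qtr _]/(t g) tg scale0r add0r scale1r rho_e.
Qed.

(* Fricke's identity for the trace of a commutator. *)
Lemma tr_commutator g h : g \in G -> h \in G ->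
  t (g * h * g^-1 * h^-1)%g = t g ^+ 2 + t h ^+ 2 - 2 - t (g * h)%g * t (g * h^-1)%g.
Proof.
move=> Gg Gh; have [GV HV] : (g^-1 \in G /\ h^-1 \in G)%g by rewrite !groupV.
have E1 := trM Gg (groupM Gh (groupM GV HV)).
have E2 := trM (groupM Gg Gh) (groupM Gg HV).
rewrite !invMg !invgK in E1 E2.
have E3 : t (g * (h * (g^-1 * h^-1)))%g = t (g * h * g^-1 * h^-1)%g by rewrite !mulgA.
have E4 : t (h * (g^-1 * h^-1))%g = t g by rewrite mulgA tr_conj // trV.
have E5 : t (g * (h * g * h^-1))%g = t (g * h * (g * h^-1))%g by rewrite !mulgA.
have E6 : t (g * h * (h * g^-1))%g = t h ^+ 2 - 2.
  by rewrite mulgA -(mulgA g) tr_conj ?tr_sqr ?groupM.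
rewrite E3 E4 E5 in E1; rewrite E6 in E2.
lra.
Qed.

Hypothesis nonab : ~~ abelian G.

Lemma e_neq1 : e != 1%g.
Proof.
apply/eqP => E; have := rho1; rewrite -E rho_e => /(congr1 (@qre _ _ _)) /=.
lra.
Qed.

(** Multiplication by [e] turns the maximality of [t z] into the lower bound. A nonabelian group has
    an element besides 1 and [e], and its two bounds force [0 <= t z]. *)
Lemma tr_max : exists2 z, z \in G & [/\ t z < 2, 0 <= t z &
  {in G, forall g, [\/ g = 1%g, g = e | - t z <= t g <= t z]}].
Proof.
have P0 : (e \in G) && (e != 1%g) by rewrite Ge e_neq1.
case: (@arg_maxP _ _ _ e [pred g in G | g != 1%g] t P0) => z /andP[Gz z1] zmax'.
have zmax g : g \in G -> g != 1%g -> t g <= t z.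
  by move=> Gg g1; apply: zmax'; rewrite inE Gg.

have bound g : g \in G -> [\/ g = 1%g, g = e | - t z <= t g <= t z].
  move=> Gg; have [->|g1] := eqVneq g 1%g; first by constructor 1.
  have [->|ge] := eqVneq g e; first by constructor 2.
  constructor 3; rewrite zmax // andbT lerNl -trN //.
  apply: zmax; rewrite ?groupM //; apply: contra ge => /eqP eg1.
  by rewrite -[g]eK eg1 mulg1.
exists z => //; split=> //.
  rewrite lt_neqAle tr_le2 // andbT; apply: contra z1 => /eqP/(tr_eq2 Gz) ->.
  exact: eqxx.
have [/existsP[g /and3P[Gg g1 ge]]|] := boolP [exists g, [&& g \in G, g != 1%g & g != e]].
  have [/eqP|/eqP|/andP[]] := bound g Gg; rewrite ?(negbTE g1) ?(negbTE ge) //.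
  lra.
rewrite negb_exists => /forallP all1e; case/negP: nonab.
apply/centsP => g Gg h Gh; have := all1e g; rewrite Gg /= negb_and !negbK.
case/orP=> /eqP ->; first exact: commute_sym (commute1 _).
exact: e_comm.
Qed.


Definition inverts_cyclic z := {in G, forall g, g * z * g^-1 = z \/ g * z * g^-1 = z^-1}%g.

(** A conjugate of [z] has the trace of [z]; if it commutes with [z] it is [z] or its inverse. If
    the largest trace is 0, all elements except 1 and [e] have square [e], and [g^2 = (gz)^2 = e]
    makes [g] invert [z]. *)
Lemma dihedral_of_comm z : z \in G -> t z < 2 -> 0 <= t z ->
    {in G, forall g, [\/ g = 1%g, g = e | - t z <= t g <= t z]} ->
    (t z = 0 \/ {in G, forall g, t g = t z -> commute g z}) ->
  inverts_cyclic z.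
Proof.
move=> Gz tz2 tz0 bound [tz|comT] g Gg; last first.
  have Gc : (g * z * g^-1)%g \in G by rewrite !groupM ?groupV.
  by apply: tr_comm => //; [apply: comT; rewrite ?tr_conj|rewrite tr_conj].
have b0 x : x \in G -> [\/ x = 1%g, x = e | t x = 0].
  move=> Gx; have [->|->|] := bound x Gx; [by constructor 1|by constructor 2|].
  by rewrite tz oppr0 => /andP[? ?]; constructor 3; lra.
have comm_l x : x \in G -> commute x z -> (x * z * x^-1 = z)%g.
  by move=> Gx ->; rewrite mulgK.
have [->|->|tg] := b0 g Gg; first by left; rewrite mul1g invg1 mulg1.
  by left; apply: comm_l; last apply: e_comm.
have [Egz|Egz|tgz] := b0 _ (groupM Gg Gz).
- left; apply: comm_l => //; have -> : g = z^-1%g by apply: (mulIg z); rewrite Egz mulVg.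
  exact/commute_sym/commuteV.
- left; apply: comm_l => //; have -> : g = (e * z^-1)%g by apply: (mulIg z); rewrite mulgVK.
  apply/commute_sym/commuteM; first exact/commute_sym/e_comm.
  exact/commuteV.
right; have sq := tr0_sqr (groupM Gg Gz) tgz.
have gV : g^-1%g = (e * g)%g.
  by apply: (mulIg g); rewrite mulVg -mulgA (tr0_sqr Gg tg) ee.
rewrite gV !mulgA -(e_comm (groupM Gg Gz)) -!mulgA; apply: (mulIg z).
by rewrite mulVg -!mulgA [(g * (z * _))%g]mulgA sq ee.
Qed.

Definition polyhedral_pair (z1 z2 : gT) :=
  [/\ z1 \in G, z2 \in G, ~ commute z1 z2, t z1 = t z2 & t (z1 * z2)%g = 1].

Lemma dichotomy :
  (exists z, [/\ z \in G, z != 1%g, z != e & inverts_cyclic z]) \/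
  exists z1 z2, [/\ polyhedral_pair z1 z2,
    {in G, forall g, [\/ g = 1%g, g = e | - t z1 <= t g <= t z1]},
    0 <= t z1 &
    [\/ t z1 = 1, t z1 ^+ 2 = 2 | t z1 ^+ 2 = t z1 + 1]].
Proof.
have [z Gz [tz2 tz0 bound]] := tr_max.
have [z1 ze] : z != 1%g /\ z != e.
  split; apply/eqP => E; move: tz2 tz0; rewrite E ?tr1; first by lra.
  by have := trN (group1 G); rewrite mulg1 tr1; lra.
have [tz|tz] := eqVneq (t z) 0.
  by left; exists z; split=> //; apply: dihedral_of_comm => //; left.
have {tz tz0} tz0 : 0 < t z by rewrite lt_neqAle eq_sym tz.
pose P := [pred p : gT * gT | [&& p.1 \in G, p.2 \in G, t p.1 == t z, t p.2 == t z
  & (p.1 * p.2 != p.2 * p.1)%g]].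
have [p0 Pp0|noP] := pickP P; last first.
  left; exists z; split=> //; apply: dihedral_of_comm => //; first exact: ltW.
  right=> g Gg tg; have := noP (g, z); rewrite /= Gg Gz tg !eqxx /=.
  by move/negbFE/eqP.
(* A larger trace of [a b^-1] means that [a] and [b] are closer: this selects a closest noncommuting
   pair among the elements of trace [t z]. *)
have := @arg_maxP _ _ _ p0 P (fun p => t (p.1 * p.2^-1)%g) Pp0.
case=> -[a b] /and5P[/= Ga Gb /eqP ta /eqP tb /eqP Nab] umax'.
have umax x y : x \in G -> y \in G -> t x = t z -> t y = t z -> ~ commute x y ->
    t (x * y^-1)%g <= t (a * b^-1)%g.
  move=> Gx Gy tx ty Nxy; apply: (umax' (x, y)).
  by rewrite /= Gx Gy tx ty !eqxx /=; apply/eqP.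
have sq x : x \in G -> t x = 0 -> (x * x = e)%g := @tr0_sqr x.
set u := t (a * b^-1)%g in umax; pose s := t (a * b)%g.
have Esu : s + u = t z ^+ 2 by rewrite /s /u trM // ta tb expr2.
have bound2 x : x \in G -> ~ commute x a -> - t z <= t x <= t z.
  move=> Gx Nx; have [E|E|//] := bound x Gx; case: Nx; rewrite E.
    exact: commute_sym (commute1 _).
  exact: e_comm.
have Nabb : ~ commute (a * b)%g a.
  by move=> C; apply: Nab; apply: (mulgI a); rewrite -C mulgA.
have NabV : ~ commute (a * b^-1)%g a.
  move=> C; apply: Nab; apply/commute_sym; rewrite -(invgK b); apply/commute_sym/commuteV.
  by apply: (mulgI a); rewrite -C mulgA.
have /andP[ls us] := bound2 _ (groupM Ga Gb) Nabb.
have /andP[lu uu] := bound2 _ (groupM Ga (groupVr Gb)) NabV.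
rewrite -/s -/u in ls us lu uu.
have Gc : (a * b * a^-1)%g \in G by rewrite !groupM ?groupV.
(* Otherwise [a b a^-1 = b^-1]. Then [s = u], the commutator is [b^-2], and Fricke's identity leaves
   [u = 0] or [u = 2], against [0 < t z < 2]. *)
have Ncomm : ~ commute b (a * b * a^-1)%g.
  move=> C; have [|E|E] := tr_comm Gb Gc C; first by rewrite tr_conj.
    by apply: Nab; rewrite -[(b * a)%g]/(b * a)%g {2}E mulgVK.
  have Eb : b^-1%g = (a * b * a^-1)%g by rewrite {1}E invgK.
  have Esu2 : s = u by rewrite /s /u Eb [RHS]trC ?groupM ?groupV // mulgVK.
  have := tr_commutator Ga Gb; rewrite -/s -/u ta tb Esu2 -Eb.
  rewrite tr_sqr ?groupV // trV // tb; rewrite Esu2 in Esu => E2.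
  have /eqP : u * (u - 2) = 0 by rewrite mulrBr; lra.
  by rewrite mulf_eq0 subr_eq0 => /orP[]/eqP u02; move: Esu; rewrite u02; nra.
(* The pair [b], [a b a^-1] competes with [a], [b]; its value is the trace of a commutator, hence at
   most [u]. Fricke's identity with [s = (t z)^2 - u] gives this product. *)
have ineq : (u - 2) * (u - (t z ^+ 2 - 1)) <= 0.
  have := umax b (a * b * a^-1)%g Gb Gc tb; rewrite tr_conj // tb => /(_ (erefl _) Ncomm).
  have -> : (b * (a * b * a^-1)^-1 = b * a * b^-1 * a^-1)%g by rewrite !invMg invgK !mulgA.
  rewrite tr_commutator // ta tb (trC Gb Ga) -/s.
  have -> : t (b * a^-1)%g = u by rewrite -trV ?groupM ?groupV // invMg invgK.
  have -> : s = t z ^+ 2 - u by lra.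
  lra.
(* As [u < 2], the second factor is nonnegative, so [(t z)^2 - 1 <= u <= t z]. *)
have tau_le : t z ^+ 2 <= t z + 1.
  have u2 : u - 2 < 0 by lra.
  by move: ineq; rewrite nmulr_rle0 // subr_ge0; lra.
pose phi : R := (1 + Num.sqrt 5) / 2.
have s5 : Num.sqrt (5 : R) ^+ 2 = 5 by rewrite sqr_sqrtr.
have s50 : 0 <= Num.sqrt (5 : R) by apply: sqrtr_ge0.
have phi0 : 0 < phi by rewrite /phi; lra.
have Ephi : phi ^+ 2 = phi + 1.
  have -> : phi ^+ 2 = (1 + 2 * Num.sqrt 5 + Num.sqrt 5 ^+ 2) / 4 by rewrite /phi; field.
  by rewrite s5 /phi; field.
have phi12 : 1 <= 2 * phi by rewrite /phi; lra.
have tau_phi : t z <= phi.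
  rewrite leNgt; apply/negP => lt.
  have : 0 < (t z - phi) * (t z + phi - 1) by rewrite mulr_gt0 //; lra.
  have -> : (t z - phi) * (t z + phi - 1) = t z ^+ 2 - t z - (phi ^+ 2 - phi) by ring.
  by rewrite Ephi; lra.
clearbody phi; clear s5 s50.
have Pt x : x \in G -> [\/ t x = 2, t x = - 2 | - phi <= t x <= phi].
  move=> Gx; have [->|->|/andP[? ?]] := bound x Gx; first by rewrite tr1; constructor 1.
    by constructor 2; have := trN (group1 G); rewrite mulg1 tr1.
  by constructor 3; apply/andP; split; lra.
have quant x : x \in G -> 0 <= t x ->
    [\/ t x = 2, t x = 0, t x = phi - 1 | (t x = 1 \/ t x ^+ 2 = 2) \/ t x = phi].
  move=> Gx tx0; apply: trace_quantization => //; first exact: Pt.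
  - by rewrite -tr_sqr //; apply: Pt; rewrite groupM.
  - have -> : t x ^+ 3 - 3 * t x = t (x * x * x)%g.
      have := trM (groupM Gx Gx) Gx; rewrite mulgK tr_sqr // => E.
      by apply: (addIr (t x)); rewrite E; ring.
    by apply: Pt; rewrite !groupM.
  have -> : t x ^+ 4 - 4 * t x ^+ 2 + 2 = t (x * x * (x * x))%g.
    by rewrite !tr_sqr ?groupM //; ring.
  by apply: Pt; rewrite !groupM.
have sq_bound : - t z <= t z ^+ 2 - 2.
  have [E|E|] := bound _ (groupM Gz Gz); last by rewrite tr_sqr // => /andP[].
    by have := tr_sqr Gz; rewrite E tr1; nra.
  by have := tr_sqr Gz; rewrite E; have := trN (group1 G); rewrite mulg1 tr1; nra.
have tau_val : [\/ t z = 1, t z ^+ 2 = 2 | t z = phi].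
  have [E|E|E|[[E|E]|E]] := quant z Gz (ltW tz0); try lra.
  - by rewrite E in sq_bound; nra.
  - by constructor 1.
  - by constructor 2.
  by constructor 3.
have val_su : s = 1 \/ u = 1.
  have s0 : 0 <= s by nra.
  have u0 : 0 <= u by nra.
  (* [s] and [u] are quantized traces with sum [(t z)^2]. Rational enclosures of [phi] and the
     square root of 2 are sharp enough to exclude by linear arithmetic every combination without a
     1. *)
  have phiB : 8 / 5 < phi < 13 / 8 by apply/andP; split; nra.
  have sqrt2B (v : R) : 0 <= v -> v ^+ 2 = 2 -> 7 / 5 < v < 17 / 12.
    by move=> v0 Ev; apply/andP; split; nra.
  have quantB x : x \in G -> 0 <= t x ->
    [\/ t x = 2, t x = 0, t x = phi - 1 | (t x = 1 \/ 7 / 5 < t x < 17 / 12) \/ t x = phi].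
    move=> Gx tx0; have [E|E|E|[[E|E]|E]] := quant x Gx tx0;
      [by constructor 1|by constructor 2|by constructor 3|
       by constructor 4; left; left| |by constructor 4; right].
    by constructor 4; left; right; apply: sqrt2B.
  have {}tau_val : [\/ t z = 1 /\ s + u = 1, 7 / 5 < t z < 17 / 12 /\ s + u = 2
      | t z = phi /\ s + u = phi + 1].
    rewrite Esu; case: tau_val => E; first by constructor 1; rewrite E expr1n.
      by constructor 2; split=> //; apply: sqrt2B => //; apply: ltW.
    by constructor 3; rewrite E.
  have := quantB _ (groupM Ga Gb) s0; have := quantB _ (groupM Ga (groupVr Gb)) u0.
  move: us uu s0 u0 phiB tau_val; rewrite -/s -/u; clear.
  move: (t z) => tau us uu s0 u0 /andP[phi1 phi2] tau_val valu vals.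
  case: vals => [Es|Es|Es|[[Es|/andP[Es Es']]|Es]]; try (by left);
  case: valu => [Eu|Eu|Eu|[[Eu|/andP[Eu Eu']]|Eu]]; try (by right); exfalso;
  case: tau_val => -[Et Esu]; try case/andP: Et => Et Et'; lra.
have tau_val' : [\/ t z = 1, t z ^+ 2 = 2 | t z ^+ 2 = t z + 1].
  by case: tau_val => [->|->|->]; [constructor 1|constructor 2|constructor 3].
right; case: val_su => E1.
  by exists a, b; rewrite /polyhedral_pair ta tb; split=> //; apply: ltW.
exists a, b^-1%g; rewrite /polyhedral_pair ta trV // tb groupV; split=> //; last exact: ltW.
split=> // C; apply: Nab; rewrite -(invgK b); exact: commuteV.
Qed.

End HamiltonGroup.

(** * Centralizers of nonreal quaternions and the dihedral case *)

Section Centralizer.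

Variable R : rcfType.
Local Notation H := (quat (-1 : R) (-1 : R)).
Implicit Types z w : H.

Definition im_sqr z := qi z ^+ 2 + qj z ^+ 2 + qij z ^+ 2.
Definition im_dot z w := qi z * qi w + qj z * qj w + qij z * qij w.

(** The commutator is twice the cross product of the imaginary parts. *)
Lemma commute_cross z w : z * w = w * z ->
  [/\ qj z * qij w = qij z * qj w, qij z * qi w = qi z * qij w
    & qi z * qj w = qj z * qi w].
Proof.
move=> E; have Ei := congr1 (@qi _ _ _) E; have Ej := congr1 (@qj _ _ _) E.
have Ek := congr1 (@qij _ _ _) E; rewrite !quatE in Ei Ej Ek.
by split; lra.
Qed.

Lemma commute_span z w : 0 < im_sqr z -> z * w = w * z ->
  exists c d : R, w = c%:A + d *: z.
Proof.
move=> Nz /commute_cross[E1 E2 E3]; have N0 : im_sqr z != 0 by rewrite gt_eqF.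
pose d := im_dot z w / im_sqr z; exists (qre w - d * qre z), d.
have scale (u v : R) : u * im_sqr z = im_dot z w * v -> u = d * v.
  by move=> E; apply: (mulIf N0); rewrite E /d; field.
rewrite qscalarE; apply: quat_eqP; rewrite !quatE /=; first by ring.
all: rewrite add0r; apply: scale; rewrite /im_sqr /im_dot.
- have -> : qi w * (qi z ^+ 2 + qj z ^+ 2 + qij z ^+ 2) = qi z * qi w * qi z + qj z * (qj z * qi w) + qij z * (qij z * qi w) by ring.
  by rewrite -E3 E2; ring.
- have -> : qj w * (qi z ^+ 2 + qj z ^+ 2 + qij z ^+ 2) = qi z * (qi z * qj w) + qj z * qj w * qj z + qij z * (qij z * qj w) by ring.
  by rewrite E3 -E1; ring.
have -> : qij w * (qi z ^+ 2 + qj z ^+ 2 + qij z ^+ 2) = qi z * (qi z * qij w) + qj z * (qj z * qij w) + qij z * qij w * qij z by ring.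
by rewrite -E2 E1; ring.
Qed.

(** On the centralizer of a nonreal [z], which is [R[z]], this is the isomorphism with the complex
    numbers sending the normalized imaginary part of [z] to i. *)
Definition to_complex z w : R[i] := Complex (qre w) (im_dot z w / Num.sqrt (im_sqr z)).

Lemma to_complexM z w w' : 0 < im_sqr z -> z * w = w * z -> z * w' = w' * z ->
  to_complex z (w * w') = to_complex z w * to_complex z w'.
Proof.
move=> Nz /(commute_span Nz)[c [d ->]] /(commute_span Nz)[c' [d' ->]].
have s0 : Num.sqrt (im_sqr z) != 0 by rewrite gt_eqF ?sqrtr_gt0.
have dot (a b : R) : im_dot z (a%:A + b *: z) = b * im_sqr z.
  by rewrite qscalarE /im_dot /im_sqr !quatE /=; ring.
have -> : (c%:A + d *: z) * (c'%:A + d' *: z) =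
    (c * c' - d * d' * qnorm z)%:A + (c * d' + c' * d + d * d' * qtr z) *: z.
  rewrite !qscalarE hamilton_norm /qtr; apply: quat_eqP; rewrite !quatE /=; ring.
have Es : im_sqr z = Num.sqrt (im_sqr z) ^+ 2 by rewrite sqr_sqrtr // ltW.
have reE (a b : R) : qre (a%:A + b *: z) = a + b * qre z by rewrite qscalarE.
have mulcE (p q p' q' : R) : Complex p q * Complex p' q' = Complex (p * p' - q * q') (p * q' + q * p') by [].
rewrite /to_complex mulcE !dot !reE hamilton_norm /qtr.
move: (Num.sqrt _) s0 Es => s s0 Es.
have -> : qre z ^+ 2 + qi z ^+ 2 + qj z ^+ 2 + qij z ^+ 2 = qre z ^+ 2 + s ^+ 2.
  by rewrite -Es /im_sqr; ring.
by rewrite Es; congr Complex; field.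
Qed.

End Centralizer.

Section DihedralCase.

Variables (R : rcfType) (gT : finGroupType) (G : {group gT}).
Local Notation H := (quat (-1 : R) (-1 : R)).
Variables (rho : gT -> H) (e : gT).
Hypothesis hrep : unit_rep G rho e.

Let rhoM := repM hrep.
Let rho_inj := rep_inj hrep.
Let rho_norm := rep_norm hrep.
Let Ge := rep_e_in hrep.
Let rho_e := rep_e hrep.

Hypothesis nonab : ~~ abelian G.

Let t g := qtr (rho g).

Lemma im_sqr_gt0 z : z \in G -> z != 1%g -> z != e -> 0 < im_sqr (rho z).
Proof.
move=> Gz z1 ze; have S (u : R) : 0 <= u ^+ 2 := sqr_ge0 u.
rewrite lt_neqAle !addr_ge0 ?S // andbT; apply/eqP => /esym N0.
have := rho_norm Gz; rewrite hamilton_norm -!addrA !addrA.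
have -> : qre (rho z) ^+ 2 + qi (rho z) ^+ 2 + qj (rho z) ^+ 2 + qij (rho z) ^+ 2 =
  qre (rho z) ^+ 2 + im_sqr (rho z) by rewrite /im_sqr; ring.
rewrite N0 addr0 => /eqP; rewrite sqrf_eq1 => /orP[]/eqP E.
  by case/eqP: z1; apply: (tr_eq2 hrep) => //; rewrite /qtr E.
case/eqP: ze; rewrite -[z](eK hrep).
rewrite -[e in RHS]mulg1; congr (_ * _)%g.
apply: (tr_eq2 hrep); first by rewrite groupM.
by rewrite (trN hrep) // /qtr E; ring.
Qed.

(** [to_complex] embeds the centralizer in the multiplicative group of a field, where finite
    subgroups are cyclic. *)
Lemma centralizer_cyclic z :
  z \in G -> z != 1%g -> z != e -> cyclic 'C_G[z].
Proof.
move=> Gz z1 ze; have Nz := im_sqr_gt0 Gz z1 ze.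
have comm g : g \in 'C_G[z]%g -> g \in G /\ rho z * rho g = rho g * rho z.
  case/setIP => Gg /cent1P C; split=> //.
  by apply/(rho_comm hrep) => //; apply: commute_sym.
apply: (@field_mul_group_cyclic _ _ _ (fun g => to_complex (rho z) (rho g))).
  by move=> g h /comm[Gg Cg] /comm[Gh Ch]; rewrite rhoM // to_complexM.
move=> g /comm[Gg Cg]; split=> [/(congr1 (@complex.Re R)) /= re1|->].
  by apply: (tr_eq2 hrep) => //; rewrite /qtr re1.
apply/eqP; rewrite eq_complex (rho1 hrep) /= /im_dot /= !mulr0 !addr0 mul0r.
by rewrite !eqxx.
Qed.

(** The product of two elements inverting [z] commutes with [z], so the cyclic centralizer has index
    2. An element [g] outside inverts all of it, in particular [g^2]; hence [g^4 = 1], and [g^2 = e]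
    because 1 and [e] are the only elements with square 1. *)
Lemma dihedral_case z :
    z \in G -> z != 1%g -> z != e -> inverts_cyclic G z ->
  exists m x y, [/\ (1 < m)%N, binary_dihedral m G,
    [/\ x \in G, y \in G, ~ commute y x & G = <<[set y; x]>>%G],
    #[y]%g = (2 * m)%N & t x = 0 /\ t (y * x)%g = 0].
Proof.
move=> Gz z1 ze inv; have Nz := im_sqr_gt0 Gz z1 ze.
have [y defC] := cyclicP (centralizer_cyclic Gz z1 ze).
have CgG g : g \in G -> g \notin 'C_G[z]%g -> (g * z * g^-1 = z^-1)%g.
  move=> Gg; rewrite inE Gg /=; have [E|//] := inv g Gg.
  have C : (g * z = z * g)%g by rewrite -{2}E mulgVK.
  by case/cent1P.
have Cy : y \in 'C_G[z]%g by rewrite defC cycle_id.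
have [Gy cyz] : y \in G /\ commute z y by case/setIP: Cy => ? /cent1P.
have invC g h : g \in G -> g \notin 'C_G[z]%g -> h \in 'C_G[z]%g -> (g * h * g^-1 = h^-1)%g.
  move=> Gg Ng /setIP[Gh /cent1P Ch].
  have Eg := CgG g Gg Ng.
  have Eg' : rho g * rho z = qconj (rho z) * rho g.
    rewrite -(rhoV hrep) // -!rhoM ?groupV //; congr rho.
    by rewrite -Eg mulgKV.
  have [|c [d Eh]] := @commute_span R (rho z) (rho h) Nz.
    by apply/(rho_comm hrep).
  apply: (mulIg g); rewrite mulgKV; apply: rho_inj; rewrite ?groupM ?groupV //.
  rewrite !rhoM ?groupV // (rhoV hrep) // Eh mulrDr -mul_scalarC.
  rewrite -scalerAr Eg' scalerAl -mulrDl; congr (_ * _).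
  by rewrite !qscalarE; apply: quat_eqP; rewrite /= ?quatE /=; ring.
have invol g : g \in G -> (g * g = 1)%g -> g = 1%g \/ g = e.
  move=> Gg gg; have := tr_sqr hrep Gg; rewrite gg (tr1 hrep) => E.
  have /eqP : (t g - 2) * (t g + 2) = 0 by rewrite -/(t g) in E; lra.
  rewrite mulf_eq0 subr_eq0 addr_eq0 => /orP[]/eqP tg.
    by left; apply: (tr_eq2 hrep).
  right; rewrite -[g](eK hrep).
  rewrite -[RHS]mulg1; congr (_ * _)%g.
  apply: (tr_eq2 hrep); first by rewrite groupM.
  by rewrite (trN hrep) // -/(t g) tg opprK.
have Ce : e \in ('C_G[z])%g.
  by rewrite inE Ge /=; apply/cent1P; apply: (e_comm hrep).
have outM g h : g \in G -> h \in G -> g \notin 'C_G[z]%g -> h \notin 'C_G[z]%g ->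
    (g * h)%g \in 'C_G[z]%g.
  move=> Gg Gh Ng Nh; rewrite inE groupM //=; apply/cent1P.
  have Eg := CgG g Gg Ng; have Eh := CgG h Gh Nh.
  have E1 : (h * z = z^-1 * h)%g by rewrite -Eh mulgVK.
  have E2 : (g * z^-1 = z * g)%g.
    by have := congr1 (@invg _) Eg; rewrite !invMg !invgK => {2}<-; rewrite mulgA mulgVK.
  by rewrite /commute -mulgA E1 [LHS]mulgA E2 -mulgA.
have sqr_out g : g \in G -> g \notin 'C_G[z]%g -> (g * g)%g = e.
  move=> Gg Ng; have Cgg := outM g g Gg Gg Ng Ng.
  have [||E|//] := invol (g * g)%g; rewrite ?groupM //.
    have := invC g _ Gg Ng Cgg; rewrite !mulgA mulgK => E.
    by rewrite {1}E -mulgA mulVg.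
  have [E1|E1] := invol g Gg E; first by rewrite E1 group1 in Ng.
  by rewrite E1 Ce in Ng.
have tr_out g : g \in G -> g \notin 'C_G[z]%g -> t g = 0.
  move=> Gg Ng; have := tr_sqr hrep Gg; rewrite (sqr_out g Gg Ng).
  have -> : qtr (rho e) = - 2 by rewrite rho_e qtrN.
  move=> E; apply/eqP; rewrite -sqrf_eq0; apply/eqP; rewrite /t; lra.
have /existsP[x /andP[Gx Nx]] : [exists x, (x \in G) && (x \notin 'C_G[z]%g)].
  rewrite -negb_forall_in; apply: contra nonab => /forall_inP sub.
  by apply: abelianS (_ : G \subset 'C_G[z]%g) _; [apply/subsetP|rewrite defC cycle_abelian].
have invy := invC x y Gx Nx Cy.
have yy : (y * y != 1)%g.
  apply/eqP => yy; have [k Ez] : exists k, z = (y ^+ k)%g.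
    by apply/cycleP; rewrite -defC inE Gz; apply/cent1P.
  have [|E|E] := invol z Gz.
  - by rewrite Ez -expgMn // yy expg1n.
  - by rewrite E eqxx in z1.
  by rewrite E eqxx in ze.
have Oe : #[e]%g = 2%N.
  by apply: nt_prime_order => //; [rewrite expg2; apply: ee hrep|apply: e_neq1 hrep].
have /dvdnP[m Em] : (2 %| #[y]%g)%N by rewrite -Oe [#[y]%g]orderE -defC order_dvdG.
have m0 : (0 < m)%N by rewrite -(ltn_pmul2r (isT : 0 < 2)%N) -Em order_gt0.
rewrite mulnC in Em.
have ym : (y ^+ m = e)%g.
  have [||E|//] := invol (y ^+ m)%g; rewrite ?groupX //.
    by rewrite -expgD addnn -mul2n -Em expg_order.
  have := order_dvdn y m; rewrite E eqxx Em => /dvdn_leq; rewrite m0 => /(_ isT).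
  by rewrite leqNgt mul2n -addnn -{1}[m]addn0 ltn_add2l m0.
have defG : G = <<[set y; x]>>%G.
  apply/val_inj/eqP; rewrite eqEsubset gen_subG /=; apply/andP; split; last first.
    by apply/subsetP => g /set2P[]->.
  have sCJ : 'C_G[z]%g \subset <<[set y; x]>>%g by rewrite defC cycle_subG mem_gen ?set21.
  have Jx : x \in <<[set y; x]>>%g by rewrite mem_gen ?set22.
  apply/subsetP => g Gg; have [/(subsetP sCJ)//|Ng] := boolP (g \in 'C_G[z]%g).
  rewrite -(groupMl g (groupVr Jx)); apply: (subsetP sCJ); apply: outM; rewrite ?groupV //.
exists m, x, y; split=> //.
- rewrite ltn_neqAle m0 andbT; apply: contra yy => /eqP m1.
  have Ey2 : #[y]%g = 2%N by rewrite Em -m1.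
  by rewrite -expg2 -{1}Ey2 expg_order.
- apply: dihedral_isoGrp => //.
    apply/homg_dihedralP; exists x, y; split=> //; first exact: (congr1 val defG).
      by rewrite -Em expg_order.
    by rewrite expg2 sqr_out.
  rewrite -[4%N]/(2 * 2)%N -mulnA -Em -(Lagrange (subsetIl G 'C[z]%g)) mulnC.
  rewrite {1}orderE -defC leq_mul2l indexg_gt1; apply/orP; right.
  by apply/subsetPn; exists x.
- split=> // C; case/eqP: yy; move: invy; rewrite -C mulgK => {2}->.
  exact: mulgV.
split; first exact: tr_out.
by apply: tr_out; [exact: groupM|rewrite (groupMl x Cy)].
Qed.

End DihedralCase.

(** Parseval's identity: [1, p, q, pq] is an orthonormal frame, and the four traces are, up to sign,
    twice the coordinates of [r] in it. *)
Lemma hamilton_parseval (R : realFieldType) (p q r : quat (-1 : R) (-1)) :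
    qtr p = 0 -> qtr q = 0 -> qnorm p = 1 -> qnorm q = 1 -> qtr (p * q) = 0 ->
  qtr r ^+ 2 + qtr (r * p) ^+ 2 + qtr (r * q) ^+ 2 + qtr (r * (p * q)) ^+ 2
    = 4 * qnorm r.
Proof.
have tr0 (x : quat (-1 : R) (-1)) : qtr x = 0 -> qre x = 0.
  by rewrite /qtr => /eqP; rewrite mulrn_eq0 => /eqP.
move=> /tr0 p0 /tr0 q0 Np Nq /tr0 pq0.
rewrite hamilton_norm p0 expr0n add0r in Np.
rewrite hamilton_norm q0 expr0n add0r in Nq.
rewrite quatE p0 q0 mul0r add0r in pq0.
have {}pq0 : qi p * qi q + qj p * qj q + qij p * qij q = 0 by lra.
pose N (x : quat (-1 : R) (-1)) := qi x ^+ 2 + qj x ^+ 2 + qij x ^+ 2.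
pose dot (x y : quat (-1 : R) (-1)) := qi x * qi y + qj x * qj y + qij x * qij y.
have dotE x y : qre y = 0 -> qtr (x * y) = - 2 * dot x y.
  by move=> y0; rewrite /qtr quatE y0 /dot; ring.
(* The imaginary part of [p q] is the cross product, so the left side is the square of a triple
   product, which is a Gram determinant. *)
have gram : dot r (p * q) ^+ 2 = N r * N p * N q + 2 * dot r p * dot p q * dot q r
    - N r * dot p q ^+ 2 - N p * dot q r ^+ 2 - N q * dot r p ^+ 2.
  by rewrite /dot !quatE p0 q0 /N; ring.
have pq0' : qre (p * q) = 0 by rewrite quatE p0 q0; lra.
rewrite !dotE // !exprMn gram /N Np Nq /(dot p q) pq0 (_ : dot q r = dot r q); last by rewrite /dot; ring.
by rewrite hamilton_norm /qtr; ring.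
Qed.

(** * The polyhedral case: pairs with equal traces whose product has trace 1 *)

Section LinearBasis.

Variables (R : rcfType) (A B : quat (-1 : R) (-1)) (tau : R).
Hypotheses (nA : qnorm A = 1) (nB : qnorm B = 1) (tA : qtr A = tau) (tB : qtr B = tau).
Hypothesis tAB : qtr (A * B) = 1.

Definition lin (c0 c1 c2 c3 : R) := c0%:A + c1 *: A + c2 *: B + c3 *: (A * B).

Let sqA : A * A = tau *: A - 1%:A. Proof. by rewrite sqr_quat tA nA. Qed.
Let sqB : B * B = tau *: B - 1%:A. Proof. by rewrite sqr_quat tB nB. Qed.

Let BA : B * A = tau *: A + tau *: B - (tau ^+ 2 - 1)%:A - A * B.
Proof.
have E : A * qconj B + B * qconj A = (tau ^+ 2 - 1)%:A.
  have <- : qtr (A * qconj B) = tau ^+ 2 - 1.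
    by have := qtr_mul A B; rewrite tAB tA tB => H; lra.
  by rewrite -add_qconj qconjM qconjK.
have -> : B * A = B * (qtr A)%:A - B * qconj A.
  by rewrite -add_qconj mulrDr addrK.
have <- : A * (qtr B)%:A - A * qconj B = A * B by rewrite -add_qconj mulrDr addrK.
rewrite -E tA tB -!mul_scalarC -!scalerAl !mul1r.
by apply: quat_eqP; rewrite !quatE; ring.
Qed.

Let BAB : B * (A * B) = A + B - tau%:A.
Proof.
rewrite mulrA BA !mulrBl !mulrDl -!scalerAl sqB -mulrA sqB mulrBr -scalerAr -scalerAr mulr1 mul1r.
move: (A * B) => C; rewrite !qscalarE; apply: quat_eqP; rewrite !quatE /=; ring.
Qed.

Let AAB : A * (A * B) = tau *: (A * B) - B.
Proof. by rewrite mulrA sqA mulrBl -!scalerAl mul1r scale1r. Qed.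

Let ABA : A * B * A = A + B - tau%:A.
Proof.
rewrite -mulrA BA !mulrBr !mulrDr -!scalerAr mulr1 sqA AAB.
move: (A * B) => C; rewrite !qscalarE; apply: quat_eqP; rewrite !quatE /=; ring.
Qed.

Let ABB : A * B * B = tau *: (A * B) - A.
Proof. by rewrite -mulrA sqB mulrBr -!scalerAr mulr1 scale1r. Qed.

Let ABAB : A * B * (A * B) = A * B - 1%:A.
Proof. by rewrite sqr_quat qnormM nA nB mulr1 tAB scale1r. Qed.

(** The two norms and the traces of [A], [B], [AB] determine the whole multiplication table, so that
    words in the generators can be evaluated by coordinates. *)
Lemma linM c0 c1 c2 c3 d0 d1 d2 d3 :
  lin c0 c1 c2 c3 * lin d0 d1 d2 d3 = lin
    (c0 * d0 - c1 * d1 - c2 * d2 - c3 * d3 - (tau ^+ 2 - 1) * c2 * d1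
       - tau * c2 * d3 - tau * c3 * d1)
    (c0 * d1 + c1 * d0 + tau * c1 * d1 + tau * c2 * d1 + c2 * d3 + c3 * d1 - c3 * d2)
    (c0 * d2 + c2 * d0 - c1 * d3 + tau * c2 * d1 + tau * c2 * d2 + c2 * d3 + c3 * d1)
    (c0 * d3 + c3 * d0 + c1 * d2 + tau * c1 * d3 - c2 * d1 + tau * c3 * d2 + c3 * d3).
Proof.
rewrite /lin !mulrDl !mulrDr -!scalerAl -!scalerAr !mulr1 !mul1r.
rewrite ABAB ABB ABA AAB BAB BA sqA sqB; move: (A * B) => C.
by rewrite !qscalarE; apply: quat_eqP; rewrite !quatE /=; ring.
Qed.

Lemma qtr_mul_lin r c0 c1 c2 c3 : qtr (r * lin c0 c1 c2 c3) =
  c0 * qtr r + c1 * qtr (r * A) + c2 * qtr (r * B) + c3 * qtr (r * (A * B)).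
Proof.
have -> : r * lin c0 c1 c2 c3 =
    c0 *: r + c1 *: (r * A) + c2 *: (r * B) + c3 *: (r * (A * B)).
  by rewrite /lin !mulrDr -!scalerAr mulr1.
by rewrite (qtrD (_ + _ + _)) (qtrD (_ + _)) qtrD !qtrZ.
Qed.

Lemma qtr_lin c0 c1 c2 c3 : qtr (lin c0 c1 c2 c3) = 2 * c0 + tau * c1 + tau * c2 + c3.
Proof. by rewrite /lin !qtrD !qtrZ tA tB tAB qtr1; ring. Qed.

End LinearBasis.

Section InvertedOrder.

Variables (gT : finGroupType) (J : {group gT}).

(** The subgroup generated by [u] and [v] has order exactly [2 * #[u]]: an element inverting [u],
    where [u^2] is not 1, cannot be a power of [u]. *)
Lemma dvdn_inverted_order (u v : gT) m :
    u \in J -> v \in J -> (v * u * v^-1 = u^-1)%g -> (v ^+ 2 = u ^+ m)%g ->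
    (u * u != 1)%g ->
  (2 * #[u]%g %| #|J|)%N.
Proof.
move=> Ju Jv inv Ev u2; pose K := <<[set u; v]>>%G.
have Ku : u \in K by rewrite mem_gen ?set21.
have Kv : v \in K by rewrite mem_gen ?set22.
have leK : (#|K| <= 2 * #[u]%g)%N := card_dihedral_order (H := K) (erefl _) Ev inv.
have suK : <[u]>%g \subset K by rewrite cycle_subG.
have gt1 : (1 < #|K : <[u]>|%g)%N.
  rewrite indexg_gt1; apply/subsetPn; exists v => //; apply: contra u2 => /cycleP[k Ek].
  have C : commute (u ^+ k)%g u by apply/commute_sym/commuteX.
  by move: inv; rewrite Ek C mulgK => {2}->; rewrite mulgV.
have := Lagrange suK; rewrite -orderE => EK.
have -> : (2 * #[u]%g = #|K|)%N.
  apply/eqP; rewrite eqn_leq leK andbT -EK mulnC leq_mul2l gt1 orbT //.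
by apply: cardSg; rewrite gen_subG; apply/subsetP => g /set2P[]->.
Qed.

Lemma dvdn_prime_order (p : nat) (u : gT) :
  prime p -> u \in J -> (u ^+ p = 1)%g -> u != 1%g -> (p %| #|J|)%N.
Proof.
by move=> pr_p Ju up u1; rewrite -(nt_prime_order pr_p up u1) order_dvdG.
Qed.

End InvertedOrder.

Section PolyhedralCase.

Variables (R : rcfType) (gT : finGroupType) (G : {group gT}).
Local Notation H := (quat (-1 : R) (-1 : R)).
Variables (rho : gT -> H) (e : gT).
Hypothesis hrep : unit_rep G rho e.

Let rhoM := repM hrep.
Let rho_inj := rep_inj hrep.
Let rho_norm := rep_norm hrep.
Let Ge := rep_e_in hrep.
Let rho_e := rep_e hrep.

Let t g := qtr (rho g).

Variables (J : {group gT}) (sJG : J \subset G) (Je : e \in J).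

(** Such an [r] is a point of the left coset [r J] nearest to 1. The sign condition costs nothing,
    since [e] belongs to [J]. *)
Definition coset_maximal r :=
  [/\ r \in G, 0 <= t r & {in J, forall h, t (r * h)%g <= t r}].

Lemma sub_of_coset_maximal :
    (forall r, coset_maximal r -> r != 1%g -> r != e -> False) -> G \subset J.
Proof.
move=> noR; apply/subsetP => g Gg.
case: (@arg_maxP _ _ _ e (mem J) (fun h => t (g * h)%g) Je) => h Jh hmax'.
have Gh := subsetP sJG h Jh.
have hmax k : k \in J -> t (g * h * k)%g <= t (g * h)%g.
  by move=> Jk; rewrite -mulgA; apply: hmax'; apply: groupM.
have tN x : x \in G -> t (x * e)%g = - t x.
  by move=> Gx; rewrite /t (trC hrep) // (trN hrep).
have rmax : coset_maximal (g * h)%g.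
  split; [exact: groupM| |exact: hmax].
  by have := hmax e Je; rewrite tN ?groupM //; lra.
have [E|r1] := eqVneq (g * h)%g 1%g.
  by rewrite -(groupMr g Jh) E.
have [E|re] := eqVneq (g * h)%g e; last by case: (noR _ rmax r1 re).
by rewrite -(groupMr g Jh) E.
Qed.

(** Since [p^2 = -1], the sum [k + p k p^-1] lies in the plane of 1 and [p]. Multiplying by [r] and
    taking traces brings in the coordinate [t (r * p)]. Maximality of [r] against [h], its conjugate
    by [p] and their inverses bounds it from both sides. *)
Lemma axis_bound r p h : coset_maximal r -> p \in J -> h \in J -> t p = 0 ->
  (t (h * p)%g * t (r * p)%g) ^+ 2 <= (2 - t h) ^+ 2 * t r ^+ 2.
Proof.
move=> [Gr r0 rmax] Jp Jh tp; have Gp := subsetP sJG p Jp; have Gh := subsetP sJG h Jh.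
have pp := tr0_sqr hrep Gp tp.
have key k : k \in J -> t (r * k)%g + t (r * (p * k * p^-1))%g
    = t k * t r - t (k * p)%g * t (r * p)%g.
  move=> Jk; have Gk := subsetP sJG k Jk.
  rewrite /t !rhoM ?groupM ?groupV // (rhoV hrep) // -qtrD -mulrDr.
  have pE : qconj (rho p) = - rho p.
    by apply/eqP; rewrite -addr_eq0 addrC add_qconj -[qtr _]/(t p) tp scale0r.
  have kp : rho k * rho p = (qtr (rho k * rho p))%:A - qconj (rho p) * qconj (rho k).
    by rewrite -qconjM -add_qconj addrK.
  have -> : rho k + rho p * rho k * qconj (rho p)
     = (qtr (rho k))%:A - qtr (rho k * rho p) *: rho p.
    rewrite {1}pE mulrN -mulrA kp mulrBr -mul_scalarC -scalerAl mul1r mulrA qnormE.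
    rewrite rho_norm // scale1r mul1r opprB addrA add_qconj.
    by rewrite -kp.
  by rewrite mulrBr -!scalerAr mulr1 qtrD qtrN !qtrZ.
have b1 := key h Jh; have b2 := key h^-1%g (groupVr Jh).
have l1 := rmax h Jh; have l2 := rmax _ (groupVr Jh).
have l3 := rmax (p * h * p^-1)%g; have l4 := rmax (p * h^-1 * p^-1)%g.
rewrite !groupM ?groupV // in l3 l4.
have {}l3 := l3 isT; have {}l4 := l4 isT.
have thp : t (h^-1 * p)%g = - t (h * p)%g.
  have E : t (p * h)%g + t (p * h^-1)%g = t p * t h := trM hrep Gp Gh.
  have C1 : t (h^-1 * p)%g = t (p * h^-1)%g := trC hrep (groupVr Gh) Gp.
  have C2 : t (h * p)%g = t (p * h)%g := trC hrep Gh Gp.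
  by rewrite C1 C2; rewrite tp mul0r in E; lra.
have thV : t h^-1%g = t h := trV hrep Gh.
rewrite thp thV in b2.
set u := t (h * p)%g in b1 b2 *; set v := t (r * p)%g in b1 b2 *.
have up : u * v <= (2 - t h) * t r by lra.
have lo : - ((2 - t h) * t r) <= u * v by lra.
rewrite -exprMn; nra.
Qed.

Lemma frame_parseval r p q : r \in G -> p \in G -> q \in G ->
    t p = 0 -> t q = 0 -> t (p * q)%g = 0 ->
  t r ^+ 2 + t (r * p)%g ^+ 2 + t (r * q)%g ^+ 2 + t (r * (p * q))%g ^+ 2 = 4.
Proof.
move=> Gr Gp Gq tp tq; rewrite /t !rhoM ?groupM // => tpq.
by rewrite hamilton_parseval ?rho_norm // mulr1.
Qed.

End PolyhedralCase.

Section RealInequalities.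

Variable R : realFieldType.
Implicit Types u v w x y : R.

(** The three bounds make the sum of squares at most [x^2 (16 - 9 u)], hence at most
    [(u + 1)(16 - 9 u) = 7 - 2 u], which is below 4 because the golden ratio exceeds 3/2. *)
Lemma icosahedral_inequality u x y1 y2 y3 :
    u ^+ 2 = u + 1 -> 0 <= x -> x <= u ->
    y1 ^+ 2 <= (2 - u) ^+ 2 * x ^+ 2 -> y2 ^+ 2 <= (2 - u) ^+ 2 * x ^+ 2 ->
    y3 ^+ 2 <= (2 - u) ^+ 2 * x ^+ 2 ->
    x ^+ 2 + y1 ^+ 2 + y2 ^+ 2 + y3 ^+ 2 = 4 -> False.
Proof.
move=> Eu x0 xu B1 B2 B3 P4.
have u1 : u < 16 / 9 by nra.
have E2 : (2 - u) ^+ 2 = 5 - 3 * u by rewrite sqrrB Eu; lra.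
have x2 : x ^+ 2 <= u + 1 by rewrite -Eu; nra.
have : x ^+ 2 * (16 - 9 * u) <= (u + 1) * (16 - 9 * u) by rewrite ler_wpM2r //; lra.
have -> : (u + 1) * (16 - 9 * u) = 16 + 7 * u - 9 * u ^+ 2 by ring.
rewrite E2 in B1 B2 B3.
have u2 : 3 / 2 < u by nra.
by rewrite Eu; lra.
Qed.

(** The sum of squares is at most [x^2 (10 - 6 u)], hence at most [20 - 12 u], which is below 4
    because the square root of 2 exceeds 4/3. *)
Lemma octahedral_inequality u x y1 y2 y3 :
    u ^+ 2 = 2 -> 0 <= u -> 0 <= x -> x <= u ->
    2 * y1 ^+ 2 <= (2 - u) ^+ 2 * x ^+ 2 -> 2 * y2 ^+ 2 <= (2 - u) ^+ 2 * x ^+ 2 ->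
    2 * y3 ^+ 2 <= (2 - u) ^+ 2 * x ^+ 2 ->
    x ^+ 2 + y1 ^+ 2 + y2 ^+ 2 + y3 ^+ 2 = 4 -> False.
Proof.
move=> Eu u0 x0 xu B1 B2 B3 P4.
have u1 : 4 / 3 < u by nra.
have u2 : u < 5 / 3 by nra.
have E2 : (2 - u) ^+ 2 = 6 - 4 * u by rewrite sqrrB Eu; lra.
have x2 : x ^+ 2 <= 2 by rewrite -Eu; nra.
have : x ^+ 2 * (20 - 12 * u) <= 2 * (20 - 12 * u) by rewrite ler_wpM2r //; lra.
by rewrite E2 in B1 B2 B3; lra.
Qed.

(** Axis bounds [y^2 <= x^2] would only give [x^2 + 3 x^2 <= 4], which is no contradiction. Instead
    [u], [v], [w], [u + v - w] will be the traces of [r h] for four elements [h] of trace 1.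
    Bounding squares by absolute values then gives a sum of at most [2 x]. *)
Lemma tetrahedral_inequality x u v w :
    0 <= x <= 1 -> 0 <= u <= x -> 0 <= v <= x -> 0 <= w <= x ->
    0 <= u + v - w <= x ->
    x ^+ 2 + (u + v - x) ^+ 2 + (w - v) ^+ 2 + (u - w) ^+ 2 = 4 -> False.
Proof.
move=> /andP[x0 x1] /andP[a0 a1] /andP[b0 b1] /andP[c0 c1] /andP[d0 d1] P4.
pose y1 := u + v - x; pose y2 := w - v; pose y3 := u - w.
rewrite -/y1 -/y2 -/y3 in P4.
have sqle (y : R) : - 1 <= y <= 1 -> y ^+ 2 <= `|y|.
  by move=> /andP[? ?]; case: (ger0P y) => ?; nra.
have x2 : x ^+ 2 <= x by nra.
have s1 := sqle y1; have s2 := sqle y2; have s3 := sqle y3.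
have {}s1 : y1 ^+ 2 <= `|y1| by apply: s1; rewrite /y1; apply/andP; split; lra.
have {}s2 : y2 ^+ 2 <= `|y2| by apply: s2; rewrite /y2; apply/andP; split; lra.
have {}s3 : y3 ^+ 2 <= `|y3| by apply: s3; rewrite /y3; apply/andP; split; lra.
have : `|y1| + `|y2| + `|y3| <= x.
  by rewrite /y1 /y2 /y3; case: (ger0P (u + v - x)) => ?; case: (ger0P (w - v)) => ?;
    case: (ger0P (u - w)) => ?; lra.
lra.
Qed.

End RealInequalities.

Section PolyhedralCases.

Variables (R : rcfType) (gT : finGroupType) (G : {group gT}).
Local Notation H := (quat (-1 : R) (-1 : R)).
Variables (rho : gT -> H) (e : gT).
Hypothesis hrep : unit_rep G rho e.

Let rhoM := repM hrep.
Let rho_inj := rep_inj hrep.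
Let rho_norm := rep_norm hrep.
Let Ge := rep_e_in hrep.
Let rho_e := rep_e hrep.

Let t g := qtr (rho g).

Variables (a b : gT).
Hypotheses (Ga : a \in G) (Gb : b \in G).
Hypotheses (Etab : t a = t b) (tab : t (a * b)%g = 1).

Let tau := t a.
Let J := <<[set a; b]>>%G.
Let Ja : a \in J. Proof. by rewrite mem_gen ?set21. Qed.
Let Jb : b \in J. Proof. by rewrite mem_gen ?set22. Qed.
Let sJG : J \subset G.
Proof. by rewrite gen_subG; apply/subsetP => g /set2P[]->. Qed.

Let L := lin (rho a) (rho b).
Let nA := rho_norm Ga.
Let nB := rho_norm Gb.
Let tA : qtr (rho a) = tau. Proof. by []. Qed.
Let tB : qtr (rho b) = tau. Proof. by rewrite /tau Etab. Qed.
Let tAB : qtr (rho a * rho b) = 1. Proof. by rewrite -rhoM. Qed.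

Let La : rho a = L 0 1 0 0.
Proof. by rewrite /L /lin !scale0r scale1r add0r !addr0. Qed.
Let Lb : rho b = L 0 0 1 0.
Proof. by rewrite /L /lin !scale0r scale1r !add0r !addr0. Qed.
Let Le : rho e = L (-1) 0 0 0.
Proof. by rewrite /L /lin !scale0r scaleN1r !addr0 rho_e. Qed.

(* Elements of [J] together with their coordinates in the basis 1, a, b, ab. *)
Definition at_lin g c0 c1 c2 c3 := g \in J /\ rho g = L c0 c1 c2 c3.

Lemma at_a : at_lin a 0 1 0 0. Proof. by split; rewrite // La. Qed.
Lemma at_b : at_lin b 0 0 1 0. Proof. by split; rewrite // Lb. Qed.

Lemma at_mul g h c0 c1 c2 c3 d0 d1 d2 d3 k0 k1 k2 k3 :
    at_lin g c0 c1 c2 c3 -> at_lin h d0 d1 d2 d3 ->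
    c0 * d0 - c1 * d1 - c2 * d2 - c3 * d3 - (tau ^+ 2 - 1) * c2 * d1
       - tau * c2 * d3 - tau * c3 * d1 = k0 ->
    c0 * d1 + c1 * d0 + tau * c1 * d1 + tau * c2 * d1 + c2 * d3 + c3 * d1 - c3 * d2
       = k1 ->
    c0 * d2 + c2 * d0 - c1 * d3 + tau * c2 * d1 + tau * c2 * d2 + c2 * d3 + c3 * d1
       = k2 ->
    c0 * d3 + c3 * d0 + c1 * d2 + tau * c1 * d3 - c2 * d1 + tau * c3 * d2 + c3 * d3
       = k3 ->
  at_lin (g * h)%g k0 k1 k2 k3.
Proof.
move=> [Jg Lg] [Jh Lh] <- <- <- <-; split; first exact: groupM.
rewrite rhoM ?(subsetP sJG) // Lg Lh; exact: (linM nA nB tA tB tAB).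
Qed.

Lemma at_tr g c0 c1 c2 c3 : at_lin g c0 c1 c2 c3 ->
  t g = 2 * c0 + tau * c1 + tau * c2 + c3.
Proof. by move=> [_ Lg]; rewrite /t Lg; apply: (qtr_lin tA tB tAB). Qed.

Lemma at_inj g h c0 c1 c2 c3 :
  at_lin g c0 c1 c2 c3 -> at_lin h c0 c1 c2 c3 -> g = h.
Proof. by move=> [Jg Lg] [Jh Lh]; apply: rho_inj; rewrite ?(subsetP sJG) // Lg Lh. Qed.

Lemma at_e g : at_lin g (-1) 0 0 0 -> g = e.
Proof. by move=> [Jg Lg]; apply: rho_inj => //; [apply: (subsetP sJG)|rewrite Lg Le]. Qed.

Lemma at_ab : at_lin (a * b)%g 0 0 0 1.
Proof. by apply: (at_mul at_a at_b); ring. Qed.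

Lemma at_aba : at_lin (a * b * a)%g (- tau) 1 1 0.
Proof. by apply: (at_mul at_ab at_a); ring. Qed.

Lemma aba_sqr : (a * b * a * (a * b * a) = e)%g.
Proof.
have tr0 : t (a * b * a)%g = 0 by rewrite (at_tr at_aba); ring.
by apply: (tr0_sqr hrep) tr0; rewrite !groupM.
Qed.

Lemma at_ba : at_lin (b * a)%g (- (tau ^+ 2 - 1)) tau tau (-1).
Proof. by apply: (at_mul at_b at_a); ring. Qed.

Lemma pair_braid : (a * b * a = b * a * b)%g.
Proof. by apply: (at_inj at_aba); apply: (at_mul at_ba at_b); ring. Qed.

Lemma pair_Je : e \in J.
Proof. by rewrite -aba_sqr !groupM. Qed.

Lemma pair_ab3 : ((a * b) ^+ 3 = e)%g.
Proof. by rewrite -aba_sqr {2}pair_braid !expgS expg0 mulg1 !mulgA. Qed.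

Lemma dvdn3 : (3 %| #|J|)%N.
Proof.
apply: (@dvdn_prime_order _ _ 3 ((a * b) ^+ 2)%g) => //; first by rewrite groupX ?groupM.
  by rewrite -expgM mulnC expgM pair_ab3 expg2 (ee hrep).
apply/eqP => E; have := pair_ab3; rewrite expgS E mulg1 => Eab.
by move: tab; rewrite Eab /t rho_e qtrN qtr1; lra.
Qed.

(** [p] and [q] generate a quaternion group of order 8: the squares of [p], [q] and [p q] all equal
    [e]. *)
Lemma quaternion_dvdn p q : p \in J -> q \in J -> t p = 0 -> t q = 0 ->
  t (p * q)%g = 0 -> (8 %| #|J|)%N.
Proof.
move=> Jp Jq tp tq tpq; have [Gp Gq] := (subsetP sJG p Jp, subsetP sJG q Jq).
have pp := tr0_sqr hrep Gp tp; have qq := tr0_sqr hrep Gq tq.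
have pqpq := tr0_sqr hrep (groupM Gp Gq) tpq.
have e_neq := e_neq1 hrep.
have Op : #[p]%g = 4%N.
  have : (#[p]%g %| 2 ^ 2)%N by rewrite order_dvdn (expgM p 2 2) !expg2 pp (ee hrep).
  case/(dvdn_pfactor _ _ (isT : prime 2)) => -[|[|[|k]]] // _ Ep.
    by have := order_dvdn p 2; rewrite Ep expg2 pp (negbTE e_neq).
  by have := order_dvdn p 2; rewrite Ep expg2 pp (negbTE e_neq).
rewrite -[8%N]/(2 * 4)%N -Op; apply: (@dvdn_inverted_order _ _ p q 2) => //.
- apply: (mulIg q); rewrite mulgVK; apply: (mulgI p); rewrite mulVKg.
  by apply: (mulIg q); rewrite qq -pqpq !mulgA.
- by rewrite !expg2 pp qq.
by rewrite pp e_neq.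
Qed.

(** [aba], [ab] and [a] serve as [x], [y], [z]: the three powers in the presentation all equal
    [e]. *)
Lemma pair_polyhedral c N : (c, N) \in [:: (3, 24); (4, 48); (5, 120)]%N ->
    (a ^+ c = e)%g -> (N %| #|J|)%N ->
    (forall r, coset_maximal G rho J r -> r != 1%g -> r != e -> False) ->
  binary_polyhedral c G /\ G = <<[set a; b]>>%G.
Proof.
move=> cN Ec dvN noR.
have EG : G = J.
  by apply/val_inj/eqP; rewrite eqEsubset sJG (sub_of_coset_maximal hrep sJG pair_Je noR).
split=> //; apply: (polyhedral_isoGrp cN); last by rewrite EG dvdn_leq.
have Ex : (a * b * a * (a * b) * a = e)%g by rewrite -aba_sqr !mulgA.
have [E1 E2 E3] : [/\ (a * b * a) ^+ 2 = a * b * a * (a * b) * a,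
  (a * b) ^+ 3 = a * b * a * (a * b) * a & a ^+ c = a * b * a * (a * b) * a]%g.
  by rewrite Ex pair_ab3 Ec expg2 aba_sqr.
apply/homg_polyhedralP; exists (a * b * a)%g, (a * b)%g, a; split=> //.
by rewrite (gen_polyhedral E1 E2 E3) mulKg {1}EG.
Qed.


Hypothesis bound : {in G, forall g, [\/ g = 1%g, g = e | - tau <= t g <= tau]}.

Lemma maximal_bound r : coset_maximal G rho J r -> r != 1%g -> r != e ->
  0 <= t r <= tau.
Proof.
move=> [Gr r0 _] /eqP r1 /eqP re; apply/andP; split=> //.
by case: (bound Gr) => // /andP[].
Qed.

Lemma axis_bound_at r p h (c : R) : coset_maximal G rho J r -> p \in J -> h \in J ->
    t p = 0 -> t (h * p)%g ^+ 2 = c ->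
  c * t (r * p)%g ^+ 2 <= (2 - t h) ^+ 2 * t r ^+ 2.
Proof. by move=> rmax Jp Jh tp <-; rewrite -exprMn; exact: (axis_bound hrep sJG rmax Jp Jh tp). Qed.

Lemma parseval_at r p q : r \in G -> p \in J -> q \in J ->
    t p = 0 -> t q = 0 -> t (p * q)%g = 0 ->
  t r ^+ 2 + t (r * p)%g ^+ 2 + t (r * q)%g ^+ 2 + t (r * (p * q))%g ^+ 2 = 4.
Proof.
by move=> Gr Jp Jq; apply: (frame_parseval hrep) => //; apply: (subsetP sJG).
Qed.

Lemma at_trM g h c0 c1 c2 c3 d0 d1 d2 d3 :
  at_lin g c0 c1 c2 c3 -> at_lin h d0 d1 d2 d3 -> t (g * h)%g =
    2 * (c0 * d0 - c1 * d1 - c2 * d2 - c3 * d3 - (tau ^+ 2 - 1) * c2 * d1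
       - tau * c2 * d3 - tau * c3 * d1)
    + tau * (c0 * d1 + c1 * d0 + tau * c1 * d1 + tau * c2 * d1 + c2 * d3 + c3 * d1 - c3 * d2)
    + tau * (c0 * d2 + c2 * d0 - c1 * d3 + tau * c2 * d1 + tau * c2 * d2 + c2 * d3 + c3 * d1)
    + (c0 * d3 + c3 * d0 + c1 * d2 + tau * c1 * d3 - c2 * d1 + tau * c3 * d2 + c3 * d3).
Proof. by move=> Hg Hh; apply: at_tr (at_mul Hg Hh _ _ _ _). Qed.

Lemma order_neq1 g : t g != 2 -> g != 1%g.
Proof. by apply: contra => /eqP ->; rewrite /t (rho1 hrep) qtr1. Qed.

Lemma icosahedral_case : tau ^+ 2 = tau + 1 ->
  binary_polyhedral 5 G /\ G = <<[set a; b]>>%G.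
Proof.
move=> Et; have Et3 : tau ^+ 3 = 2 * tau + 1 by rewrite exprS Et mulrDr mulr1 -expr2 Et; ring.
have Et4 : tau ^+ 4 = 3 * tau + 2 by rewrite exprS Et3 mulrDr mulr1 mulrCA -expr2 Et; ring.
have A2 : at_lin (a * a)%g (-1) tau 0 0 by apply: (at_mul at_a at_a); ring.
have B2 : at_lin (b * b)%g (-1) 0 tau 0 by apply: (at_mul at_b at_b); ring.
have A3 : at_lin (a * a * a)%g (- tau) tau 0 0 by apply: (at_mul A2 at_a); lra.
have B3 : at_lin (b * b * b)%g (- tau) 0 tau 0 by apply: (at_mul B2 at_b); lra.
have A4 : at_lin (a * a * a * a)%g (- tau) 1 0 0 by apply: (at_mul A3 at_a); lra.
have B4 : at_lin (b * b * b * b)%g (- tau) 0 1 0 by apply: (at_mul B3 at_b); lra.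
have A5 : (a ^+ 5 = e)%g.
  rewrite !expgS expg0 mulg1 !mulgA; apply: at_e; apply: (at_mul A4 at_a); lra.
pose p := (a * b * a)%g; pose q := (a * a * (b * b * b) * (a * a))%g.
have Q1 : at_lin (a * a * (b * b * b))%g tau (- (tau + 1)) (- tau) (tau + 1).
  by apply: (at_mul A2 B3); lra.
have P0 : at_lin p (- tau) 1 1 0 := at_aba.
have Q0 : at_lin q 0 (- tau) tau 0 by apply: (at_mul Q1 A2); lra.
have PQ : at_lin (p * q)%g (1 + tau) (- (1 + tau)) (- (1 + tau)) (2 * tau).
  by apply: (at_mul P0 Q0); lra.
have H2 : at_lin (a * a * a * (b * b * b * b) * (a * a))%g tau (- tau) 0 1.
  have H : at_lin (a * a * a * (b * b * b * b))%g (tau + 1) (- (tau + 1)) (- tau) tau.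
    by apply: (at_mul A3 B4); lra.
  by apply: (at_mul H A2); lra.
have H3 : at_lin (a * a * a * a * (b * b * b * b * a))%g (1 + tau) (- tau) (- tau) tau.
  have H : at_lin (b * b * b * b * a)%g (- tau) 0 tau (-1) by apply: (at_mul B4 at_a); lra.
  by apply: (at_mul A4 H); lra.
have [tp tq tpq] : [/\ t p = 0, t q = 0 & t (p * q)%g = 0].
  by split; [rewrite (at_tr P0)|rewrite (at_tr Q0)|rewrite (at_tr PQ)]; lra.
have [Jp Jq] : p \in J /\ q \in J by case: P0 Q0 => ? _ [? _].
have th2 : t (a * a * a * (b * b * b * b) * (a * a))%g = tau by rewrite (at_tr H2); lra.
have th3 : t (a * a * a * a * (b * b * b * b * a))%g = tau by rewrite (at_tr H3); lra.
have hp1 : t (a * p)%g ^+ 2 = 1 by rewrite (at_trM at_a P0) (_ : _ + _ = - 1) ?sqrrN ?expr1n //; lra.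
have hp2 : t (a * a * a * (b * b * b * b) * (a * a) * q)%g ^+ 2 = 1.
  by rewrite (at_trM H2 Q0) (_ : _ + _ = - 1) ?sqrrN ?expr1n //; lra.
have hp3 : t (a * a * a * a * (b * b * b * b * a) * (p * q))%g ^+ 2 = 1.
  by rewrite (at_trM H3 PQ) (_ : _ + _ = - 1) ?sqrrN ?expr1n //; lra.
apply: (@pair_polyhedral 5%N 120%N) => //.
  rewrite -[120%N]/(8 * (3 * 5))%N !Gauss_dvd // (quaternion_dvdn Jp Jq tp tq tpq) dvdn3 /=.
  apply: (@dvdn_prime_order _ _ 5 (a * a)%g) => //; first by rewrite groupM.
    by rewrite -expg2 -expgM mulnC expgM A5 expg2 (ee hrep).
  apply: order_neq1; rewrite (at_tr A2); apply/eqP; nra.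
move=> r rmax r1 re; have /andP[r0 rtau] := maximal_bound rmax r1 re.
have B1 := axis_bound_at rmax Jp Ja tp hp1.
have B2' := axis_bound_at rmax Jq (proj1 H2) tq hp2.
have B3' := axis_bound_at rmax (groupM Jp Jq) (proj1 H3) tpq hp3.
have [Gr _ _] := rmax; have P4 := parseval_at Gr Jp Jq tp tq tpq.
rewrite -/tau th2 th3 in B1 B2' B3'.
rewrite !mul1r in B1 B2' B3'.
exact: icosahedral_inequality Et r0 rtau B1 B2' B3' P4.
Qed.

Lemma octahedral_case : tau ^+ 2 = 2 -> 0 <= tau ->
  binary_polyhedral 4 G /\ G = <<[set a; b]>>%G.
Proof.
move=> Et tau0; have Et3 : tau ^+ 3 = 2 * tau by rewrite exprS Et mulrC.
have Et4 : tau ^+ 4 = 4 by rewrite (exprM tau 2 2) Et; ring.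
have A2 : at_lin (a * a)%g (-1) tau 0 0 by apply: (at_mul at_a at_a); ring.
have B2 : at_lin (b * b)%g (-1) 0 tau 0 by apply: (at_mul at_b at_b); ring.
have A3 : at_lin (a * a * a)%g (- tau) 1 0 0 by apply: (at_mul A2 at_a); lra.
have B3 : at_lin (b * b * b)%g (- tau) 0 1 0 by apply: (at_mul B2 at_b); lra.
have A4 : (a ^+ 4 = e)%g.
  by rewrite !expgS expg0 mulg1 !mulgA; apply: at_e; apply: (at_mul A3 at_a); lra.
have B4 : (b ^+ 4 = e)%g.
  by rewrite !expgS expg0 mulg1 !mulgA; apply: at_e; apply: (at_mul B3 at_b); lra.
pose p := (a * a)%g; pose q := (b * b)%g.
have PQ : at_lin (p * q)%g 1 (- tau) (- tau) 2 by apply: (at_mul A2 B2); lra.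
have AE : at_lin e (-1) 0 0 0 by split; [exact: pair_Je|exact: Le].
have AB3 : at_lin (a * b * (a * a * a))%g (- tau) 1 1 (- tau) by apply: (at_mul at_ab A3); lra.
(* The factor [e] changes the trace from [- tau] to [tau]. *)
have H3 : at_lin (e * (a * b * (a * a * a)))%g tau (-1) (-1) tau by apply: (at_mul AE AB3); lra.
have [tp tq tpq] : [/\ t p = 0, t q = 0 & t (p * q)%g = 0].
  by split; [rewrite (at_tr A2)|rewrite (at_tr B2)|rewrite (at_tr PQ)]; lra.
have [Jp Jq] : p \in J /\ q \in J by rewrite !groupM.
have th3 : t (e * (a * b * (a * a * a)))%g = tau by rewrite (at_tr H3); lra.
have sq2 (x : R) : x = - tau \/ x = tau -> x ^+ 2 = 2 by case=> ->; rewrite ?sqrrN.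
have hp1 : t (a * p)%g ^+ 2 = 2 by apply: sq2; left; rewrite (at_trM at_a A2); lra.
have hp2 : t (b * q)%g ^+ 2 = 2 by apply: sq2; left; rewrite (at_trM at_b B2); lra.
have hp3 : t (e * (a * b * (a * a * a)) * (p * q))%g ^+ 2 = 2.
  by apply: sq2; left; rewrite (at_trM H3 PQ); lra.
apply: (@pair_polyhedral 4%N 48%N) => //.
  have pp := tr0_sqr hrep (subsetP sJG _ Jp) tp.
  have Oa : #[a]%g = 8%N.
    have : (#[a]%g %| 2 ^ 3)%N by rewrite order_dvdn (expgM a 4 2) A4 expg2 (ee hrep).
    case/(dvdn_pfactor _ _ (isT : prime 2)) => -[|[|[|[|k]]]] // _ Ea;
      by have := order_dvdn a 4; rewrite Ea A4 (negbTE (e_neq1 hrep)).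
  have H16 : (2 * 8 %| #|J|)%N.
    rewrite -Oa; apply: (@dvdn_inverted_order _ _ a (b * b)%g 4) => //.
    - by apply: octahedral_invert; rewrite ?pair_braid // pair_ab3 A4.
    - by rewrite A4 -B4 expg2 !expgS expg0 mulg1 !mulgA.
    by apply: order_neq1; rewrite tp; apply/eqP; lra.
  by rewrite -[48%N]/(2 * 8 * 3)%N Gauss_dvd // H16 dvdn3.
move=> r rmax r1 re; have /andP[r0 rtau] := maximal_bound rmax r1 re.
have B1 := axis_bound_at rmax Jp Ja tp hp1.
have B2' := axis_bound_at rmax Jq Jb tq hp2.
have B3' := axis_bound_at rmax (groupM Jp Jq) (proj1 H3) tpq hp3.
have [Gr _ _] := rmax; have P4 := parseval_at Gr Jp Jq tp tq tpq.
rewrite -/tau -?Etab -/tau th3 in B1 B2' B3'.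
exact: octahedral_inequality Et tau0 r0 rtau B1 B2' B3' P4.
Qed.

Lemma at_rtr r g c0 c1 c2 c3 : r \in G -> at_lin g c0 c1 c2 c3 ->
  t (r * g)%g = c0 * t r + c1 * t (r * a)%g + c2 * t (r * b)%g + c3 * t (r * (a * b))%g.
Proof.
move=> Gr [Jg Lg]; rewrite /t (rhoM Gr (subsetP sJG _ Jg)) (rhoM Gr Ga) (rhoM Gr Gb).
rewrite (rhoM Gr (groupM Ga Gb)) (rhoM Ga Gb) Lg.
exact: qtr_mul_lin.
Qed.

Lemma tetrahedral_case : tau = 1 ->
  binary_polyhedral 3 G /\ G = <<[set a; b]>>%G.
Proof.
move=> Et.
have A2 : at_lin (a * a)%g (-1) 1 0 0 by apply: (at_mul at_a at_a); rewrite Et; ring.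
have A3 : (a ^+ 3 = e)%g.
  by rewrite !expgS expg0 mulg1 !mulgA; apply: at_e; apply: (at_mul A2 at_a); rewrite Et; ring.
pose p := (a * b * a)%g; pose q := (a * a * b)%g.
have P0 : at_lin p (-1) 1 1 0 by have := at_aba; rewrite Et.
have Q0 : at_lin q 0 0 (-1) 1 by apply: (at_mul A2 at_b); rewrite Et; ring.
have PQ : at_lin (p * q)%g 0 1 0 (-1) by apply: (at_mul P0 Q0); rewrite Et; ring.
have BA : at_lin (b * a)%g 0 1 1 (-1) by apply: (at_mul at_b at_a); rewrite Et; ring.
have [tp tq tpq] : [/\ t p = 0, t q = 0 & t (p * q)%g = 0].
  by split; [rewrite (at_tr P0)|rewrite (at_tr Q0)|rewrite (at_tr PQ)]; rewrite Et; ring.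
have [Jp Jq] : p \in J /\ q \in J by rewrite !groupM.
apply: (@pair_polyhedral 3%N 24%N) => //.
  by rewrite -[24%N]/(8 * 3)%N Gauss_dvd // (quaternion_dvdn Jp Jq tp tq tpq) dvdn3.
move=> r rmax r1 re; have /andP[r0 rtau] := maximal_bound rmax r1 re.
have [Gr _ maxr] := rmax; have P4 := parseval_at Gr Jp Jq tp tq tpq.
(* For [h] of trace 1 the traces of [r h] and [r h^-1] add up to [t r] and neither exceeds [t r], so
   both are nonnegative. *)
have range h : h \in J -> t h = 1 -> 0 <= t (r * h)%g <= t r.
  move=> Jh th; rewrite maxr // andbT.
  have E : t (r * h)%g + t (r * h^-1)%g = t r * t h := trM hrep Gr (subsetP sJG h Jh).
  by have := maxr _ (groupVr Jh); rewrite th in E; lra.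
have tb1 : t b = 1 by rewrite -Etab.
have tba : t (b * a)%g = 1 by rewrite (at_tr BA) Et; ring.
have /andP[a0 a1] := range a Ja Et; have /andP[b0 b1] := range b Jb tb1.
have /andP[c0 c1] := range _ (groupM Ja Jb) tab.
have /andP[d0 d1] := range _ (groupM Jb Ja) tba.
rewrite (at_rtr Gr BA) in d0 d1; rewrite (at_rtr Gr P0) (at_rtr Gr Q0) (at_rtr Gr PQ) in P4.
rewrite Et in rtau.
apply: (@tetrahedral_inequality R (t r) (t (r * a)%g) (t (r * b)%g) (t (r * (a * b))%g)) => //.
- by rewrite r0.
- by rewrite a0.
- by rewrite b0.
- by rewrite c0.
- by apply/andP; split; lra.
by rewrite -P4; ring.
Qed.

End PolyhedralCases.

(** * Real places of a totally definite algebra *)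

(** The proofs are arguments of this wrapper so that a morphism structure can be attached to any
    function that comes with them. *)
Definition rmorph_fun (S T : nzRingType) (f : S -> T)
    (fB : {morph f : x y / x - y}) (fM : {morph f : x y / x * y}) (f1 : f 1 = 1) := f.

Section PackRMorphism.

Variables (S T : nzRingType) (f : S -> T).
Hypotheses (fB : {morph f : x y / x - y}) (fM : {morph f : x y / x * y}) (f1 : f 1 = 1).

HB.instance Definition _ :=
  GRing.isZmodMorphism.Build S T (rmorph_fun fB fM f1) fB.
HB.instance Definition _ :=
  GRing.isMonoidMorphism.Build S T (rmorph_fun fB fM f1) (conj f1 fM).

Definition pack_rmorphism : {rmorphism S -> T} := rmorph_fun fB fM f1.

End PackRMorphism.

Definition additive_fun (S T : zmodType) (f : S -> T)
    (fB : {morph f : x y / x - y}) := f.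

Section PackAdditive.

Variables (S T : zmodType) (f : S -> T).
Hypothesis fB : {morph f : x y / x - y}.

HB.instance Definition _ := GRing.isZmodMorphism.Build S T (additive_fun fB) fB.

Definition pack_additive : {additive S -> T} := additive_fun fB.

End PackAdditive.

Section AnticommutingPair.

Variable R : realFieldType.
Local Notation H := (quat (-1 : R) (-1 : R)).
Implicit Types u v w : H.

Lemma central_of_commute u v w : u * v != v * u -> w * u = u * w -> w * v = v * w ->
  w = (qre w)%:A.
Proof.
move=> Nuv Cu Cv.
have central (x : H) : w * x = x * w.
  have indep c0 c1 c2 c3 := quat_indep (@hamilton_aniso R) (c0 := c0) (c1 := c1) (c2 := c2) (c3 := c3) Nuv.
  have [c0 [c1 [c2 [c3 ->]]]] := quat_span x indep.
  rewrite !mulrDr !mulrDl -!scalerAr -!scalerAl mulr1 mul1r Cu Cv.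
  by rewrite mulrA Cu -mulrA Cv mulrA.
have E1 := central (Quat (-1) (-1) 0 1 0 0); have E2 := central (Quat (-1) (-1) 0 0 1 0).
have E3 := congr1 (@qj _ _ _) E1; have E4 := congr1 (@qij _ _ _) E1.
have E5 := congr1 (@qij _ _ _) E2; rewrite !quatE /= in E3 E4 E5.
by rewrite qscalarE; apply: quat_eqP => //=; lra.
Qed.

Lemma anticommuting_neq u v :
  u != 0 -> v != 0 -> u * v = - (v * u) -> u * v != v * u.
Proof.
move=> u0 v0 anti; apply/eqP => C; have E : u * v = 0.
  have := anti; rewrite -C => E2; have := scaler_eq0 (2 : R) (u * v).
  by rewrite -[2](natrD R 1 1) scalerDl scale1r {1}E2 addNr eqxx pnatr_eq0 /= => /esym/eqP.
by have [/eqP|/eqP] := quat_mul_eq0 (@hamilton_aniso R) E; rewrite (negbTE u0, negbTE v0).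
Qed.

Lemma anticommuting_sqr u v (r : R) :
    u != 0 -> v != 0 -> u * v = - (v * u) -> u * u = r%:A ->
  qtr u = 0 /\ r < 0.
Proof.
move=> u0 v0 anti Eu; have Nuv := anticommuting_neq u0 v0 anti.
have tu : qtr u = 0.
  apply/eqP; apply: contraNT Nuv => tu0; apply/eqP.
  have : qtr u *: u = (r + qnorm u)%:A by rewrite [RHS]scalerDl -Eu sqr_quat subrK.
  move/(congr1 (fun x => (qtr u)^-1 *: x)); rewrite !scalerA mulVf // scale1r => ->.
  exact: mul_scalarC.
split=> //; have : u * u = (- qnorm u)%:A by rewrite sqr_quat tu scale0r sub0r scaleNr.
rewrite Eu !qscalarE => -[->]; rewrite oppr_lt0 lt_neqAle hamilton_norm.
rewrite !addr_ge0 ?sqr_ge0 // andbT -hamilton_norm eq_sym; apply/eqP => /hamilton_aniso.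
exact/eqP.
Qed.

End AnticommutingPair.

Section RealPlaces.

Variables (R : realType) (K : fieldExtType rat) (a b : K).
Hypotheses (a0 : a != 0) (b0 : b != 0).
Local Notation A := (quat a b).
Local Notation n := (\dim {:K}).

(** Each coordinate of H^n gives a ring morphism from [A] to H. The image of K commutes with the
    noncommuting images of i and j, so it is real; nonzero anticommuting quaternions with real
    squares have negative squares. *)
Theorem totally_definite_places : totally_definite a b R ->
  exists sigma : 'I_n -> {rmorphism K -> R},
    (forall k, sigma k a < 0 /\ sigma k b < 0) /\
    forall lam : 'I_n -> R, (forall c, \sum_k lam k * sigma k c = 0) -> forall k, lam k = 0.
Proof.
move=> [t [[[tDl tDr tQ] tU] t1 tM tZ]].
pose phi k (x : A) := t x 1 k.
have phiD k x y : phi k (x + y) = phi k x + phi k y by rewrite /phi tDl ffunE.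
have phi0 k : phi k 0 = 0 by apply: (addrI (phi k 0)); rewrite -phiD !addr0.
have phiN k x : phi k (- x) = - phi k x by apply: (addrI (phi k x)); rewrite -phiD !subrr phi0.
have phi1 k : phi k 1 = 1 by rewrite /phi t1 ffunE.
have phiM k x y : phi k (x * y) = phi k x * phi k y 
  by have E : t (x * y) 1 = t x 1 * t y 1 by [rewrite -tM mulr1]; rewrite /phi E ffunE.
have phi_scal k (c : K) (x : A) : phi k (c *: x) = phi k c%:A * phi k x.
  by rewrite -phiM -scalerAl mul1r.
pose qI : A := Quat a b 0 1 0 0; pose qJ : A := Quat a b 0 0 1 0.
have phi_neq0 k (x y : A) (c : K) : c != 0 -> x * y = c%:A -> phi k x != 0.
  move=> c0 Exy; apply/eqP => x0.
  have : phi k (x * (c^-1 *: y)) = 0 by rewrite phiM x0 mul0r.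
  rewrite -scalerAr Exy scalerA mulVf // scale1r phi1 => /(congr1 (@qre _ _ _))/eqP.
  by rewrite oner_eq0.
have anti k : phi k qI * phi k qJ = - (phi k qJ * phi k qI).
  by rewrite -!phiM -phiN quat_ij quat_ji opprK.
have I0 k : phi k qI != 0 by apply: phi_neq0 a0 (quat_ii a b).
have J0 k : phi k qJ != 0 by apply: phi_neq0 b0 (quat_jj a b).
have comm k (c : K) x : phi k c%:A * phi k x = phi k x * phi k c%:A.
  by rewrite -!phiM mul_scalarC.
have Nij k := anticommuting_neq (I0 k) (J0 k) (anti k).
pose s k (c : K) := qre (phi k c%:A).
have sE k c : phi k c%:A = (s k c)%:A.
  exact: central_of_commute (Nij k) (comm _ _ _) (comm _ _ _).
have sB k : {morph s k : x y / x - y}.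
  by move=> x y; rewrite /s scalerBl phiD phiN.
have s1 k : s k 1 = 1 by rewrite /s scale1r phi1.
have sM k : {morph s k : x y / x * y}.
  move=> x y; rewrite {1}/s -scalerA -[y *: 1]mul1r scalerAl phiM !sE.
  by rewrite -scalerAl mul1r scalerA !qscalarE.
have Isq k : phi k qI * phi k qI = (s k a)%:A by rewrite -phiM quat_ii sE.
have Jsq k : phi k qJ * phi k qJ = (s k b)%:A by rewrite -phiM quat_jj sE.
have anti' k : phi k qJ * phi k qI = - (phi k qI * phi k qJ) by rewrite anti opprK.
exists (fun k => pack_rmorphism (sB k) (sM k) (s1 k)); split=> [k|lam lam0 k].
  have [_ ?] := anticommuting_sqr (I0 k) (J0 k) (anti k) (Isq k).
  by have [_ ?] := anticommuting_sqr (J0 k) (I0 k) (anti' k) (Jsq k).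
have trI k' : qtr (phi k' qI) = 0.
  by have [? _] := anticommuting_sqr (I0 k') (J0 k') (anti k') (Isq k').
have trJ k' : qtr (phi k' qJ) = 0.
  by have [? _] := anticommuting_sqr (J0 k') (I0 k') (anti' k') (Jsq k').
have re0 (h : quat (-1 : R) (-1)) : qtr h = 0 -> qre h = 0.
  by rewrite /qtr => /eqP; rewrite mulrn_eq0 => /eqP.
have reI k' := re0 _ (trI k'); have reJ k' := re0 _ (trJ k').
have reIJ k' : qre (phi k' qI * phi k' qJ) = 0.
  apply: re0; have := qtrMC (phi k' qI) (phi k' qJ); rewrite {1}anti qtrN => E.
  by rewrite anti qtrN; lra.
have re_phi k' x : qre (phi k' x) = s k' (qre x).
  have Ex : x = (qre x)%:A + qi x *: qI + qj x *: qJ + qij x *: (qI * qJ).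
    by rewrite quat_ij qscalarE; apply: quat_eqP; rewrite !quatE /=; ring.
  have Z (c : K) y : qre (phi k' (c *: y)) = s k' c * qre (phi k' y).
    by rewrite phi_scal sE -scalerAl mul1r quatE.
  rewrite {1}Ex !phiD !qreD !Z phi1 phiM reI reJ reIJ !mulr0 !addr0.
  exact: mulr1.
pose T := {ffun 'I_n -> quat (-1 : R) (-1 : R)}.
pose h (v : T) := \sum_k' lam k' * qre (v k').
have hB : {morph h : x y / x - y}.
  by move=> x y; rewrite /h -sumrB; apply: eq_bigr => k' _; rewrite !ffunE !quatE mulrBr.
have zB : {morph (fun _ : T => 0 : R) : x y / x - y} by move=> x y; rewrite subr0.
have bal : balanced (fun (_ : A) (_ : R) => 0 : R) by split=> *; rewrite ?addr0.
have [h0 _ h0U] := tU _ _ bal.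
have hE x r : h (t x r) = 0.
  have E0 : \sum_k' r * (lam k' * s k' (qre x)) = 0 by rewrite -mulr_sumr [X in r * X]lam0 mulr0.
  transitivity (\sum_k' r * (lam k' * s k' (qre x))); last exact: E0.
  rewrite /h; apply: eq_bigr => k' _.
  rewrite -[r in t x r]mulr1 tZ ffunE quatE -[t x 1 k']/(phi k' x) re_phi.
  by rewrite mulrCA.
(* [h] and the zero map agree on pure tensors, hence everywhere by uniqueness; a vector supported at
   [k] then isolates [lam k]. *)
have E1 := h0U (pack_additive hB) hE; have E2 := h0U (pack_additive zB) (fun _ _ => erefl _).
pose v : T := [ffun j => (j == k)%:R].
have : h v = 0 by rewrite [LHS](E1 v) -(E2 v).
rewrite /h (bigD1 k) //= ffunE eqxx mulr1 big1 ?addr0 // => j jk.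
by rewrite ffunE (negbTE jk) mulr0.
Qed.

End RealPlaces.

(** * Algebraic integers *)

Notation algint := (integralOver (intr : int -> _)).

Section AlgebraicIntegers.

Variables (F : fieldType).
Implicit Types x y : F.

Lemma algint_fmorph (E : fieldType) (f : {rmorphism F -> E}) x :
  algint (f x) <-> algint x.
Proof.
have Ef (p : {poly int}) : map_poly intr p = map_poly f (map_poly intr p).
  by rewrite -map_poly_comp; apply: eq_map_poly => z /=; rewrite rmorph_int.
by split=> -[p mp rp]; exists p => //; move: rp; rewrite Ef fmorph_root.
Qed.

Lemma algint_int (z : int) : algint (z%:~R : F).
Proof. exact: integral_id. Qed.

Lemma algint_add x y : algint x -> algint y -> algint (x + y).
Proof. exact: integral_add. Qed.

Lemma algint_mul x y : algint x -> algint y -> algint (x * y).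
Proof. exact: integral_mul. Qed.

Lemma algint0 : algint (0 : F). Proof. exact: integral0. Qed.
Lemma algint1 : algint (1 : F). Proof. exact: integral1. Qed.

Lemma algint_sum I (r : seq I) (P : pred I) (E : I -> F) :
  (forall i, P i -> algint (E i)) -> algint (\sum_(i <- r | P i) E i).
Proof. by move=> H; elim/big_ind: _ => //; [exact: algint0|exact: algint_add]. Qed.

Definition algint_poly (p : {poly F}) := forall i, algint p`_i.

Lemma algint_polyM p q : algint_poly p -> algint_poly q -> algint_poly (p * q).
Proof. by move=> Hp Hq i; rewrite coefM; apply: algint_sum => j _; apply: algint_mul. Qed.

Lemma algint_polyD p q : algint_poly p -> algint_poly q -> algint_poly (p + q).
Proof. by move=> Hp Hq i; rewrite coefD; apply: algint_add. Qed.

Lemma algint_polyN p : algint_poly p -> algint_poly (- p).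
Proof. by move=> Hp i; rewrite coefN; apply: integral_opp. Qed.

Lemma algint_polyC c : algint c -> algint_poly c%:P.
Proof. by move=> Hc i; rewrite coefC; case: eqP => _ //; apply: algint0. Qed.

Lemma algint_char_poly n (M : 'M[F]_n) :
  (forall i j, algint (M i j)) -> algint_poly (char_poly M).
Proof.
move=> HM; have H1 : algint_poly 1 by apply: algint_polyC algint1.
rewrite /char_poly /determinant; apply: (big_ind algint_poly).
- exact: algint_polyC algint0.
- exact: algint_polyD.
move=> s _; apply: algint_polyM.
  by case: (odd_perm s); rewrite ?expr1 ?expr0 //; apply: algint_polyN.
apply: (big_ind algint_poly) => // [|i _]; first exact: algint_polyM.
rewrite !mxE; apply: algint_polyD; last exact/algint_polyN/algint_polyC.
case: (_ == _); rewrite ?mulr1n ?mulr0n; last exact: algint_polyC algint0.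
by move=> j; rewrite coefX; case: (j == 1)%N; [exact: algint1|exact: algint0].
Qed.

Lemma algint_root (p : {poly F}) x :
  p \is monic -> root p x -> algint_poly p -> algint x.
Proof. by move=> mp rp /integral_poly; apply: integral_root_monic. Qed.

End AlgebraicIntegers.

Lemma algint_rat (q : rat) : algint q -> exists z : int, q = z%:~R.
Proof.
move=> /(algint_fmorph (ratr : rat -> algC)) [p mp rp].
have Aq : ratr q \in Aint.
  apply: (root_monic_Aint rp); first exact: monic_map.
  by apply/polyOverP => i; rewrite coef_map; apply: intr_int.
have /intrP[z Ez] : (ratr q : algC) \in Num.int.
  by apply: Cint_rat_Aint => //; apply: Crat_rat.
exists z; apply: (fmorph_inj (ratr : {rmorphism rat -> algC})).
by rewrite /= Ez rmorph_int.
Qed.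

Lemma rat_common_denominator (I : finType) (q : I -> rat) :
  exists2 N : int, N != 0 & forall i, exists z : int, N%:~R * q i = z%:~R.
Proof.
exists (\prod_i denq (q i)); first by apply/prodf_neq0 => i _; apply: denq_neq0.
move=> i; rewrite (bigD1 i) //=; set P := \prod_(_ | _) _.
exists (numq (q i) * P); rewrite !intrM mulrAC; congr (_ * _).
by rewrite mulrC -[X in X * _]divq_num_den mulfVK // intr_eq0 denq_neq0.
Qed.

Section NumberFieldPlaces.

Variables (R : realType) (K : fieldExtType rat).
Local Notation n := (\dim {:K}).
Local Notation om := (vbasis {:K}).

Lemma rat_scale_algE (q : rat) (x : K) : q *: x = q%:A * x.
Proof. by rewrite -scalerAl mul1r. Qed.

Lemma rmorph_rat_scale (E : fieldType) (f : {rmorphism K -> E}) (q : rat) x :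
  f (q *: x) = ratr q * f x.
Proof.
by rewrite rat_scale_algE rmorphM; congr (_ * _); rewrite -(fmorph_eq_rat (f \o in_alg K)).
Qed.

Lemma vbasis_sum (x : K) : x = \sum_j coord om j x *: om`_j.
Proof. exact: coord_vbasis (memvf x). Qed.

Definition regular_mx (x : K) : 'M[rat]_n := \matrix_(i, j) coord om i (x * om`_j).

(** [x] is an eigenvalue of its regular matrix, with the basis as eigenvector. Clearing denominators
    makes the characteristic polynomial integral. *)
Lemma algint_scale (x : K) : exists2 N : int, N != 0 & algint (N%:~R * x).
Proof.
pose M := regular_mx x.
have [N N0 HN] := rat_common_denominator (fun p : 'I_n * 'I_n => M p.1 p.2).
exists N => //; pose M' := map_mx (in_alg K) (N%:~R *: M).
pose v : 'rV[K]_n := \row_j om`_j.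
have vM : v *m M' = (N%:~R * x) *: v.
  apply/rowP => j; rewrite !mxE -mulrA [x * _]vbasis_sum mulr_sumr.
  apply: eq_bigr => i _; rewrite !mxE rat_scale_algE rmorphM rmorph_int.
  by rewrite mulrC -mulrA.
have v0 : v != 0.
  apply/eqP => /rowP v0; have := oner_neq0 K; rewrite [1](vbasis_sum) big1 ?eqxx // => j _.
  by have := v0 j; rewrite !mxE => ->; rewrite scaler0.
have : eigenvalue M' (N%:~R * x) by apply/eigenvalueP; exists v.
rewrite eigenvalue_root_char => rx.
apply: algint_root rx _; first exact: char_poly_monic.
apply: algint_char_poly => i j; have [z /= Ez] := HN (i, j).
rewrite mxE [X in GRing.in_alg K X]mxE [X in GRing.in_alg K X]Ez rmorph_int.
exact: algint_int.
Qed.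

Variable sigma : 'I_n -> {rmorphism K -> R}.
Hypothesis sigma_indep :
  forall lam : 'I_n -> R, (forall c, \sum_k lam k * sigma k c = 0) -> forall k, lam k = 0.

Let W : 'M[R]_n := \matrix_(k, j) sigma k om`_j.

Lemma places_kernel (lam : 'I_n -> R) :
  (forall j : 'I_n, \sum_k lam k * sigma k om`_j = 0) -> forall k, lam k = 0.
Proof.
move=> H; apply: sigma_indep => c.
have E k : sigma k c = \sum_j ratr (coord om j c) * sigma k om`_j.
  by rewrite {1}[c]vbasis_sum rmorph_sum; apply: eq_bigr => j _; rewrite rmorph_rat_scale.
under eq_bigr do rewrite E mulr_sumr.
rewrite exchange_big big1 // => j _; under eq_bigr do rewrite mulrCA.
by rewrite -mulr_sumr H mulr0.
Qed.

Let uW : W \in unitmx.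
Proof.
rewrite -row_free_unit -kermx_eq0; apply/eqP/row_matrixP => i; rewrite row0.
have := sub_kermxP (row_sub i (kermx W)); move: (row i _) => r rW.
have H := places_kernel (lam := fun k => r 0 k).
apply/rowP => k; rewrite mxE; apply: H => j.
by have := congr1 (fun v : 'rV_n => v 0 j) rW; rewrite !mxE => {2}<-; apply: eq_bigr => l _; rewrite mxE.
Qed.

(** The invertible matrix [W] of conjugates of the basis diagonalizes the regular matrix of [c],
    with the [sigma k c] on the diagonal. *)
Lemma trace_places (c : K) : \sum_k sigma k c = ratr (\tr (regular_mx c)).
Proof.
pose D := diag_mx (\row_k sigma k c).
have EW : D *m W = W *m map_mx ratr (regular_mx c).
  apply/matrixP => k j; rewrite mul_diag_mx !mxE -rmorphM [c * _]vbasis_sum rmorph_sum.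
  by apply: eq_bigr => i _; rewrite !mxE rmorph_rat_scale mulrC.
have -> : \sum_k sigma k c = \tr D.
  by rewrite mxtrace_diag; apply: eq_bigr => k _; rewrite mxE.
have -> : D = W *m map_mx ratr (regular_mx c) *m invmx W by rewrite -EW mulmxK.
by rewrite mxtrace_mulC mulmxA mulVmx // mul1mx trace_map_mx.
Qed.

Lemma trace_algint (c : K) : algint c -> exists z : int, \sum_k sigma k c = z%:~R.
Proof.
move=> ic; rewrite trace_places.
have [|z ->] := @algint_rat (\tr (regular_mx c)); last by exists z; rewrite rmorph_int.
have : algint (\sum_k sigma k c) by apply: algint_sum => k _; apply/algint_fmorph.
rewrite trace_places; exact: (proj1 (algint_fmorph (ratr : {rmorphism rat -> R}) _)).
Qed.

End NumberFieldPlaces.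

(** * Orders *)

Section QuaternionPowers.

Variables (K : fieldType) (a b : K).
Local Notation A := (quat a b).

(* [x ^+ k = p.1 *: x + p.2] for any root [x] of [X^2 - t X + n]. *)
Fixpoint lucas_pair (t n : K) (k : nat) : K * K :=
  if k is k'.+1 then
    let p := lucas_pair t n k' in (t * p.1 + p.2, - (n * p.1))
  else (0, 1).

Lemma quat_power (x : A) k :
  x ^+ k = (lucas_pair (qtr x) (qnorm x) k).1 *: x
           + (lucas_pair (qtr x) (qnorm x) k).2%:A.
Proof.
elim: k => [|k IH]; first by rewrite expr0 scale0r add0r scale1r.
rewrite exprSr IH /=; move: (lucas_pair _ _ _) => [p q] /=.
rewrite mulrDl -scalerAl sqr_quat -scalerAl mul1r.
move: (qtr x) (qnorm x) => t n.
by rewrite !qscalarE; apply: quat_eqP; rewrite !quatE /=; ring.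
Qed.

Lemma root_power (E : fieldType) (f : {rmorphism K -> E}) (t n : K) (z : E) k :
  z * z = f t * z - f n ->
  z ^+ k = f (lucas_pair t n k).1 * z + f (lucas_pair t n k).2.
Proof.
move=> Ez; elim: k => [|k IH]; first by rewrite expr0 /= rmorph0 rmorph1 mul0r add0r.
rewrite exprSr IH /=; move: (lucas_pair _ _ _) => [p q] /=.
rewrite mulrDl -mulrA Ez !(rmorphD, rmorphM, rmorphN) /=; ring.
Qed.

Lemma nonscalar_indep (x : A) (c d : K) :
  (forall e, x != e%:A) -> c *: x + d%:A = 0 -> c = 0 /\ d = 0.
Proof.
move=> Nx E; have [c0|c0] := eqVneq c 0.
  split=> //; move: E; rewrite c0 scale0r add0r => /eqP.
  by rewrite scaler_eq0 oner_eq0 orbF => /eqP.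
case/eqP: (Nx (- (c^-1 * d))); apply: (scalerI c0).
rewrite scalerA mulrN mulrA mulfV // mul1r scaleNr.
by apply/eqP; rewrite -addr_eq0 E.
Qed.

Lemma root_of_quat_poly (E : fieldType) (f : {rmorphism K -> E}) (x : A) (p : {poly K}) (z : E) :
    (forall e, x != e%:A) -> \sum_(k < size p) p`_k *: x ^+ k = 0 ->
    z * z = f (qtr x) * z - f (qnorm x) ->
  root (map_poly f p) z.
Proof.
move=> Nx px Ez; have [] := @nonscalar_indep x
  (\sum_(k < size p) p`_k * (lucas_pair (qtr x) (qnorm x) k).1)
  (\sum_(k < size p) p`_k * (lucas_pair (qtr x) (qnorm x) k).2) Nx.
  rewrite !scaler_suml -big_split /= -[RHS]px; apply: eq_bigr => k _.
  by rewrite quat_power scalerDr !scalerA.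
move=> E1 E2; rewrite rootE horner_coef size_map_poly; apply/eqP.
transitivity (f (\sum_(k < size p) p`_k * (lucas_pair (qtr x) (qnorm x) k).1) * z
  + f (\sum_(k < size p) p`_k * (lucas_pair (qtr x) (qnorm x) k).2)).
  rewrite !rmorph_sum mulr_suml -big_split /=; apply: eq_bigr => k _.
  by rewrite coef_map (root_power k Ez) !rmorphM /=; ring.
by rewrite E1 E2 !rmorph0 mul0r add0r.
Qed.

(* The companion root is explicit because the discriminant is negative. *)
Lemma quat_complex_root (R : rcfType) (f : {rmorphism K -> R}) (x : A) :
    f a < 0 -> f b < 0 ->
  exists s : R, let z := Complex (f (qre x)) s in
    z * z = (f (qtr x))%:C%C * z - (f (qnorm x))%:C%C.
Proof.
move=> fa fb; pose d := f (qnorm x) - f (qre x) ^+ 2.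
have d0 : 0 <= d.
  have -> : d = (- f a) * f (qi x) ^+ 2 + (- f b) * f (qj x) ^+ 2
      + (- f a) * (- f b) * f (qij x) ^+ 2.
    by rewrite /d qnorm_def !(rmorphD, rmorphB, rmorphM, rmorphXn); ring.
  have na : 0 <= - f a by rewrite oppr_ge0 ltW.
  have nb : 0 <= - f b by rewrite oppr_ge0 ltW.
  by apply: addr_ge0; [apply: addr_ge0|]; apply: mulr_ge0; rewrite ?sqr_ge0 ?mulr_ge0.
exists (Num.sqrt d) => /=; have Es := sqr_sqrtr d0; move: (Num.sqrt d) Es => s Es.
apply/eqP; rewrite eq_complex /= /qtr rmorphMn /=.
by apply/andP; split; apply/eqP; rewrite /d in Es; lra.
Qed.

End QuaternionPowers.

Section Orders.

Variables (R : realType) (K : fieldExtType rat) (a b : K).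
Local Notation A := (quat a b).
Variables (L : {pred A}).
Hypothesis L_order : is_order L.

Let L1 : 1 \in L. Proof. by case: L_order => -[? ? ?] _ _. Qed.
Let LB : {in L &, forall x y, x - y \in L}. Proof. by case: L_order => -[? ? ?] _ _. Qed.
Let LM : {in L &, forall x y, x * y \in L}. Proof. by case: L_order => -[? ? ?] _ _. Qed.

Lemma order0 : 0 \in L. Proof. by rewrite -(subrr 1) LB. Qed.
Lemma orderN x : x \in L -> - x \in L. Proof. by move=> Lx; rewrite -sub0r LB ?order0. Qed.
Lemma orderD x y : x \in L -> y \in L -> x + y \in L.
Proof. by move=> Lx Ly; rewrite -[y]opprK LB ?orderN. Qed.

Lemma orderZ c x : algint c -> x \in L -> c *: x \in L.
Proof.
case: L_order => _ [s Ls] _ Hc /Ls[d [Hd ->]]; apply/Ls; exists (fun i => c * d i).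
split=> [i|]; first exact: (algint_mul Hc (Hd i)).
by rewrite scaler_sumr; apply: eq_bigr => i _; rewrite scalerA.
Qed.

Lemma order_scale (v : A) : exists2 N : int, N != 0 & (N%:~R : K) *: v \in L.
Proof.
case: L_order => _ _ [X XL /(_ v)[c [-> _]]].
have [N HN] := fin_all_exists2 (fun i : 'I_(size X) => algint_scale (c i)).
move=> Hi; exists (\prod_i N i); first by apply/prodf_neq0.
rewrite scaler_sumr; apply: (big_ind (fun x => x \in L)); [exact: order0|exact: orderD|].
move=> i _; rewrite scalerA (bigD1 i) //= intrM mulrAC.
by apply: orderZ; [apply: algint_mul; [exact: Hi|exact: algint_int]|apply/XL/mem_nth].
Qed.

(** Multiplication by [x] acts on generators of [L] through a matrix of algebraic integers. By
    Cayley-Hamilton its characteristic polynomial at [x] kills every generator, hence kills 1. *)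
Lemma order_poly (x : A) : x \in L ->
  exists p : {poly K}, [/\ p \is monic, algint_poly p & \sum_(k < size p) p`_k *: x ^+ k = 0].
Proof.
move=> Lx; case: L_order => _ [s Ls] _.
have [r [v [Lv Lr]]] : exists r (v : 'I_r -> A), (forall i, v i \in L) /\
    forall y, y \in L -> exists c : 'I_r -> K, (forall i, algint (c i)) /\ y = \sum_i c i *: v i.
  exists (size s), (fun i => s`_i); split=> [i|y /Ls//].
  apply/Ls; exists (fun j => (j == i)%:R); split=> [j|].
    by case: eqP => _; [exact: algint1|exact: algint0].
  rewrite (bigD1 i) //= eqxx scale1r big1 ?addr0 // => j /negbTE ->.
  by rewrite scale0r.
case: r v Lv Lr => [|r] v Lv Lr.
  have [c [_ /eqP]] := Lr 1 L1; rewrite big_ord0 oner_eq0 //.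
have [C HC] := fin_all_exists (fun i => Lr _ (LM Lx (Lv i))).
pose M : 'M[K]_r.+1 := \matrix_(i, j) C i j.
have xv k i : x ^+ k * v i = \sum_j (M ^+ k) i j *: v j.
  elim: k i => [|k IH] i.
    rewrite expr0 mul1r expr0 (bigD1 i) //= mxE eqxx scale1r big1 ?addr0 // => j ji.
    by rewrite mxE eq_sym (negbTE ji) scale0r.
  rewrite exprSr -mulrA (proj2 (HC i)) mulr_sumr exprS.
  under [RHS]eq_bigr do rewrite mxE scaler_suml.
  rewrite exchange_big /=; apply: eq_bigr => j _.
  rewrite -scalerAr IH scaler_sumr; apply: eq_bigr => l _.
  by rewrite scalerA mxE.
exists (char_poly M); split; first exact: char_poly_monic.
  by apply: algint_char_poly => i j; rewrite mxE; apply: (proj1 (HC i)).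
set p := char_poly M; set y := \sum_(_ < _) _.
have pM : \sum_(k < size p) p`_k *: M ^+ k = 0.
  rewrite -[RHS](Cayley_Hamilton M) -/p -[p in RHS]coefK poly_def linear_sum.
  by apply: eq_bigr => k _; rewrite linearZ rmorphXn /= horner_mx_X.
have yv i : y * v i = 0.
  rewrite /y mulr_suml; under eq_bigr do rewrite -scalerAl xv scaler_sumr.
  rewrite exchange_big big1 // => j _ /=.
  under eq_bigr do rewrite scalerA.
  rewrite -scaler_suml; have := congr1 (fun Z : 'M_r.+1 => Z i j) pM.
  rewrite summxE mxE => E; rewrite (_ : \sum_(_ < _) _ = 0) ?scale0r // -[RHS]E.
  by apply: eq_bigr => k _; rewrite mxE.
have [c [_ E1]] := Lr 1 L1.
rewrite -[y]mulr1 E1 mulr_sumr big1 // => i _.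
by rewrite -scalerAr yv scaler0.
Qed.

(** For nonscalar [x] the integral polynomial of [x] vanishes at both complex roots of the reduced
    characteristic polynomial, which are therefore integral; their sum is the image of the trace. *)
Lemma order_qtr (f : {rmorphism K -> R}) (x : A) :
  f a < 0 -> f b < 0 -> x \in L -> algint (qtr x).
Proof.
move=> fa fb Lx; have [p [mp ip px]] := order_poly Lx.
have [[e Ex]|Nx] := pselect (exists e, x = e%:A).
  have pe : root p e.
    rewrite rootE horner_coef; apply/eqP.
    have : (\sum_(k < size p) p`_k * e ^+ k)%:A = 0 :> A.
      rewrite -[RHS]px scaler_suml; apply: eq_bigr => k _.
      by rewrite Ex exprZn expr1n scalerA.
    by move/eqP; rewrite scaler_eq0 oner_eq0 orbF => /eqP.
  have ie := algint_root mp pe ip.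
  by rewrite Ex qtrA mulr2n; apply: algint_add.
have {}Nx e : x != e%:A by apply/eqP => Ex; apply: Nx; exists e.
have [s /= Ez] := quat_complex_root x fa fb.
pose g : {rmorphism K -> R[i]} := real_complex R \o f.
have gp : algint_poly (map_poly g p) by move=> i; rewrite coef_map; apply/algint_fmorph.
have gm : map_poly g p \is monic by rewrite map_monic.
have iz := algint_root gm (root_of_quat_poly (f := g) Nx px Ez) gp.
have Ez' : (Complex (f (qre x)) (- s)) * (Complex (f (qre x)) (- s)) =
    g (qtr x) * Complex (f (qre x)) (- s) - g (qnorm x).
  move: Ez => /eqP; rewrite !eq_complex /= => /andP[/eqP E1 /eqP E2].
  by apply/eqP; rewrite eq_complex /=; apply/andP; split; apply/eqP; lra.
have iz' := algint_root gm (root_of_quat_poly (f := g) Nx px Ez') gp.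
apply/(algint_fmorph g); have -> : g (qtr x) = Complex (f (qre x)) s + Complex (f (qre x)) (- s).
  by apply/eqP; rewrite eq_complex /= /qtr rmorphMn /= subrr mulr2n !eqxx.
exact: algint_add.
Qed.

End Orders.

(** * Finiteness of the norm one group *)

Lemma finite_of_inj (A : choiceType) (T : finType) (P : A -> Prop) (g : A -> T) :
    (forall x y, P x -> P y -> g x = g y -> x = y) ->
  exists s : seq A, forall x, P x <-> x \in s.
Proof.
move=> inj; pose f u := match pselect (exists x, P x /\ g x = u) with
  | left H => Some (proj1_sig (cid H)) | right _ => None end.
have fP u x : f u = Some x -> P x /\ g x = u.
  by rewrite /f; case: pselect => // H [<-]; case: (cid H).
exists (pmap f (enum T)) => x; rewrite mem_pmap; split=> [Px|/mapP[u _ /esym/fP[]//]].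
apply/mapP; exists (g x); first by rewrite mem_enum.
case Ef: (f (g x)) => [y|]; first by have [Py Ey] := fP _ _ Ef; rewrite (inj y x).
by move: Ef; rewrite /f; case: pselect => // -[]; exists x.
Qed.

Lemma finite_of_bounded_int (A : choiceType) (I : finType) (P : A -> Prop)
    (h : I -> A -> int) (B : I -> nat) :
    (forall i x, P x -> `|h i x| <= (B i)%:Z) ->
    (forall x y, P x -> P y -> (forall i, h i x = h i y) -> x = y) ->
  exists s : seq A, forall x, P x <-> x \in s.
Proof.
move=> hB inj; pose M := \sum_i B i.
have hM i x : P x -> (absz (h i x + M%:Z)%R < (M + M).+1)%N /\ 0 <= h i x + M%:Z.
  move=> /(hB i); have : (B i <= M)%N by rewrite /M (bigD1 i) //= leq_addr.
  move: (h i x) (B i) M; clear => u c M cM uc.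
  have {uc} : `|u| <= M%:Z by apply: le_trans uc _; rewrite lez_nat.
  by rewrite ler_norml => /andP[? ?]; split; lia.
apply: (@finite_of_inj _ {ffun I -> 'I_(M + M).+1} P
  (fun x => [ffun i => inord (absz (h i x + M%:Z)%R)])) => x y Px Py /ffunP E.
apply: inj => // i; have := E i; rewrite !ffunE => /(congr1 val) /=.
have [lx x0] := hM i x Px; have [ly y0] := hM i y Py.
by rewrite !inordK // => Exy; apply: (addIr M%:Z); rewrite -(gez0_abs x0) -(gez0_abs y0) Exy.
Qed.

Section NormOneFinite.

Variables (R : realType) (K : fieldExtType rat) (a b : K).
Local Notation A := (quat a b).
Local Notation n := (\dim {:K}).
Hypotheses (a0 : a != 0) (b0 : b != 0).
Variable sigma : 'I_n -> {rmorphism K -> R}.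
Hypothesis sigma_neg : forall k, sigma k a < 0 /\ sigma k b < 0.
Hypothesis sigma_indep :
  forall lam : 'I_n -> R, (forall c, \sum_k lam k * sigma k c = 0) -> forall k, lam k = 0.
Variables (L : {pred A}).
Hypothesis L_order : is_order L.

Let n_gt0 : (0 < n)%N.
Proof. by rewrite adim_gt0. Qed.

Lemma norm_coords_bound (k : 'I_n) (x : A) : qnorm x = 1 ->
  [/\ sigma k (qre x) ^+ 2 <= 1, (- sigma k a) * sigma k (qi x) ^+ 2 <= 1,
      (- sigma k b) * sigma k (qj x) ^+ 2 <= 1
    & (sigma k a * sigma k b) * sigma k (qij x) ^+ 2 <= 1].
Proof.
move=> /(congr1 (sigma k)); rewrite qnorm_def rmorph1.
rewrite !(rmorphD, rmorphB, rmorphM, rmorphXn) /= => E.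
have [na nb] := sigma_neg k.
have S (u : R) : 0 <= u ^+ 2 := sqr_ge0 u.
have S0 := S (sigma k (qre x)).
have S1 : 0 <= (- sigma k a) * sigma k (qi x) ^+ 2 by apply: mulr_ge0 => //; rewrite oppr_ge0 ltW.
have S2 : 0 <= (- sigma k b) * sigma k (qj x) ^+ 2 by apply: mulr_ge0 => //; rewrite oppr_ge0 ltW.
have S3 : 0 <= (sigma k a * sigma k b) * sigma k (qij x) ^+ 2.
  by apply: mulr_ge0 => //; rewrite nmulr_rge0 // ltW.
split; lra.
Qed.

Lemma sqr_bound (c u : R) : 0 < c -> c * u ^+ 2 <= 1 -> `|u| <= 1 + c^-1.
Proof.
move=> c0 Hu; rewrite leNgt; apply/negP => lt.
have ci : 0 < c^-1 by rewrite invr_gt0.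
have cc : c * c^-1 = 1 by rewrite mulfV // gt_eqF.
rewrite -real_normK ?num_real // in Hu; nra.
Qed.

Lemma weighted_trace_bound (u : A -> K) (c : 'I_n -> R) (d : K) :
    (forall k, 0 < c k) ->
    (forall k x, x \in norm_one L -> c k * sigma k (u x) ^+ 2 <= 1) ->
  exists B : nat, forall x, x \in norm_one L -> `|\sum_k sigma k (u x * d)| <= B%:R.
Proof.
move=> c0 Hc; pose B0 := \sum_k (1 + (c k)^-1) * `|sigma k d|.
exists (Num.bound B0) => x Lx.
have B00 : 0 <= B0.
  by apply: sumr_ge0 => k _; rewrite mulr_ge0 // addr_ge0 // invr_ge0 ltW.
apply: le_trans (_ : B0 <= _); last by apply: ltW; apply: archi_boundP.
apply: le_trans (ler_norm_sum _ _ _) _; apply: ler_sum => k _.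
by rewrite rmorphM normrM ler_wpM2r // sqr_bound // Hc.
Qed.

(** The traces to the rationals of the reduced trace of [x] times a basis element, times a basis of
    K, are integers after scaling. They are bounded because the norm form is positive at every
    place, and they determine [x] because the places are independent. *)
Lemma norm_one_finite : exists s : seq A, forall x, x \in norm_one L <-> x \in s.
Proof.
have k0 := Ordinal n_gt0.
pose e (l : 'I_4) : A := [:: 1; Quat a b 0 1 0 0; Quat a b 0 0 1 0; Quat a b 0 0 0 1]`_l.
(* [N l] moves the basis element [e l] into the order, and [D j] makes the j-th basis element of K
   integral. *)
have [N N0 LN] := fin_all_exists2 (fun l => order_scale L_order (e l)).
have [D D0 ID] := fin_all_exists2 (fun j : 'I_n => algint_scale (vbasis {:K})`_j).
pose om j := (D j)%:~R * (vbasis {:K})`_j.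
pose u (l : 'I_4) (x : A) : K := [:: qre x; qi x; qj x; qij x]`_l.
(* The diagonal of the form [qtr (x * y)] in the basis 1, i, j, ij, where it is orthogonal. *)
pose m (l : 'I_4) : K := [:: 2; 2 * a; 2 * b; - (2 * a * b)]`_l.
have m0 l : m l != 0.
  have two0 : (2 : K) != 0 by rewrite -(rmorph_nat (in_alg K)) fmorph_eq0 pnatr_eq0.
  by case: l => -[|[|[|[|l]]]] //= Hl; rewrite /m /= ?oppr_eq0 ?mulf_neq0.
have uE l x : qtr (x * ((N l)%:~R *: e l)) = u l x * (m l * (N l)%:~R).
  rewrite -scalerAr qtrZ; case: l => -[|[|[|[|l]]]] //= Hl; rewrite /qtr quatE /u /m /e /=; ring.
pose w (p : 'I_4 * 'I_n) x := \sum_k sigma k (u p.1 x * (m p.1 * (N p.1)%:~R * om p.2)).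
have wZ p x : x \in norm_one L -> exists z : int, w p x = z%:~R.
  move=> /andP[Lx _]; apply: trace_algint => //.
  rewrite mulrA -uE; apply: algint_mul; last exact: ID.
  have [na nb] := sigma_neg k0.
  apply: (order_qtr L_order na nb).
  by case: L_order => -[_ _ LM] _ _; apply: LM Lx (LN _).
pose c (l : 'I_4) (k : 'I_n) : R := [:: 1; - sigma k a; - sigma k b; sigma k a * sigma k b]`_l.
have c0 l k : 0 < c l k.
  have [na nb] := sigma_neg k; rewrite /c.
  by case: l => -[|[|[|[|l]]]] //= Hl; rewrite ?oppr_gt0 // nmulr_rgt0.
have wB p : exists B : nat, forall x, x \in norm_one L -> `|w p x| <= B%:R.
  apply: (@weighted_trace_bound (u p.1) (c p.1)) => // k x /andP[_ /eqP n1].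
  have [? ? ? ?] := norm_coords_bound k n1; rewrite /c /u.
  by case: (p.1) => -[|[|[|[|l]]]] //= Hl; rewrite ?mul1r.
have [B HB] := fin_all_exists wB.
pose h p x := Num.floor (w p x).
have hE p x : x \in norm_one L -> w p x = (h p x)%:~R.
  by move=> Lx; have [z Ez] := wZ p x Lx; rewrite /h Ez floorK ?intr_int.
apply: (@finite_of_bounded_int _ _ (fun x => x \in norm_one L) h B) => [p x Lx|x y Lx Ly Exy].
  by rewrite -(ler_int R) intr_norm -hE // HB.
have Eu l : u l x = u l y.
  apply/eqP; rewrite -subr_eq0.
  have mN0 : m l * (N l)%:~R != 0.
    by rewrite mulf_neq0 // -(rmorph_int (in_alg K)) fmorph_eq0 intr_eq0.
  rewrite -(mulIr_eq0 _ (mulIf mN0)) -(fmorph_eq0 (sigma k0)); apply/eqP.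
  apply: (places_kernel sigma_indep (lam := fun k => sigma k ((u l x - u l y) * (m l * (N l)%:~R)))) => j.
  have : w (l, j) x - w (l, j) y = 0 by rewrite !hE // Exy subrr.
  rewrite /w -sumrB /= => E.
  have Dj0 : (D j)%:~R != 0 :> R by rewrite intr_eq0.
  apply: (mulIf Dj0); rewrite mul0r -[RHS]E mulr_suml; apply: eq_bigr => k _.
  rewrite -rmorphB -mulrBl /om -(rmorph_int (sigma k)) -!rmorphM; congr (sigma k _); ring.
apply: quat_eqP; [exact: (Eu 0)|exact: (Eu 1)|exact: (Eu 2%:R)|exact: (Eu 3%:R)].
Qed.

End NormOneFinite.

(** * Rational bases and traces *)

Section RegularGroup.

Variables (K : fieldExtType rat) (a b : K) (s : seq (quat a b)).
Local Notation A := (quat a b).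
Hypotheses (s1 : 1 \in s) (sM : forall x y, x \in s -> y \in s -> x * y \in s).
Hypothesis sV : forall x, x \in s -> exists2 y, y \in s & x * y = 1.

Local Notation T := (seq_sub s).
Let one : T := SeqSub s1.

Let rmul (y x : T) : T := SeqSub (sM (ssvalP x) (ssvalP y)).

Let rmul_inj y : injective (rmul y).
Proof.
move=> x x' /(congr1 val) /= E; have [z _ yz] := sV (ssvalP y).
by apply: val_inj; rewrite /= -[ssval x]mulr1 -[ssval x']mulr1 -yz !mulrA E.
Qed.

Let G : {set {perm T}} :=
  [set p : {perm T} | [forall x : T, val (p x) == val x * val (p one)]].

Let inG (p : {perm T}) : reflect (forall x, val (p x) = val x * val (p one)) (p \in G).
Proof. by rewrite inE; apply: (iffP forallP) => H x; apply/eqP; apply: H. Qed.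

Let groupG : group_set G.
Proof.
apply/group_setP; split=> [|p q /inG Hp /inG Hq].
  by apply/inG => x; rewrite !perm1 mulr1.
by apply/inG => x; rewrite !permM Hq Hp [in RHS]Hq mulrA.
Qed.

(** Elements act on [s] by right multiplication, and each permutation is recovered from its value at
    1. Permutations compose from left to right, so this evaluation is multiplicative. *)
Lemma regular_group : exists (gT : finGroupType) (G : {group gT}),
  mul_isog [pred x | x \in s] G.
Proof.
exists {perm T}, (Group groupG), (fun p : {perm T} => val (p one)); split.
- move=> p q /inG Hp /inG Hq E; apply/permP => x; apply: val_inj.
  by rewrite Hp Hq E.
- by move=> p q /inG Hp /inG Hq /=; rewrite permM Hq.
move=> x; rewrite inE; split=> [sx|[p _ <-]]; last exact: valP.
exists (perm (@rmul_inj (SeqSub sx))); last by rewrite permE /= mul1r.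
by apply/inG => y; rewrite !permE /= mul1r.
Qed.

End RegularGroup.

Section BasisExtraction.

Variables (F K : fieldType) (f : {rmorphism F -> K}) (V : lmodType K).

Definition spans (X : seq V) (v : V) :=
  exists c : 'I_(size X) -> F, v = \sum_i f (c i) *: X`_i.

Section SpanClosure.

Variable X : seq V.

Lemma spans0 : spans X 0.
Proof. by exists (fun _ => 0); rewrite big1 // => i _; rewrite rmorph0 scale0r. Qed.

Lemma spansD x y : spans X x -> spans X y -> spans X (x + y).
Proof.
move=> [c ->] [d ->]; exists (fun i => c i + d i); rewrite -big_split /=.
by apply: eq_bigr => i _; rewrite rmorphD scalerDl.
Qed.

Lemma spansZ e x : spans X x -> spans X (f e *: x).
Proof.
move=> [c ->]; exists (fun i => e * c i); rewrite scaler_sumr.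
by apply: eq_bigr => i _; rewrite rmorphM scalerA.
Qed.

Lemma mem_spans x : x \in X -> spans X x.
Proof.
move=> /(nthP 0)[i iX <-]; exists (fun j => (j == Ordinal iX)%:R).
rewrite (bigD1 (Ordinal iX)) //= eqxx rmorph1 scale1r big1 ?addr0 // => j /negbTE ->.
by rewrite rmorph0 scale0r.
Qed.

End SpanClosure.

Lemma spans_nil_free (s : seq V) : exists2 X : seq V, {subset X <= s} &
  (forall c : 'I_(size X) -> F, \sum_i f (c i) *: X`_i = 0 -> forall i, c i = 0) /\
  forall x, x \in s -> spans X x.
Proof.
elim: s => [|x s [X XS [Xfree Xspan]]].
  by exists [::] => //; split=> [c _ []|].
have [Xx|Xx] := pselect (spans X x).
  exists X; first by move=> y /XS sy; rewrite inE sy orbT.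
  by split=> // y; rewrite inE => /predU1P[->|/Xspan].
exists (x :: X).
  by move=> y; rewrite !inE => /predU1P[->|/XS ->]; rewrite ?eqxx ?orbT.
split=> [c|y].
  rewrite big_ord_recl /= => E.
  have c0 : c ord0 = 0.
    apply/eqP; apply: contra_notT Xx => c0.
    exists (fun i => - ((c ord0)^-1 * c (lift ord0 i))).
    have fc0 : f (c ord0) != 0 by rewrite fmorph_eq0.
    apply: (scalerI fc0); rewrite scaler_sumr -[LHS]addr0.
    apply/eqP; rewrite -subr_eq0 addr0 -sumrN; apply/eqP; rewrite -[RHS]E; congr (_ + _).
    apply: eq_bigr => i _; rewrite scalerA rmorphN rmorphM fmorphV mulrN mulrA mulfV //.
    by rewrite mul1r scaleNr opprK.
  move: E; rewrite c0 rmorph0 scale0r add0r => /Xfree H i.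
  by case: (unliftP ord0 i) => [j ->|->].
rewrite inE => /predU1P[->|/Xspan[c ->]].
  exists (fun i => if i == ord0 then 1 else 0); rewrite big_ord_recl /= rmorph1 scale1r.
  by rewrite big1 ?addr0 // => i _; rewrite rmorph0 scale0r.
exists (fun i => if unlift ord0 i is Some j then c j else 0).
rewrite big_ord_recl /= unlift_none rmorph0 scale0r add0r.
by apply: eq_bigr => i _; rewrite liftK.
Qed.

Lemma spansP (s : seq V) :
    (forall v, exists c : 'I_(size s) -> F, v = \sum_i f (c i) *: s`_i) ->
  exists2 X : seq V, {subset X <= s} & is_basis_via f X.
Proof.
move=> span; have [X XS [Xfree Xspan]] := spans_nil_free s; exists X => // v.
have [c Ev] : spans X v.
  have [c ->] := span v; apply: (big_ind (spans X)); [exact: spans0|exact: spansD|].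
  by move=> i _; apply/spansZ/Xspan/mem_nth.
exists (finfun c); split=> [|d Ed]; first by rewrite Ev; apply: eq_bigr => i _; rewrite ffunE.
apply/ffunP => i; rewrite ffunE; apply/eqP; rewrite -subr_eq0; apply/eqP.
apply: (Xfree (fun i => c i - d i)); rewrite -[RHS](subrr v) {1}Ev Ed -sumrB.
by apply: eq_bigr => j _; rewrite rmorphB scalerBl.
Qed.

End BasisExtraction.

(** * Subfields generated by traces *)

Section DivringClosed.

Variables (K : fieldExtType rat) (F : {pred K}).
Hypothesis F_div : GRing.divring_closed F.

Let F1 : 1 \in F. Proof. by case: F_div. Qed.
Let FB : {in F &, forall x y, x - y \in F}. Proof. by case: F_div. Qed.
Let Fdiv : {in F &, forall x y, x / y \in F}. Proof. by case: F_div. Qed.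

Lemma divring0 : 0 \in F. Proof. by rewrite -(subrr 1) FB. Qed.
Lemma divringN x : x \in F -> - x \in F.
Proof. by move=> Fx; rewrite -sub0r FB ?divring0. Qed.
Lemma divringD x y : x \in F -> y \in F -> x + y \in F.
Proof. by move=> Fx Fy; rewrite -[y]opprK FB ?divringN. Qed.
Lemma divringM x y : x \in F -> y \in F -> x * y \in F.
Proof. by move=> Fx Fy; rewrite -[y]invrK Fdiv // -[y^-1]mul1r Fdiv. Qed.

Lemma divring_int (z : int) : z%:~R \in F.
Proof.
have Fnat n : n%:R \in F.
  elim: n => [|n IH]; first exact: divring0.
  by rewrite -addn1 natrD divringD.
by case: z => n; rewrite ?NegzE ?rmorphN /= ?divringN -?pmulrn ?Fnat.
Qed.

Lemma divring_rat (q : rat) : q%:A \in F.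
Proof.
rewrite -[q]divq_num_den -[_%:A]/(in_alg K _) fmorph_div !rmorph_int.
by rewrite Fdiv // divring_int.
Qed.

End DivringClosed.

Section TwoGenerated.

Variables (K : fieldType) (a b : K).
Local Notation A := (quat a b).
Variables (u v : A).
Hypotheses (nu : qnorm u = 1) (nv : qnorm v = 1).

Let vu : v * u = qtr v *: u + qtr u *: v - (qtr u * qtr v - qtr (u * v))%:A - u * v.
Proof.
have E : u * qconj v + v * qconj u = (qtr u * qtr v - qtr (u * v))%:A.
  have <- : qtr (u * qconj v) = qtr u * qtr v - qtr (u * v).
    by rewrite -qtr_mul addrAC subrr add0r.
  by rewrite -add_qconj qconjM qconjK.
have -> : v * u = v * (qtr u)%:A - v * qconj u by rewrite -add_qconj mulrDr addrK.
have Euv : u * (qtr v)%:A - u * qconj v = u * v by rewrite -add_qconj mulrDr addrK.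
rewrite -E -[in RHS]Euv -!mul_scalarC -!scalerAl !mul1r.
by apply: quat_eqP; rewrite !quatE; ring.
Qed.

(** Here and in [mul_right_gen], which is also a left multiplication, the new coefficients are
    integral polynomials in the old ones and the traces of [u], [v], [uv]. The span over any
    subfield containing these traces is thus stable under both generators. *)
Lemma mul_left_gen c0 c1 c2 c3 :
  u * (c0%:A + c1 *: u + c2 *: v + c3 *: (u * v)) =
  (- c1)%:A + (c0 + qtr u * c1) *: u + (- c3) *: v + (c2 + qtr u * c3) *: (u * v).
Proof.
rewrite !mulrDr -!scalerAr mulr1 mulrA sqr_quat nu mulrBl -!scalerAl mul1r.
move: (u * v) => w; move: (qtr u) => t.
by rewrite !qscalarE; apply: quat_eqP; rewrite !quatE /=; ring.
Qed.

Lemma mul_right_gen c0 c1 c2 c3 :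
  v * (c0%:A + c1 *: u + c2 *: v + c3 *: (u * v)) =
  (- c1 * (qtr u * qtr v - qtr (u * v)) - c2 - c3 * qtr u)%:A
  + (c1 * qtr v + c3) *: u
  + (c0 + c1 * qtr u + c2 * qtr v + c3 * qtr (u * v)) *: v + (- c1) *: (u * v).
Proof.
have vuv : v * (u * v) = u + qtr (u * v) *: v - (qtr u)%:A.
  rewrite mulrA vu !mulrBl !mulrDl -!scalerAl -mulrA sqr_quat nv mulrBr -!scalerAr mulr1 mul1r.
  move: (qtr (u * v)) (u * v) => s w; rewrite /qtr.
  by rewrite !qscalarE; apply: quat_eqP; rewrite !quatE /=; ring.
rewrite !mulrDr -!scalerAr mulr1 vuv vu sqr_quat nv.
move: (qtr (u * v)) (u * v) => s w; rewrite /qtr.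
by rewrite !qscalarE; apply: quat_eqP; rewrite !quatE /=; ring.
Qed.

End TwoGenerated.

Section FieldOfTraces.

Variables (K : fieldExtType rat) (a b : K).
Local Notation A := (quat a b).
Hypothesis aniso : forall x : A, qnorm x = 0 -> x = 0.
Variables (S : {pred A}) (gT : finGroupType) (G : {group gT}) (f : gT -> A).
Hypotheses (fM : {in G &, forall g h, f (g * h)%g = f g * f h}).
Hypothesis fS : forall x, x \in S <-> exists2 g, g \in G & f g = x.
Hypothesis Snorm : forall x, x \in S -> qnorm x = 1.

(** The [F]-span of [1, u, v, uv] contains the group, hence its rational span, which is all of [A].
    A scalar [c] has coordinates [(c, 0, 0, 0)] over K, and these are unique, so [c] lies in [F]. *)
Lemma field_of_traces (F : {pred K}) (g h : gT) : GRing.divring_closed F ->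
    g \in G -> h \in G -> G = <<[set g; h]>>%G -> f g * f h != f h * f g ->
    qtr (f g) \in F -> qtr (f h) \in F -> qtr (f (g * h)%g) \in F ->
  contains_Qbasis S -> forall c : K, c \in F.
Proof.
move=> Fdiv Gg Gh defG Ngh tg th tgh [X XS Xbasis] c.
have FD := divringD Fdiv; have FM := divringM Fdiv; have FN := divringN Fdiv.
have F0 := divring0 Fdiv; have F1 : 1 \in F by case: Fdiv.
rewrite fM // in tgh.
have Sf x : x \in G -> f x \in S by move=> Gx; apply/fS; exists x.
have ng := Snorm (Sf g Gg); have nh := Snorm (Sf h Gh).
pose u := f g; pose v := f h.
have [nu nv Nuv] : [/\ qnorm u = 1, qnorm v = 1 & u * v != v * u] by [].
have [tu tv tuv] : [/\ qtr u \in F, qtr v \in F & qtr (u * v) \in F] by [].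
pose P (x : A) := exists c0 c1 c2 c3 : K, [/\ c0 \in F, c1 \in F, c2 \in F & c3 \in F] /\
  x = c0%:A + c1 *: u + c2 *: v + c3 *: (u * v).
have P0 : P 0 by exists 0, 0, 0, 0; rewrite !scale0r !addr0.
have P1 : P 1 by exists 1, 0, 0, 0; rewrite !scale0r !addr0 scale1r.
have PD x y : P x -> P y -> P (x + y).
  move=> [c0 [c1 [c2 [c3 [[? ? ? ?] ->]]]]] [d0 [d1 [d2 [d3 [[? ? ? ?] ->]]]]].
  exists (c0 + d0), (c1 + d1), (c2 + d2), (c3 + d3); split; first by split; apply: FD.
  move: (u * v) => w; rewrite !qscalarE.
  by apply: quat_eqP; rewrite !quatE /=; ring.
have PZ e x : e \in F -> P x -> P (e *: x).
  move=> Fe [c0 [c1 [c2 [c3 [[? ? ? ?] ->]]]]].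
  exists (e * c0), (e * c1), (e * c2), (e * c3); split; first by split; apply: FM.
  by rewrite !scalerDr !scalerA.
have Pu x : P x -> P (u * x).
  move=> [c0 [c1 [c2 [c3 [[? ? ? ?] ->]]]]]; rewrite mul_left_gen //.
  exists (- c1), (c0 + qtr u * c1), (- c3), (c2 + qtr u * c3); split=> //.
  by split; [exact: FN|apply: FD => //; exact: FM|exact: FN|apply: FD => //; exact: FM].
have Pv x : P x -> P (v * x).
  move=> [c0 [c1 [c2 [c3 [[? ? ? ?] ->]]]]]; rewrite mul_right_gen //.
  exists (- c1 * (qtr u * qtr v - qtr (u * v)) - c2 - c3 * qtr u), (c1 * qtr v + c3),
    (c0 + c1 * qtr u + c2 * qtr v + c3 * qtr (u * v)), (- c1).
  split; last by [].
  by split; repeat first [assumption|apply: divring0|apply: (divringN Fdiv)|apply: (divringM Fdiv)|apply: (divringD Fdiv)].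
pose D := [set x in G | `[< forall w, P w -> P (f x * w) >]].
have inD x : reflect (x \in G /\ forall w, P w -> P (f x * w)) (x \in D).
  by rewrite inE; apply: (iffP andP) => -[Gx /asboolP Hx]; split=> //; apply/asboolP.
have f1 : f 1%g = 1.
  have f10 : f 1%g != 0.
    apply/eqP => E; have := Snorm (Sf _ (group1 G)).
    rewrite E qnorm_def /= expr0n /= !mulr0 !subr0 addr0 => /eqP.
    by rewrite eq_sym oner_eq0.
  by apply: (quat_mulfI aniso f10); rewrite -fM // mulg1 mulr1.
have gD : group_set D.
  apply/group_setP; split=> [|x y /inD[Gx Hx] /inD[Gy Hy]].
    by apply/inD; split=> // w; rewrite f1 mul1r.
  by apply/inD; split=> [|w Pw]; [exact: groupM|rewrite fM // -mulrA; apply/Hx/Hy].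
have sGD x : x \in G -> P (f x).
  move=> Gx; have : x \in Group gD.
    have : G \subset Group gD.
      rewrite {1}defG gen_subG; apply/subsetP => y /set2P[]->; apply/inD; split=> // w.
    by move/subsetP; apply.
  by case/inD => _ /(_ 1 P1); rewrite mulr1.
have [q [Ec _]] := Xbasis c%:A.
have : P c%:A.
  rewrite Ec; apply: (big_ind P) => // i _; apply: PZ; first exact: divring_rat.
  have /XS/fS[x Gx <-] : X`_i \in X by apply: mem_nth.
  exact: sGD.
move=> [c0 [c1 [c2 [c3 [[Fc0 _ _ _] E]]]]].
have : (c0 - c)%:A + c1 *: u + c2 *: v + c3 *: (u * v) = 0.
  by rewrite scalerBl !(addrAC _ (- c%:A)) -E subrr.
by move/(quat_indep aniso Nuv) => [/eqP]; rewrite subr_eq0 => /eqP <-.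
Qed.

End FieldOfTraces.

Section QuaternionBasis.

Variables (K : fieldExtType rat) (a b : K) (s : seq (quat a b)).
Local Notation A := (quat a b).
Local Notation Qspan := (spans (in_alg K) s).
Hypothesis aniso : forall x : A, qnorm x = 0 -> x = 0.
Hypothesis sM : forall x y, x \in s -> y \in s -> x * y \in s.

Lemma Qspan_mul x y : Qspan x -> Qspan y -> Qspan (x * y).
Proof.
move=> [c ->] [d ->]; rewrite mulr_suml.
apply: (big_ind Qspan) => [||i _]; [exact: spans0|exact: spansD|].
rewrite -scalerAl; apply: spansZ; rewrite mulr_sumr.
apply: (big_ind Qspan) => [||j _]; [exact: spans0|exact: spansD|].
by rewrite -scalerAr; apply/spansZ/mem_spans/sM; apply: mem_nth.
Qed.

(** The rational span is a ring; once it contains K it is a K-space, and it contains the K-basis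
    [1, u, v, uv]. *)
Lemma Qbasis_of_scalars (u v : A) :
    u \in s -> v \in s -> u * v != v * u -> (forall c : K, Qspan c%:A) ->
  contains_Qbasis [pred x | x \in s].
Proof.
move=> su sv Nuv Ks; apply: spansP => w; change (Qspan w).
have indep c0 c1 c2 c3 := quat_indep aniso (c0 := c0) (c1 := c1) (c2 := c2) (c3 := c3) Nuv.
have [c0 [c1 [c2 [c3 ->]]]] := quat_span w indep.
have KZ c x : x \in s -> Qspan (c *: x).
  by move=> sx; rewrite -[x]mul1r scalerAl; apply: Qspan_mul => //; apply: mem_spans.
apply: spansD; last by apply: KZ; apply: sM.
apply: spansD; last exact: KZ.
by apply: spansD; [apply: Ks|apply: KZ].
Qed.

End QuaternionBasis.

Section SimpleExtension.

Variables (K : fieldExtType rat) (t : K).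
Hypothesis Kt : <<1; t>>%VS = fullv.

Lemma adjoin_ind (P : K -> Prop) :
    (forall x y, P x -> P y -> P (x + y)) -> (forall (q : rat) x, P x -> P (q *: x)) ->
    (forall x, P x -> P (x * t)) -> P 1 ->
  forall c, P c.
Proof.
move=> PD PZ Pt P1 c.
have : c \in <<1; t>>%VS by rewrite Kt memvf.
move=> /Fadjoin1_polyP[p ->]; elim/poly_ind: p => [|p q IH].
  by rewrite rmorph0 horner0 -[0](scale0r (1 : K)); apply: PZ.
rewrite rmorphD rmorphM /= map_polyX map_polyC hornerMXaddC.
by apply: PD; [apply: Pt|apply: PZ].
Qed.

End SimpleExtension.

(** * Quadratic fields *)

Section QuadraticExtension.

Variables (K : fieldExtType rat).
Implicit Types t : K.

Lemma subfield_divring_closed (E : {subfield K}) : GRing.divring_closed [pred x : K | x \in E].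
Proof.
split=> [|x y|x y]; rewrite !inE; first exact: mem1v.
  exact: memvB.
by move=> Fx Fy; rewrite rpredM ?memvV.
Qed.

Lemma dim_adjoin_quadratic t (p q : rat) :
  t ^+ 2 = p *: t + q%:A -> (\dim <<1; t>> <= 2)%N.
Proof.
move=> Et; rewrite dim_Fadjoin dimv1 muln1.
rewrite -ltnS -size_minPoly.
pose r : {poly K} := 'X^2 - (p%:A *: 'X + (q%:A)%:P).
have sz : (size ((p%:A *: 'X + (q%:A)%:P)%R : {poly K}) <= 2)%N.
  apply: leq_trans (size_polyD _ _) _; rewrite geq_max.
  rewrite (leq_trans (@size_polyC_leq1 K _)) // andbT.
  by apply: leq_trans (size_scale_leq _ _) _; rewrite size_polyX.
have sr : (size r = 3)%N.
  by rewrite /r size_polyDl ?size_polyXn // size_polyN ltnS.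
have r0 : r != 0 by rewrite -size_poly_eq0 sr.
rewrite -sr; apply: dvdp_leq => //; apply: minPoly_dvdp.
  rewrite rpredB ?rpredX ?polyOverX // rpredD ?polyOverZ ?polyOverX ?polyOverC //;
  by rewrite memvZ ?mem1v.
by rewrite rootE !hornerE Et rat_scale_algE subrr.
Qed.

Lemma adjoin_full t : \dim {:K} = 2%N -> t \notin 1%VS -> <<1; t>>%VS = fullv.
Proof.
move=> dK Nt; apply/eqP; rewrite eqEdim subvf dK /=.
rewrite ltnNge; apply: contra Nt => d1.
suff -> : 1%VS = <<1; t>>%VS :> {vspace K} by apply: memv_adjoin.
by apply/eqP; rewrite eqEdim subv_adjoin dimv1.
Qed.

Lemma rat_sqr2 (q : rat) : q ^+ 2 != 2.
Proof.
apply/eqP => E; have [|z Ez] := @algint_rat q.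
  exists ('X^2 - 2%:P); first by rewrite monicXnsubC.
  by rewrite rootE rmorphB /= map_polyXn map_polyC /= !hornerE E subrr.
move: E; rewrite Ez -rmorphXn -[2]/(2%:~R) => /intr_inj; rewrite expr2 => {}E.
have : (z <= -2) || (2 <= z) \/ z \in [:: -1; 0; 1] by rewrite !inE; lia.
by case=> [/orP[] /= ?|]; [nia|nia|rewrite !inE => /or3P[] /eqP Ez'; move: E; rewrite Ez'].
Qed.

Lemma rat_golden (q : rat) : q ^+ 2 != q + 1.
Proof.
apply/eqP => E; have [|z Ez] := @algint_rat q.
  exists ('X^2 - ('X + 1%:P)); last first.
    by rewrite rootE rmorphB rmorphD /= map_polyXn map_polyX map_polyC /= !hornerE E subrr.
  rewrite monicE lead_coefDl ?lead_coefXn //.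
  by rewrite size_polyN size_polyXn size_XaddC.
move: E; rewrite Ez -rmorphXn -[1]/(1%:~R) -rmorphD => /intr_inj; rewrite expr2 => {}E.
have : (z <= -2) || (2 <= z) \/ z \in [:: -1; 0; 1] by rewrite !inE; lia.
by case=> [/orP[] /= ?|]; [nia|nia|rewrite !inE => /or3P[] /eqP Ez'; move: E; rewrite Ez'].
Qed.

End QuadraticExtension.

(** * Real cyclotomic fields *)

Lemma primitive_rootP (C : idomainType) (z : C) N : (0 < N)%N ->
  (forall k, z ^+ k = 1 <-> (N %| k)%N) -> N.-primitive_root z.
Proof.
move=> N0 zN; have [m zm mN] := prim_order_exists N0 ((zN N).2 (dvdnn N)).
suff -> : N = m by [].
by apply/eqP; rewrite eqn_dvd mN andbT; apply/zN/(prim_expr_order zm).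
Qed.

Section RootTransfer.

Variables (K : fieldType) (a b : K) (C : numClosedFieldType) (f : {rmorphism K -> C}).
Local Notation A := (quat a b).
Hypothesis aniso : forall x : A, qnorm x = 0 -> x = 0.
Variable y : A.
Hypotheses (y_norm : qnorm y = 1) (y_nonscalar : forall e, y != e%:A).

(** For [e = 1] or [-1], the norm of [y - e] is [2 - e * qtr y]; a trace 2 or -2 would make [y] a
    scalar. *)
Lemma nonscalar_qtr_sqr : qtr y ^+ 2 != 4.
Proof.
have norm_sub e : e * e = 1 -> qnorm (y - e%:A) = 2 - qtr y * e.
  move=> ee; have -> : 2 = qnorm y + e * e by rewrite y_norm ee.
  by rewrite !qnorm_def /qtr qscalarE !quatE /=; ring.
apply/eqP => E; have : (qtr y - 2) * (qtr y + 2) = 0.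
  by transitivity (qtr y ^+ 2 - 4); [ring|rewrite E subrr].
move/eqP; rewrite mulf_eq0 => /orP[/eqP T|/eqP T].
  have /aniso/eqP : qnorm (y - 1%:A) = 0 by rewrite norm_sub ?mulr1 // -opprB T oppr0.
  by rewrite subr_eq0 (negbTE (y_nonscalar _)).
have /aniso/eqP : qnorm (y - (-1)%:A) = 0.
  by rewrite norm_sub ?mulrNN ?mulr1 // mulrN mulr1 opprK addrC T.
by rewrite subr_eq0 (negbTE (y_nonscalar _)).
Qed.

Lemma root_pairE (z : C) k : z + z^-1 = f (qtr y) -> z != 0 ->
  z ^+ k = f (lucas_pair (qtr y) 1 k).1 * z + f (lucas_pair (qtr y) 1 k).2.
Proof.
move=> Ez z0; apply: root_power.
by rewrite -Ez rmorph1 mulrDl mulVf // addrK.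
Qed.

(** [y], [z] and [z^-1] are roots of one quadratic, so their powers share the coefficients [p], [q].
    If [z^k = 1], then [p z + q = p z^-1 + q], and [z] differs from [z^-1], so [p = 0] and
    [q = 1]. *)
Lemma power_eq1 (z : C) k : z + z^-1 = f (qtr y) -> z != 0 -> y ^+ k = 1 <-> z ^+ k = 1.
Proof.
move=> Ez z0; rewrite quat_power y_norm.
have := root_pairE k Ez z0.
have : (z^-1) ^+ k = _ := @root_pairE z^-1 k _ _; rewrite invrK addrC invr_eq0 => /(_ Ez z0).
move: (lucas_pair _ _ _) => [p q] /= EV E; split=> [|E1].
  move/eqP; rewrite -subr_eq0 -[X in _ - X]scale1r -addrA -scalerBl => /eqP.
  case/(nonscalar_indep y_nonscalar) => p0 /eqP; rewrite subr_eq0 => /eqP q1.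
  by rewrite E p0 q1 rmorph0 rmorph1 mul0r add0r.
have zz : z - z^-1 != 0.
  apply/eqP => zz; case/eqP: nonscalar_qtr_sqr; apply: (fmorph_inj f).
  rewrite rmorphXn rmorph_nat -Ez.
  have -> : (z + z^-1) ^+ 2 = (z - z^-1) ^+ 2 + 4 * (z * z^-1) by ring.
  by rewrite zz mulfV // expr0n add0r mulr1.
have p0 : p = 0.
  have : f p * (z - z^-1) = 0.
    have -> : f p * (z - z^-1) = (f p * z + f q) - (f p * z^-1 + f q) by ring.
    by rewrite -E -EV exprVn E1 invr1 subrr.
  by move/eqP; rewrite mulf_eq0 (negbTE zz) orbF fmorph_eq0 => /eqP.
move: E; rewrite p0 rmorph0 mul0r add0r E1 => /esym/eqP.
by rewrite fmorph_eq1 => /eqP ->; rewrite scale0r add0r scale1r.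
Qed.

Lemma primitive_transfer N : (0 < N)%N -> (forall k, y ^+ k = 1 <-> (N %| k)%N) ->
  exists2 z : C, N.-primitive_root z & z + z^-1 = f (qtr y).
Proof.
move=> N0 yN; set T := f (qtr y).
pose z := (T + sqrtC (T ^+ 2 - 4)) / 2; pose w := (T - sqrtC (T ^+ 2 - 4)) / 2.
have zw : z * w = 1.
  have -> : z * w = (T ^+ 2 - sqrtC (T ^+ 2 - 4) ^+ 2) / 4 by rewrite /z /w; field.
  by rewrite sqrtCK; field.
have z0 : z != 0 by apply/eqP => E; move/eqP: zw; rewrite E mul0r eq_sym oner_eq0.
have zV : z^-1 = w by apply: (mulfI z0); rewrite zw mulfV.
have Ez : z + z^-1 = T by rewrite zV /z /w; field.
exists z => //; apply: primitive_rootP => // k.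
by rewrite -(power_eq1 k Ez z0).
Qed.

End RootTransfer.

Section RealCyclotomic.

Variables (R : realType) (K : fieldExtType rat) (a b : K) (m : nat).
Local Notation A := (quat a b).
Hypothesis aniso : forall x : A, qnorm x = 0 -> x = 0.
Variable y : A.
Hypotheses (y_norm : qnorm y = 1) (y_nonscalar : forall e, y != e%:A).
Hypotheses (m0 : (0 < 2 * m)%N) (y_order : forall k, y ^+ k = 1 <-> (2 * m %| k)%N).

Lemma image_divring_closed (f : {rmorphism K -> R[i]}) (F : {pred K}) :
    GRing.divring_closed F ->
  GRing.divring_closed [pred c : R[i] | `[< exists2 x, x \in F & f x = c >]].
Proof.
move=> [F1 FB FV]; split=> [|c d|c d]; rewrite !inE.
- by apply/asboolP; exists 1; rewrite ?rmorph1.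
- move=> /asboolP[u Fu <-] /asboolP[v Fv <-]; apply/asboolP.
  by exists (u - v); rewrite ?FB ?rmorphB.
move=> /asboolP[u Fu <-] /asboolP[v Fv <-]; apply/asboolP.
by exists (u / v); rewrite ?FV ?fmorph_div.
Qed.

Lemma real_cyclotomic_of_trace (f : {rmorphism K -> R[i]}) :
    (forall F : {pred K}, GRing.divring_closed F -> qtr y \in F -> forall c, c \in F) ->
  is_real_cyclotomic R K m.
Proof.
move=> FK; have [z zprim Ez] := primitive_transfer f aniso y_norm y_nonscalar m0 y_order.
exists z => //; exists f => c; split=> [|[x <-] S Sdiv Sz].
  have Tdiv : GRing.divring_closed [pred x : K | true] by [].
  move=> /(_ _ (image_divring_closed f Tdiv)); rewrite !inE Ez.
  by case/(_ _)/asboolP => [|x _ <-]; [apply/asboolP; exists (qtr y)|exists x].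
apply: (FK [pred x | f x \in S]); last by rewrite inE -Ez.
case: Sdiv => S1 SB SV; split=> [|u v|u v]; rewrite !inE ?rmorph1 ?rmorphB ?fmorph_div //.
  exact: SB.
exact: SV.
Qed.

Lemma lucas_closed (F : {pred K}) (t : K) k : GRing.divring_closed F -> t \in F ->
  (lucas_pair t 1 k).1 \in F /\ (lucas_pair t 1 k).2 \in F.
Proof.
move=> Fdiv Ft; elim: k => [|k [F1 F2]] /=; first by rewrite divring0 //; case: Fdiv.
rewrite mul1r; split; last exact: divringN.
by apply: (divringD Fdiv) => //; apply: (divringM Fdiv).
Qed.

(** The given [zeta] need not be the root [z] attached to [y], but it is a power of [z], so
    [zeta + zeta^-1] is a rational expression in [z + z^-1]. *)
Lemma adjoin_full_of_cyclotomic : is_real_cyclotomic R K m -> <<1; qtr y>>%VS = fullv.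
Proof.
move=> [zeta zetaP [f f_adj]].
have [z zprim Ez] := primitive_transfer f aniso y_norm y_nonscalar m0 y_order.
have z0 : z != 0 by rewrite (prim_root_eq0 zprim) -lt0n.
have [j Ej] := prim_rootP zprim (prim_expr_order zetaP).
set F := [pred x : K | x \in <<1; qtr y>>%VS].
have Fdiv : GRing.divring_closed F := subfield_divring_closed <<1; qtr y>>%AS.
have Ft : qtr y \in F by rewrite inE memv_adjoin.
apply/eqP; rewrite eqEsubv subvf; apply/subvP => c _.
have : in_adjoin (zeta + zeta^-1) (f c) by apply/f_adj; exists c.
move=> /(_ _ (image_divring_closed f Fdiv)); rewrite !inE.
case/(_ _)/asboolP => [|x Fx /fmorph_inj <- //].
apply/asboolP; rewrite Ej -exprVn (root_pairE j Ez z0).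
rewrite (@root_pairE _ _ _ _ f y z^-1 j) ?invr_eq0 ?invrK 1?addrC //.
have [F1 F2] := lucas_closed j Fdiv Ft.
move: (lucas_pair _ _ _) F1 F2 => [p q] /= Fp Fq.
(* With [z^j = p z + q] and [z^-j = p z^-1 + q], this is the sum of the two powers. *)
exists (p * qtr y + q + q).
  by rewrite !(divringD Fdiv) // (divringM Fdiv).
by rewrite (rmorphD f (_ + _)) (rmorphD f (_ * _)) (rmorphM f p) -Ez; ring.
Qed.

End RealCyclotomic.

(** * Embedding in the Hamilton quaternions *)

Section HamiltonEmbedding.

Variables (R : rcfType) (K : fieldType) (a b : K) (f : {rmorphism K -> R}).
Hypotheses (fa : f a < 0) (fb : f b < 0).
Local Notation A := (quat a b).
Local Notation H := (quat (-1 : R) (-1 : R)).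
Let sa := Num.sqrt (- f a).
Let sb := Num.sqrt (- f b).

Definition hamilton_embed (x : A) : H :=
  Quat (-1) (-1) (f (qre x)) (sa * f (qi x)) (sb * f (qj x)) (sa * sb * f (qij x)).

Let Ea : f a = - sa ^+ 2.
Proof. by rewrite sqr_sqrtr ?opprK // oppr_ge0 ltW. Qed.
Let Eb : f b = - sb ^+ 2.
Proof. by rewrite sqr_sqrtr ?opprK // oppr_ge0 ltW. Qed.

Lemma hamilton_embedM x y : hamilton_embed (x * y) = hamilton_embed x * hamilton_embed y.
Proof.
apply: quat_eqP; rewrite !quatE /= !quatE /= !(rmorphD, rmorphB, rmorphN, rmorphM) /= ?Ea ?Eb; ring.
Qed.

Lemma hamilton_embedN1 : hamilton_embed (-1) = -1.
Proof. by apply: quat_eqP; rewrite ?quatE /= ?rmorphN ?rmorph1 ?rmorph0 ?oppr0 ?mulr0. Qed.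

Lemma hamilton_embed_norm x : qnorm (hamilton_embed x) = f (qnorm x).
Proof.
by rewrite !qnorm_def /= !(rmorphD, rmorphB, rmorphN, rmorphM, rmorphXn) /= Ea Eb; ring.
Qed.

Lemma hamilton_embed_qtr x : qtr (hamilton_embed x) = f (qtr x).
Proof. by rewrite /qtr /= rmorphMn. Qed.

Lemma hamilton_embed_inj : injective hamilton_embed.
Proof.
have sa0 : sa != 0 by rewrite gt_eqF // sqrtr_gt0 oppr_gt0.
have sb0 : sb != 0 by rewrite gt_eqF // sqrtr_gt0 oppr_gt0.
move=> [x0 x1 x2 x3] [y0 y1 y2 y3] [] /fmorph_inj-> /(mulfI sa0)/fmorph_inj->.
by move=> /(mulfI sb0)/fmorph_inj-> /(mulfI (mulf_neq0 sa0 sb0))/fmorph_inj->.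
Qed.

Lemma quat_aniso (x : A) : qnorm x = 0 -> x = 0.
Proof.
move=> x0; apply: hamilton_embed_inj; rewrite (@hamilton_aniso _ (hamilton_embed x)).
  by apply: quat_eqP; rewrite /= ?rmorph0 ?mulr0.
by rewrite hamilton_embed_norm x0 rmorph0.
Qed.

Section Classification.

Variables (gT : finGroupType) (G : {group gT}) (phi : gT -> A) (e : gT).
Hypotheses (phi_inj : {in G &, injective phi})
  (phiM : {in G &, forall g h, phi (g * h)%g = phi g * phi h})
  (phi_norm : {in G, forall g, qnorm (phi g) = 1})
  (Ge : e \in G) (phi_e : phi e = -1).

Lemma hamilton_unit_rep : unit_rep G (hamilton_embed \o phi) e.
Proof.
split=> //= [g h Gg Gh|g h Gg Gh /hamilton_embed_inj|g Gg|].
- by rewrite phiM // hamilton_embedM.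
- exact: phi_inj.
- by rewrite hamilton_embed_norm phi_norm // rmorph1.
by rewrite phi_e hamilton_embedN1.
Qed.

(** The trace equations are obtained in R and descend to K because the place [f] is injective. *)
Lemma norm_one_classification : ~~ abelian G ->
  (exists m x y, [/\ (1 < m)%N, binary_dihedral m G,
      [/\ x \in G, y \in G, phi y * phi x != phi x * phi y & G = <<[set y; x]>>%G],
      #[y]%g = (2 * m)%N & qtr (phi x) = 0 /\ qtr (phi (y * x)%g) = 0])
  \/ exists z1 z2, let t := qtr (phi z1) in
     [/\ [/\ z1 \in G, z2 \in G, phi z1 * phi z2 != phi z2 * phi z1 & G = <<[set z1; z2]>>%G],
         qtr (phi z2) = t, qtr (phi (z1 * z2)%g) = 1
       & [\/ binary_polyhedral 3 G /\ t = 1, binary_polyhedral 4 G /\ t ^+ 2 = 2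
          | binary_polyhedral 5 G /\ t ^+ 2 = t + 1]].
Proof.
have hrep := hamilton_unit_rep.
have comm g h : g \in G -> h \in G -> ~ commute g h -> phi g * phi h != phi h * phi g.
  move=> Gg Gh Ngh; apply/eqP => E; apply: Ngh; apply: phi_inj; rewrite ?groupM //.
  by rewrite !phiM.
have eqf u v : f u = f v -> u = v := @fmorph_inj _ _ f u v.
move=> nonab; have [[z [Gz z1 ze inv]]|] := dichotomy hrep nonab.
  left; have [m [x [y [m1 dG [Gx Gy Nyx defG] oy [tx tyx]]]]] :=
    dihedral_case hrep nonab Gz z1 ze inv.
  exists m, x, y; split=> //; first by split=> //; apply: comm.
  split; apply: eqf; rewrite rmorph0.
    by rewrite -tx /= hamilton_embed_qtr.
  by rewrite -tyx /= hamilton_embed_qtr.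
move=> [z1 [z2 [[Gz1 Gz2 N12 Et t12] bound t0 tcase]]]; right; exists z1, z2 => t.
have ft : qtr (hamilton_embed (phi z1)) = f t := hamilton_embed_qtr _.
have tE : (f t = 1 -> t = 1) * (f t ^+ 2 = 2 -> t ^+ 2 = 2) * (f t ^+ 2 = f t + 1 -> t ^+ 2 = t + 1).
  split; [split=> E|move=> E]; apply: eqf; first by rewrite E; apply/esym/rmorph1.
    by rewrite rmorphXn E rmorph_nat.
  by rewrite rmorphXn E -(rmorph1 f) -rmorphD.
have Ez2 : qtr (phi z2) = t by apply: eqf; rewrite -ft -[LHS]hamilton_embed_qtr; exact/esym.
have E12 : qtr (phi (z1 * z2)%g) = 1.
  by apply: eqf; rewrite rmorph1 -hamilton_embed_qtr.
have N12' := comm z1 z2 Gz1 Gz2 N12.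
case: tcase => tcase.
- have [bG defG] := tetrahedral_case hrep Gz1 Gz2 Et t12 bound tcase.
  by split=> //; apply: Or31; split=> //; apply: tE.1.1; rewrite -ft.
- have [bG defG] := octahedral_case hrep Gz1 Gz2 Et t12 bound tcase t0.
  by split=> //; apply: Or32; split=> //; apply: tE.1.2; rewrite -ft.
have [bG defG] := icosahedral_case hrep Gz1 Gz2 Et t12 bound tcase.
by split=> //; apply: Or33; split=> //; apply: tE.2; rewrite -ft.
Qed.

End Classification.

End HamiltonEmbedding.

(** * Reduced norm one groups *)

Section NumberFieldDimension.

Variable K : fieldExtType rat.

Lemma pnatr_fieldExt n : (n.+1%:R : K) != 0.
Proof. by rewrite -(rmorph_nat (in_alg K)) fmorph_eq0 pnatr_eq0. Qed.

Lemma dim1_line : \dim {:K} = 1%N -> (1%VS : {vspace K}) = fullv.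
Proof. by move=> dK; apply/eqP; rewrite eqEdim subvf dK dimv1. Qed.

Lemma rational_of_dim1 : \dim {:K} = 1%N -> forall c : K, exists q : rat, c = q%:A.
Proof. by move=> dK c; apply/vlineP; rewrite dim1_line ?memvf. Qed.

Lemma dim1_of_line : (forall c : K, c \in 1%VS) -> \dim {:K} = 1%N.
Proof.
move=> K1; have -> : fullv = 1%VS :> {vspace K}.
  by apply/eqP; rewrite eqEsubv subvf andbT; apply/subvP => c _; apply: K1.
exact: dimv1.
Qed.

Lemma dim2_of_quadratic (t : K) (p q : rat) :
    t ^+ 2 = p *: t + q%:A -> (forall u : rat, u ^+ 2 != p * u + q) ->
    (forall F : {pred K}, GRing.divring_closed F -> t \in F -> forall c, c \in F) ->
  \dim {:K} = 2%N.
Proof.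
move=> Et irr FK; have tK := FK _ (subfield_divring_closed <<1; t>>%AS) (memv_adjoin _ _).
have fullE : <<1; t>>%VS = fullv.
  by apply/eqP; rewrite eqEsubv subvf; apply/subvP => c _; apply: tK.
have := dim_adjoin_quadratic Et; rewrite fullE.
have : (0 < \dim {:K})%N := adim_gt0 _.
case dK : (\dim {:K}) => [|[|[|n]]] // _ _.
have [u Eu] := rational_of_dim1 dK t; case/eqP: (irr u).
apply: (fmorph_inj (in_alg K)); move: Et; rewrite Eu.
by rewrite -[u%:A]/(in_alg K u) -[q%:A]/(in_alg K q) -mulr_algl -[p%:A]/(in_alg K p)
  -rmorphXn -rmorphM -rmorphD.
Qed.

End NumberFieldDimension.

Section NoncommutingBasis.

Variables (K : fieldExtType rat) (a b : K).
Local Notation A := (quat a b).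

Lemma Qbasis_noncommuting (S : {pred A}) : contains_Qbasis S ->
  exists u v, [/\ u \in S, v \in S & u * v != v * u].
Proof.
move=> [X XS Xbasis]; apply: contrapT => comm.
have commX u v : u \in X -> v \in X -> u * v = v * u.
  move=> Xu Xv; apply/eqP; apply: contrapT => /negP Nuv; apply: comm.
  by exists u, v; split=> //; apply: XS.
have ext (w : A) : (forall u, u \in X -> w * u = u * w) -> forall v, w * v = v * w.
  move=> Hw v; have [c [-> _]] := Xbasis v.
  rewrite mulr_sumr mulr_suml; apply: eq_bigr => i _.
  by rewrite -scalerAr -scalerAl Hw // mem_nth.
have all_comm (u v : A) : u * v = v * u.
  by apply: (ext u) => w Xw; apply/esym/(ext w) => w' Xw'; apply: commX.
have := all_comm (Quat a b 0 1 0 0) (Quat a b 0 0 1 0).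
rewrite quat_ij quat_ji => /(congr1 (@qij _ _ _)); rewrite quatE /= => /eqP.
by rewrite -subr_eq0 opprK -mulr2n (negbTE (pnatr_fieldExt K 1)).
Qed.

End NoncommutingBasis.

Section IsomorphicGroup.

Variables (K : fieldExtType rat) (a b : K) (L : {pred quat a b}).
Local Notation A := (quat a b).
Local Notation N := (norm_one L).
Hypothesis aniso : forall x : A, qnorm x = 0 -> x = 0.
Variables (gT : finGroupType) (G : {group gT}) (phi : gT -> A).
Hypotheses (phi_inj : {in G &, injective phi})
  (phiM : {in G &, forall g h, phi (g * h)%g = phi g * phi h})
  (phiE : forall x, x \in N <-> exists2 g, g \in G & phi g = x).

Lemma phi_in g : g \in G -> phi g \in N.
Proof. by move=> Gg; apply/phiE; exists g. Qed.

Lemma phi_norm : {in G, forall g, qnorm (phi g) = 1}.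
Proof. by move=> g /phi_in /andP[_ /eqP]. Qed.

Lemma phi1 : phi 1%g = 1.
Proof.
have f10 : phi 1%g != 0.
  apply/eqP => E; have := phi_norm (group1 G).
  by rewrite E qnorm_def /= expr0n /= !mulr0 !subr0 addr0 => /esym/eqP; rewrite oner_eq0.
by apply: (quat_mulfI aniso f10); rewrite -phiM // mulg1 mulr1.
Qed.

Lemma phiX g k : g \in G -> phi (g ^+ k)%g = phi g ^+ k.
Proof.
move=> Gg; elim: k => [|k IH]; first by rewrite expg0 phi1.
by rewrite expgS exprS phiM ?groupX // IH.
Qed.

Lemma phiV g : g \in G -> phi g^-1%g = qconj (phi g).
Proof.
move=> Gg; apply: (quat_mulfI aniso (x := phi g)).
  apply/eqP => E; have := phi_norm Gg.
  by rewrite E qnorm_def /= expr0n /= !mulr0 !subr0 addr0 => /esym/eqP; rewrite oner_eq0.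
by rewrite -phiM ?groupV // mulgV phi1 qnormE phi_norm // scale1r.
Qed.

Lemma phi_commute g h : g \in G -> h \in G -> phi g * phi h = phi h * phi g -> commute g h.
Proof. by move=> Gg Gh E; apply: phi_inj; rewrite ?groupM // !phiM. Qed.

Lemma phi_order g k : g \in G -> phi g ^+ k = 1 <-> (#[g]%g %| k)%N.
Proof.
move=> Gg; rewrite order_dvdn -phiX // -phi1; split=> [/phi_inj|/eqP->//].
by move=> /(_ (groupX k Gg) (group1 G)) ->.
Qed.

Lemma phi_scalar g e : g \in G -> phi g = e%:A -> (g ^+ 2 = 1)%g.
Proof.
move=> Gg Eg; apply: phi_inj; rewrite ?groupX // phiX // phi1.
have := phi_norm Gg; rewrite Eg qnorm_def qscalarE /= expr0n /= !mulr0 !subr0 addr0 => E.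
by rewrite -qscalarE exprZn E expr1n scale1r.
Qed.

Lemma Qbasis_of_trace (y : A) : ~~ abelian G -> y \in N -> <<1; qtr y>>%VS = fullv ->
  contains_Qbasis N.
Proof.
move=> nonab /phiE[g Gg <-{y}] Ky.
pose s := [seq phi g | g <- enum G].
have Ns x : x \in N <-> x \in s.
  rewrite phiE; split=> [[h Gh <-]|/mapP[h]]; first by apply: map_f; rewrite mem_enum.
  by rewrite mem_enum => Gh ->; exists h.
have sphi h : h \in G -> phi h \in s by move=> Gh; apply/Ns/phi_in.
have sM x y : x \in s -> y \in s -> x * y \in s.
  move=> /Ns/phiE[h Gh <-] /Ns/phiE[k Gk <-]; rewrite -phiM //.
  by apply: sphi; rewrite groupM.
have [h [k [Gh Gk Nhk]]] : exists h k, [/\ h \in G, k \in G & phi h * phi k != phi k * phi h].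
  apply: contrapT => comm; case/negP: nonab; apply/centsP => h Gh k Gk.
  apply: phi_commute => //; apply/eqP; apply: contrapT => /negP Nhk.
  by apply: comm; exists h, k.
have [X Xs Xbasis] : contains_Qbasis [pred x | x \in s].
  apply: (Qbasis_of_scalars aniso sM (sphi h Gh) (sphi k Gk) Nhk).
  apply: (adjoin_ind Ky (P := fun c => spans (in_alg K) s c%:A)) => [x y Hx Hy|q x Hx|x Hx|].
  - by rewrite scalerDl; apply: spansD.
  - by rewrite rat_scale_algE -scalerA; apply: (spansZ (f := in_alg K)).
  - rewrite -[(_ * _)%:A]scalerA -[x *: _]mulr_algl; apply: (Qspan_mul sM) => //.
    by rewrite -add_qconj -phiV //; apply: spansD; apply/mem_spans/sphi; rewrite ?groupV.
  by rewrite scale1r -phi1; apply/mem_spans/sphi/group1.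
by exists X => // x /Xs; apply: (Ns x).2.
Qed.

(** [x^2 = y^3] commutes with [y] while [x] does not, so [x] has trace 0 and [x^2 = -1]. Hence
    [z^c = -1], and the coefficients of [z^c] over 1 and [z] give equations for the trace of [z]. *)
Lemma polyhedral_trace c : c \in [:: 4; 5]%N -> binary_polyhedral c G ->
  exists2 z, z \in G & let t := qtr (phi z) in
    if c == 4%N then t ^+ 2 = 2 else t ^+ 2 = t + 1.
Proof.
move=> c45 isoG; have c345 : c \in [:: 3; 4; 5]%N by rewrite inE c45 orbT.
have nonab := polyhedral_nonabelian c345 isoG.
have /homg_polyhedralP[x [y [z [EG Ex Ey Ez]]]] := isoGrp_hom isoG.
have Gz : z \in G by rewrite EG mem_gen // inE cycle_id orbT.
have GxGy : x \in G /\ y \in G.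
  by split; rewrite EG mem_gen // inE mem_gen ?inE ?cycle_id ?orbT.
have [Gx Gy] := GxGy.
have Eyz : (y * z = x)%g by apply: (mulgI x); rewrite mulgA -Ex.
have Nyz : ~ commute y z.
  move=> Cyz; case/negP: nonab; rewrite EG (gen_polyhedral Ex Ey Ez) abelian_gen.
  have Czy : commute z (z^-1 * y)%g.
    by apply: commuteM; [apply/commuteV/commute_refl|apply: commute_sym].
  by apply/centsP => u /set2P[]-> v /set2P[]->; rewrite /commute // Czy.
have Nxy : ~ commute x y.
  rewrite -Eyz /commute -mulgA => /mulgI Czy; exact: Nyz.
have Nxy' : phi x * phi y != phi y * phi x.
  by apply/eqP => E; apply: Nxy; apply: phi_commute.
have X2 : phi x ^+ 2 = -1.
  have CX : phi x * phi x * phi y = phi y * (phi x * phi x).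
    rewrite -!phiM ?groupM //; congr phi; rewrite -expg2 Ex -Ey.
    by rewrite -expgSr -expgS.
  have t0 : qtr (phi x) = 0.
    apply/eqP; apply: contraNT Nxy' => t0; apply/eqP/(scalerI t0).
    move: CX; rewrite sqr_quat mulrBl mulrBr mul_scalarC => /subIr.
    by rewrite -scalerAl -scalerAr.
  by rewrite expr2 sqr_quat t0 scale0r phi_norm // scale1r sub0r.
have Zc : phi z ^+ c = -1 by rewrite -phiX // Ez -Ex phiX.
have Nz e : phi z != e%:A.
  apply/eqP => E; apply: Nyz; apply: phi_commute => //.
  by rewrite E mul_scalarC.
exists z => // t; move: Zc; rewrite quat_power phi_norm // -/t.
move=> /eqP; rewrite -subr_eq0 -addrA opprK -[X in _ + (_ + X)]scale1r -scalerDl => /eqP.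
move=> /(nonscalar_indep Nz).
move: c45; rewrite !inE => /orP[]/eqP->; rewrite /= => -[E1 E2]; apply/eqP.
  by rewrite -subr_eq0 -oppr_eq0 -E2; apply/eqP; ring.
(* The equations are [t^4 - 3 t^2 + 1 = 0] and [1 - (t^3 - 2 t) = 0]; the first plus [t] times the
   second is [- (t^2 - t - 1)]. *)
rewrite -subr_eq0 -oppr_eq0 -[X in _ == X]E1 -[X in _ == X]addr0 -[X in _ == _ + X](mulr0 t) -[X in _ == _ + t * X]E2.
by apply/eqP; ring.
Qed.

End IsomorphicGroup.

(** Here [zeta = -1]. This serves to exclude the binary dihedral group of order 4, which is cyclic,
    when K is larger than the rationals. *)
Lemma real_cyclotomic1 (R : realType) (K : fieldExtType rat) :
  is_real_cyclotomic R K 1 -> \dim {:K} = 1%N.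
Proof.
move=> [zeta zetaP [f f_adj]]; apply: dim1_of_line => c.
have : zeta ^+ 2 == 1 by rewrite (prim_expr_order zetaP).
rewrite sqrf_eq1 => /orP[]/eqP Ez.
  have := prim_order_dvd zetaP 1; rewrite Ez expr1n eqxx => /idP.
  by rewrite dvdn1.
have one_div := subfield_divring_closed (1%AS : {subfield K}).
have : in_adjoin (zeta + zeta^-1) (f c) by apply/f_adj; exists c.
move=> /(_ _ (image_divring_closed f one_div)); rewrite !inE Ez invrN1.
case/(_ _)/asboolP => [|x Fx /fmorph_inj <- //].
apply/asboolP; exists (-1 - 1); last by rewrite rmorphB rmorphN rmorph1.
by rewrite memvB ?memvN ?mem1v.
Qed.

Section NormOneGroup.

Variables (R : realType) (K : fieldExtType rat) (a b : K) (L : {pred quat a b}).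
Hypothesis L_order : is_order L.
Variable f : {rmorphism K -> R}.
Hypotheses (fa : f a < 0) (fb : f b < 0).
Local Notation A := (quat a b).
Local Notation N := (norm_one L).

Let aniso (x : A) : qnorm x = 0 -> x = 0 := @quat_aniso R K a b f fa fb x.

Lemma norm_oneM x y : x \in N -> y \in N -> x * y \in N.
Proof.
have [[_ _ LM] _ _] := L_order.
by move=> /andP[Lx /eqP nx] /andP[Ly /eqP ny]; rewrite inE LM //= qnormM nx ny mulr1.
Qed.

Lemma norm_one1 : 1 \in N.
Proof. by have [[L1 _ _] _ _] := L_order; rewrite inE L1 qnorm1 /=. Qed.

Lemma norm_oneN1 : -1 \in N.
Proof.
by rewrite inE (orderN L_order) ?qnorm_def ?quatE /=; last (by have [[L1]] := L_order);
  apply/eqP; ring.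
Qed.

(** The inverse is the conjugate [qtr x - x], which stays in the order because the reduced trace is
    integral. *)
Lemma norm_oneV x : x \in N -> exists2 y, y \in N & x * y = 1.
Proof.
move=> /andP[Lx /eqP nx]; have [[L1 LB _] _ _] := L_order.
exists (qconj x); last by rewrite qnormE nx scale1r.
rewrite inE qnorm_conj nx eqxx andbT.
have -> : qconj x = (qtr x)%:A - x by rewrite -add_qconj addrC addKr.
by rewrite LB // (orderZ L_order) //; apply: (order_qtr L_order fa fb).
Qed.

Section FromBasis.

Hypothesis finN : exists s : seq A, forall x, x \in N <-> x \in s.
Hypothesis basisN : contains_Qbasis N.

Lemma norm_one_group : exists (gT : finGroupType) (G : {group gT}),
  mul_isog N G /\ ~~ abelian G.
Proof.
have [s Es] := finN.
have [|x y /Es Nx /Es Ny|x /Es Nx|gT [G [phi [inj M E]]]] := @regular_group K a b s.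
- exact/Es/norm_one1.
- exact/Es/norm_oneM.
- by have [y Ny xy] := norm_oneV Nx; exists y => //; apply/Es.
exists gT, G; split; first by exists phi; split=> // x; rewrite Es; apply: E.
have [u [v [/Es/E[g Gg <-] /Es/E[h Gh <-] Ngh]]] := Qbasis_noncommuting basisN.
by apply: contra Ngh => /centsP/(_ g Gg h Gh) E'; rewrite -!M // E'.
Qed.

(** Over the rationals the trace is an integer strictly between -2 and 2, so [y^3], [y^4] or [y^6]
    is 1. An even order above 2 can then only be 4 or 6. *)
Lemma dihedral_totient m (y : A) : \dim {:K} = 1%N -> (1 < m)%N -> y \in N ->
  (forall k, y ^+ k = 1 <-> (2 * m %| k)%N) -> (forall e, y != e%:A) -> totient (2 * m) = 2%N.
Proof.
move=> dK m1 /andP[Ly /eqP ny] oy Ny.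
have [q Eq] := rational_of_dim1 dK (qtr y).
have [|z Ez] := @algint_rat q.
  by apply/(algint_fmorph (in_alg K)); rewrite /= -Eq; apply: (order_qtr L_order fa fb).
have Tz : qtr y = z%:~R by rewrite Eq Ez -[_%:A]/(in_alg K _) rmorph_int.
have zR : z%:~R = qtr (hamilton_embed f y) :> R.
  by rewrite hamilton_embed_qtr Tz rmorph_int.
have nR : qnorm (hamilton_embed f y) = 1 by rewrite (hamilton_embed_norm fa fb) ny rmorph1.
have z4 : z ^+ 2 != 4.
  apply/eqP => E; case/eqP: (nonscalar_qtr_sqr aniso ny Ny).
  by rewrite Tz -rmorphXn E.
have zle : z <= 2 by rewrite -(ler_int R) zR; apply: hamilton_qtr_le2.
have zge : - z <= 2.
  rewrite -(ler_int R) rmorphN /= zR -qtrN; apply: hamilton_qtr_le2.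
  by apply: etrans nR; rewrite !qnorm_def !quatE /=; ring.
have : z \in [:: -1; 0; 1].
  rewrite !inE; move: z4; rewrite expr2; have : z \in [:: -2; -1; 0; 1; 2] by rewrite !inE; lia.
  by rewrite !inE => /or4P[|||/orP[]] /eqP->.
have yp k := quat_power y k; rewrite ny Tz in yp.
rewrite !inE => /or3P[]/eqP E; rewrite {}E in yp.
- have : y ^+ 3 = 1.
    by rewrite yp; apply: quat_eqP; rewrite !quatE /=; ring.
  move/oy/dvdn_leq => /(_ isT); lia.
- have : y ^+ 4 = 1.
    by rewrite yp; apply: quat_eqP; rewrite !quatE /=; ring.
  move/oy/dvdn_leq => /(_ isT) m2; have -> : m = 2%N by lia.
  by [].
have : y ^+ 6 = 1.
  by rewrite yp; apply: quat_eqP; rewrite !quatE /=; ring.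
move/oy => m6; have := dvdn_leq (isT : (0 < 6)%N) m6 => m3.
have [E|->] : m = 2%N \/ m = 3%N by lia.
  by rewrite E in m6.
by [].
Qed.

Lemma norm_one_cases : exists (gT : finGroupType) (G : {group gT}), mul_isog N G /\
  [\/ \dim {:K} = 1%N /\ binary_polyhedral 3 G,
      \dim {:K} = 2%N /\ (binary_polyhedral 4 G \/ binary_polyhedral 5 G)
    | exists m, [/\ (0 < m)%N, binary_dihedral m G, is_real_cyclotomic R K m
        & \dim {:K} = 1%N -> totient (2 * m) = 2%N]].
Proof.
have [gT [G [[phi [inj M E]] nonab]]] := norm_one_group.
exists gT, G; split; first by exists phi.
have [e Ge Ee] : exists2 g, g \in G & phi g = -1 := (E _).1 norm_oneN1.
have nphi := phi_norm E.
have Nnorm x : x \in N -> qnorm x = 1 by case/andP=> _ /eqP.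
have [] := norm_one_classification fa fb inj M nphi Ge Ee nonab.
  move=> [m [x [y [m1 dG [Gx Gy Nyx defG] oy [tx tyx]]]]].
  have FK (F : {pred K}) : GRing.divring_closed F -> qtr (phi y) \in F -> forall c, c \in F.
    move=> Fdiv Fy; apply: (field_of_traces aniso M E Nnorm Fdiv Gy Gx defG Nyx Fy _ _ basisN).
      by rewrite tx divring0.
    by rewrite tyx divring0.
  have m0 : (0 < 2 * m)%N by rewrite muln_gt0 /= ltnW.
  have yo k : phi y ^+ k = 1 <-> (2 * m %| k)%N by rewrite -oy; apply: (phi_order aniso inj M E).
  have Ny c : phi y != c%:A.
    by apply: contra Nyx => /eqP->; rewrite mul_scalarC.
  apply: Or33; exists m; split=> //; first exact: ltnW.
    pose emb : {rmorphism K -> R[i]} := (real_complex R \o f : {rmorphism K -> R[i]}).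
    exact: (real_cyclotomic_of_trace aniso (nphi _ Gy) Ny m0 yo emb FK).
  by move=> dK; apply: (dihedral_totient dK m1 (phi_in E Gy) yo Ny).
move=> [z1 [z2 /= [[Gz1 Gz2 Nz defG] t2 t12 tcase]]].
have FK (F : {pred K}) : GRing.divring_closed F -> qtr (phi z1) \in F -> forall c, c \in F.
  move=> Fdiv Ft; apply: (field_of_traces aniso M E Nnorm Fdiv Gz1 Gz2 defG Nz Ft _ _ basisN).
    by rewrite t2.
  by rewrite t12; case: Fdiv.
case: tcase => -[bG tE].
(* All three traces are 1, so the prime field already contains them. *)
- apply: Or31; split=> //; apply: dim1_of_line => c.
  by apply: (FK _ (subfield_divring_closed 1%AS)); rewrite inE tE mem1v.
- apply: Or32; split; last by left.
  apply: (@dim2_of_quadratic K _ 0 2 _ _ FK).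
    by rewrite tE scale0r add0r scaler_nat.
  by move=> u; rewrite mul0r add0r rat_sqr2.
apply: Or32; split; last by right.
apply: (@dim2_of_quadratic K _ 1 1 _ _ FK); first by rewrite tE !scale1r.
by move=> u; rewrite mul1r rat_golden.
Qed.

End FromBasis.

Section ToBasis.

Variables (gT : finGroupType) (G : {group gT}).
Hypothesis isoG : mul_isog N G.

Lemma Qbasis_of_polyhedral3 : \dim {:K} = 1%N -> binary_polyhedral 3 G -> contains_Qbasis N.
Proof.
move=> dK bG; have [phi [inj M E]] := isoG.
apply: (Qbasis_of_trace aniso inj M E (polyhedral_nonabelian _ bG) norm_one1) => //.
by apply/eqP; rewrite eqEsubv subvf -(dim1_line dK) subv_adjoin.
Qed.

Lemma Qbasis_of_polyhedral c : c \in [:: 4; 5]%N -> \dim {:K} = 2%N -> binary_polyhedral c G ->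
  contains_Qbasis N.
Proof.
move=> c45 dK bG; have [phi [inj M E]] := isoG.
have nonab : ~~ abelian G by apply: (polyhedral_nonabelian _ bG); rewrite inE c45 orbT.
have [z Gz /= tz] := polyhedral_trace aniso inj M E c45 bG.
apply: (Qbasis_of_trace aniso inj M E nonab (phi_in E Gz)); apply: adjoin_full => //.
apply/vlineP => -[q Eq]; move: tz; rewrite Eq -[q%:A]/(in_alg K q) -rmorphXn.
case: (c == 4%N) => Eq2.
  by case/eqP: (rat_sqr2 q); apply: (fmorph_inj (in_alg K)); rewrite Eq2 rmorph_nat.
by case/eqP: (rat_golden q); apply: (fmorph_inj (in_alg K)); rewrite Eq2 rmorphD rmorph1.
Qed.

Lemma Qbasis_of_dihedral m : (1 < m)%N -> binary_dihedral m G ->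
  (\dim {:K} = 1%N \/ is_real_cyclotomic R K m) -> contains_Qbasis N.
Proof.
move=> m1 dG KE; have [phi [inj M E]] := isoG.
have [x [y [defG _ Exy oy]]] := binary_dihedral_gen (ltnW m1) dG.
have [Gx Gy] : x \in G /\ y \in G by rewrite defG !mem_gen ?set21 ?set22.
have y2 : (y ^+ 2 != 1)%g.
  rewrite -order_dvdn oy; apply/negP => /dvdn_leq => /(_ isT); lia.
have nonab : ~~ abelian G.
  apply: contra y2 => /centsP/(_ x Gx y Gy) Cxy.
  by rewrite expgS expg1 -{1}(invgK y) -Exy Cxy mulgK mulVg.
case: KE => [dK|cK].
  apply: (Qbasis_of_trace aniso inj M E nonab norm_one1).
  by apply/eqP; rewrite eqEsubv subvf -(dim1_line dK) subv_adjoin.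
apply: (Qbasis_of_trace aniso inj M E nonab (phi_in E Gy)).
apply: (@adjoin_full_of_cyclotomic R K a b m aniso _ _ _ _ _ cK).
- exact: (phi_norm E).
- by move=> e; apply: contra y2 => /eqP /(phi_scalar aniso inj M E Gy)->.
- by rewrite muln_gt0 /= ltnW.
by move=> k; rewrite -oy; apply: (phi_order aniso inj M E).
Qed.

End ToBasis.

End NormOneGroup.

Theorem theorem3p2p12 (R : realType) (K : fieldExtType rat) (a b : K)
    (a_neq0 : a != 0) (b_neq0 : b != 0)
    (K_real : totally_real K R) (A_def : totally_definite a b R)
    (L : {pred quat a b}) (L_order : is_order L) :
  [/\ \dim {:K} = 1%N ->
        (contains_Qbasis (norm_one L) <->
         mul_isog_to (norm_one L) binary_tetrahedral \/
         exists m : nat,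
           [/\ (0 < m)%N, mul_isog_to (norm_one L) (binary_dihedral m)
             & totient (2 * m) = 2%N]),
      \dim {:K} = 2%N ->
        (contains_Qbasis (norm_one L) <->
         (mul_isog_to (norm_one L) binary_octahedral \/
          mul_isog_to (norm_one L) binary_icosahedral) \/
         exists m : nat,
           [/\ (0 < m)%N, mul_isog_to (norm_one L) (binary_dihedral m)
             & is_real_cyclotomic R K m])
    & (2 < \dim {:K})%N ->
        (contains_Qbasis (norm_one L) <->
         exists m : nat,
           [/\ (0 < m)%N, mul_isog_to (norm_one L) (binary_dihedral m)
             & is_real_cyclotomic R K m])].
Proof.
have [sigma [sigma_neg sigma_indep]] := totally_definite_places a_neq0 b_neq0 A_def.
have finN := norm_one_finite a_neq0 b_neq0 sigma_neg sigma_indep L_order.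
have dim_gt0 : (0 < \dim {:K})%N by rewrite adim_gt0.
have [fa fb] := sigma_neg (Ordinal dim_gt0).
have cases := norm_one_cases L_order fa fb finN.
have dihedral m : (1 < \dim {:K})%N -> (0 < m)%N ->
    mul_isog_to (norm_one L) (binary_dihedral m) -> is_real_cyclotomic R K m ->
    contains_Qbasis (norm_one L).
  move=> dK m0 [gT [G [dG isoG]]] cK.
  have m1 : (1 < m)%N.
    case: m m0 cK {dG} => [|[|m]] // _ cK; move: dK; by rewrite (real_cyclotomic1 cK).
  by apply: (Qbasis_of_dihedral L_order fa fb isoG m1 dG); right.
split=> dK; split.
- move=> /cases[gT [G [isoG]]] [[_ bG]|[d2]|[m [m0 dG cK tm]]].
  + by left; exists gT, G.
  + by rewrite dK in d2.
  by right; exists m; split=> //; [exists gT, G|apply: tm].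
- move=> [[gT [G [bG isoG]]]|[m [m0 [gT [G [dG isoG]]] tm]]].
    exact: (Qbasis_of_polyhedral3 L_order fa fb isoG dK bG).
  apply: (Qbasis_of_dihedral L_order fa fb isoG _ dG); last by left.
  (* [m = 1] is excluded because the totient of 2 is 1. *)
  by case: m m0 tm {dG} => [|[|m]].
- move=> /cases[gT [G [isoG]]] [[d1]|[_ bG]|[m [m0 dG cK tm]]].
  + by rewrite dK in d1.
  + by left; case: bG => bG; [left|right]; exists gT, G.
  by right; exists m; split=> //; exists gT, G.
- move=> [[|]|[m [m0 dG cK]]].
  + by move=> [gT [G [bG isoG]]]; apply: (Qbasis_of_polyhedral fa fb isoG _ dK bG).
  + by move=> [gT [G [bG isoG]]]; apply: (Qbasis_of_polyhedral fa fb isoG _ dK bG).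
  by apply: (dihedral m) => //; rewrite dK.
- move=> /cases[gT [G [isoG]]] [[d1]|[d2 _]|[m [m0 dG cK tm]]].
  + by rewrite d1 in dK.
  + by rewrite d2 in dK.
  by exists m; split=> //; exists gT, G.
by move=> [m [m0 dG cK]]; apply: (dihedral m) => //; apply: ltnW.
Qed.
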